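(* Let $\Phi$ be an irreducible (crystallographic) root system in $V=\mathbb{R}^\ell$ with simple roots $\Delta$ and positive system $\Phi^+$, and let $\Sigma\subseteq\Phi^+$. The following are equivalent: (1) $\Sigma$ is Worpitzky-compatible; (2) $\Sigma$ is $2$-locally compatible; (3) if $\Phi$ is not of type $G_2$, then $\Sigma$ is negatively coclosed; if $\Phi$ is of type $G_2$, then $\Sigma$ is negatively coclosed or $\Sigma$ is one of the seven sets $\{\alpha_2\}\cup S$ with $\emptyset\neq S\subseteq\{2\alpha_1+\alpha_2,\,3\alpha_1+\alpha_2,\,3\alpha_1+2\alpha_2\}$, where $\Delta=\{\alpha_1,\alpha_2\}$ and $\alpha_2$ is the unique long simple root.
   Context: $V=\mathbb{R}^\ell$ carries the standard inner product $(\cdot,\cdot)$; $\Delta=\{\alpha_1,\dots,\alpha_\ell\}$. For $\alpha\in\Phi^+$ and $n\in\mathbb{Z}$ put $H_\alpha^n=\{x\in V\mid (\alpha,x)=n\}$. Alcoves: an alcove is a connected component of $V\setminus\bigcup_{\alpha\in\Phi^+,n\in\mathbb{Z}}H_\alpha^n$; its closure is an $\ell$-simplex. A face of a simplex is the convex hull of a subset of its vertices, a facet is a face which is an $(\ell-1)$-simplex; faces of an alcove mean faces of its closure. A wall of an alcove $A$ is a hyperplane supporting a facet of $A$. The ceilings of $A$ are the walls not passing through the origin and having the origin on the same side as $A$. The upper closure $A^\diamondsuit$ is the union of $A$ and its facets supported by ceilings of $A$. The fundamental parallelepiped is $P^\diamondsuit=\{x\in V\mid 0<(\alpha_i,x)\le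 1,\ 1\le i\le\ell\}$. Worpitzky-compatible: $\Sigma\subseteq\Phi^+$ is (Worpitzky-)compatible in $\Phi$ if for every alcove $A\subseteq P^\diamondsuit$ and every $\alpha\in\Sigma$, $n_\alpha\in\mathbb{Z}$, the set $A^\diamondsuit\cap H_\alpha^{n_\alpha}$ is either empty or contained in some ceiling $H_\beta^{n_\beta}$ of $A$ with $\beta\in\Sigma$, $n_\beta\in\mathbb{Z}$. Negatively coclosed: $\Sigma$ is negatively coclosed if whenever $\alpha\in\Sigma$, $\beta_1,\beta_2\in\Phi^+$, $\alpha=d_1\beta_1+d_2\beta_2$ with $d_1,d_2\in\mathbb{Z}_{>0}$ and $(\beta_1,\beta_2)<0$, then $\beta_1\in\Sigma$ or $\beta_2\in\Sigma$. Localization: let $\mathcal{A}=\{H_\alpha^0\mid\alpha\in\Phi^+\}$ be the Weyl arrangement and $L_2(\mathcal{A})$ the set of codimension-$2$ subspaces that are intersections of hyperplanes of $\mathcal{A}$. For $X\in L_2(\mathcal{A})$, $\Phi_X=\Phi\cap X^\perp$ is a rank $2$ root subsystem with positive system $\Phi_X^+=\Phi^+\cap\Phi_X$, and $\Sigma_X=\Sigma\cap\Phi_X^+$. $\Sigma$ is $2$-locally compatible if for every $X\in L_2(\mathcal{A})$ with $\Phi_X$ irreducible, $\Sigma_X$ is Worpitzky-compatible in $\Phi_X$ (in the span of $\Phi_X$, with respect to the positive system $\Phi_X^+$).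
   Formalization: In the upper closure, the facets supported by ceilings are added without their points lying on walls of A that are not ceilings; with closed facets the claim fails already in type A_2 for Σ = Φ^+. *)

(* Defs.v *)
From HB Require Import structures.
From mathcomp Require Import all_boot all_order all_algebra finmap.
From mathcomp Require Import all_classical all_reals all_analysis.
Import numFieldNormedType.Exports.

Set Implicit Arguments.
Unset Strict Implicit.
Unset Printing Implicit Defensive.

Import Order.TTheory GRing.Theory Num.Theory.

Local Open Scope classical_set_scope.
Local Open Scope fset_scope.
Local Open Scope ring_scope.

(** A root system [Phi] is a finite set of vectors of ['rV[R]_l].  It is not
    required to span ['rV[R]_l]: all the geometry attached to [Phi] (alcoves,
    hyperplanes, ...) takes place in its linear span, so that the same
    definitions apply to [Phi] and to its localizations [Phi_X]. *)

Section RootSystems.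
Variables (R : realType) (l : nat).
Local Notation V := 'rV[R]_l.

Definition dot (u v : V) : R := (u *m v^T) 0 0.

Definition cartan (a b : V) : R := 2 * dot a b / dot b b.

Definition reflection (a x : V) : V := x - cartan x a *: a.

Definition rspan (Phi : {fset V}) : {vspace V} := <<enum_fset Phi>>%VS.

Record root_system (Phi : {fset V}) : Prop := RootSystem {
  root_neq0 : 0 \notin Phi;
  root_reduced :
    forall (a : V) (c : R), a \in Phi -> c *: a \in Phi -> c = 1 \/ c = -1;
  root_reflection :
    forall a b : V, a \in Phi -> b \in Phi -> reflection a b \in Phi;
  root_integral :
    forall a b : V, a \in Phi -> b \in Phi -> cartan a b \is a Num.int }.

Definition irreducible_roots (Phi : {fset V}) : Prop :=
  Phi != fset0 /\
  forall Psi : {fset V}, Psi `<=` Phi ->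
    (forall a b : V, a \in Psi -> b \in Phi `\` Psi -> dot a b = 0) ->
    Psi = fset0 \/ Psi = Phi.

Definition natcomb (D : {fset V}) (x : V) : Prop :=
  exists c : V -> nat, x = \sum_(d <- D) (c d)%:R *: d.

Record simple_roots (Phi D : {fset V}) : Prop := SimpleRoots {
  simple_sub : D `<=` Phi;
  simple_basis : basis_of (rspan Phi) (enum_fset D);
  simple_sign :
    forall a : V, a \in Phi -> natcomb D a \/ natcomb D (- a) }.

Definition positive_roots (Phi D : {fset V}) : {fset V} :=
  [fset a in Phi | `[< natcomb D a >]].

Definition hyp (Phi : {fset V}) (a : V) (c : R) : set V :=
  [set x | x \in rspan Phi /\ dot a x = c].

(* The hyperplanes of negative roots are the same as those of positive ones
   (H_{-a}^n = H_a^{-n}), so restricting to positive roots loses nothing. *)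
Definition alcove_complement (Phi D : {fset V}) : set V :=
  [set x | x \in rspan Phi /\
     forall (a : V) (n : int), a \in positive_roots Phi D ->
       ~ hyp Phi a n%:~R x].

Definition alcove (Phi D : {fset V}) (A : set V) : Prop :=
  exists2 x, alcove_complement Phi D x &
    A = connected_component (alcove_complement Phi D) x.

Definition conv_hull (s : {fset V}) : set V :=
  [set x | exists t : V -> R,
     [/\ forall v, v \in s -> 0 <= t v, \sum_(v <- s) t v = 1
       & x = \sum_(v <- s) t v *: v]].

Definition aff_indep (s : {fset V}) : Prop :=
  forall t : V -> R,
    \sum_(v <- s) t v = 0 -> \sum_(v <- s) t v *: v = 0 ->
    forall v, v \in s -> t v = 0.

(* [s] is the vertex set of a [d]-simplex whose underlying set is [C]. *)
Definition simplex (d : nat) (s : {fset V}) (C : set V) : Prop :=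
  [/\ #|` s| = d.+1, aff_indep s & C = conv_hull s].

(* With r+1 the rank of [Phi], [closure A] is an (r+1)-simplex and [F] is an
   r-simplex spanned by a subset of its vertices. *)
Definition facet (Phi : {fset V}) (A F : set V) : Prop :=
  exists r, \dim (rspan Phi) = r.+1 /\
  exists s s' : {fset V},
    [/\ simplex r.+1 s (closure A), s' `<=` s & simplex r s' F].

Definition hyperplane (Phi : {fset V}) (H : set V) : Prop :=
  exists (a : V) (c : R), [/\ a \in rspan Phi, a != 0 & H = hyp Phi a c].

(* A hyperplane supports a facet when it contains it (it is then its affine
   span). *)
Definition wall (Phi : {fset V}) (A H : set V) : Prop :=
  hyperplane Phi H /\ exists2 F, facet Phi A F & (F `<=` H)%classic.

Definition same_side (H : set V) (x y : V) : Prop :=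
  forall t : R, 0 <= t <= 1 -> ~ H ((1 - t) *: x + t *: y).

Definition ceiling (Phi : {fset V}) (A H : set V) : Prop :=
  [/\ wall Phi A H, ~ H 0 & forall x, A x -> same_side H 0 x].

(** The upper closure is half-open: the facets supported by ceilings are added
    to [A] without their points lying on the other walls of [A].  This is what
    makes the upper closures of the alcoves of the fundamental parallelepiped a
    partition of it (the Worpitzky partition).  With closed facets the upper
    closures would overlap, and in type A_2 the set of all positive roots would
    not be compatible. *)
Definition upper_closure (Phi : {fset V}) (A : set V) : set V :=
  (A `|` [set x | (exists F H, [/\ facet Phi A F, ceiling Phi A H,
                                 (F `<=` H)%classic & F x]) /\
                forall H, wall Phi A H -> ~ ceiling Phi A H -> ~ H x])%classic.

Definition parallelepiped (Phi D : {fset V}) : set V :=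
  [set x | x \in rspan Phi /\ forall a, a \in D -> 0 < dot a x <= 1].

Definition worpitzky_compatible (Phi D Sigma : {fset V}) : Prop :=
  forall A : set V, alcove Phi D A -> (A `<=` parallelepiped Phi D)%classic ->
  forall (a : V) (n : int), a \in Sigma ->
    (upper_closure Phi A `&` hyp Phi a n%:~R = set0)%classic \/
    exists (b : V) (m : int),
      [/\ b \in Sigma, ceiling Phi A (hyp Phi b m%:~R)
        & (upper_closure Phi A `&` hyp Phi a n%:~R
             `<=` hyp Phi b m%:~R)%classic].

(* Codimension-2 intersections of hyperplanes of the Weyl arrangement; negative
   roots define the same hyperplanes through the origin. *)
Definition codim2_flat (Phi D : {fset V}) (X : {vspace V}) : Prop :=
  (\dim X + 2)%N = l /\
  exists2 B : {fset V}, B `<=` positive_roots Phi D &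
    forall x, x \in X <-> forall a, a \in B -> dot a x = 0.

Definition localization (Psi : {fset V}) (X : {vspace V}) : {fset V} :=
  [fset a in Psi | `[< forall x, x \in X -> dot a x = 0 >]].

(* [DX] is the (unique) simple system of [Phi_X] determined by the positive
   system [localization (positive_roots Phi D) X]. *)
Definition locally_compatible2 (Phi D Sigma : {fset V}) : Prop :=
  forall X : {vspace V}, codim2_flat Phi D X ->
    irreducible_roots (localization Phi X) ->
    exists DX : {fset V},
      [/\ simple_roots (localization Phi X) DX,
          positive_roots (localization Phi X) DX
            = localization (positive_roots Phi D) X
        & worpitzky_compatible (localization Phi X) DX (localization Sigma X)].

Definition negatively_coclosed (Phi D Sigma : {fset V}) : Prop :=
  forall (a b1 b2 : V) (d1 d2 : nat),
    a \in Sigma -> b1 \in positive_roots Phi D -> b2 \in positive_roots Phi D ->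
    (0 < d1)%N -> (0 < d2)%N -> a = d1%:R *: b1 + d2%:R *: b2 ->
    dot b1 b2 < 0 -> b1 \in Sigma \/ b2 \in Sigma.

Definition typeG2 (D : {fset V}) : Prop :=
  exists a1 a2 : V, [/\ D = [fset a1; a2], cartan a1 a2 = -1
                      & cartan a2 a1 = -3].

Definition G2_exceptional (D Sigma : {fset V}) : Prop :=
  exists a1 a2 : V, [/\ D = [fset a1; a2], dot a1 a1 < dot a2 a2 &
    exists S : {fset V},
      [/\ S != fset0,
          S `<=` [fset 2 *: a1 + a2; 3 *: a1 + a2; 3 *: a1 + 2 *: a2]
        & Sigma = a2 |` S]].

End RootSystems.

(* Main.v *)
(** Let [x0] lie in an alcove [A]. The functions [affval a = (a, .) - floor (a, x0)],
    for [a] a root, take values in ]0, 1[ on [A]. The difference of two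
    indecomposable ones is not a root, so they are pairwise obtuse, and all the
    others are natural combinations of them; as [1 = affval a + affval (- a)] and the
    system is irreducible, they satisfy a single linear relation, with positive
    coefficients. Hence [closure A] is a simplex, and the indecomposable
    functions are its walls.

    Coclosed implies compatible: if [a] in [Sigma] is integral at [x] in the upper
    closure of [A], then [a] is a natural combination of the ceilings through
    [x]; reflecting [a] in a ceiling [b] with [(a, b) > 0] writes it as
    [a' + k b] with [(a', b) < 0], and one descends from [a] to [a'].

    Compatible implies coclosed: given positive roots [b1], [b2] at an obtuse
    angle, there is [x] in the parallelepiped at which the integral roots are
    those of the plane of [b1] and [b2]: take a small generic vector orthogonal to
    the plane and add a coweight to correct its coordinates. Without [G2]
    subsystem these roots are, up to sign, nonnegative combinations of [b1] and
    [b2], and the alcove just below [x] has exactly [b1] and [b2] as ceilings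
    through [x]. Coclosedness is a condition on planes of roots, which gives the
    local statement.

    A pair of roots with Cartan integer -3 forces an irreducible system to have
    rank 2. In [G2], compatibility is tested at the points where the simple roots
    take the values (1, 1) and (1/3, 1), and every set of positive roots
    containing the long simple root is compatible. *)

Require Import Defs.
From mathcomp Require Import all_boot all_order all_algebra finmap.
From mathcomp Require Import all_classical all_reals all_analysis.
From mathcomp Require Import ring lra zify.
Import numFieldNormedType.Exports.

Set Implicit Arguments.
Unset Strict Implicit.
Unset Printing Implicit Defensive.

Import Order.TTheory GRing.Theory Num.Theory.

Local Open Scope classical_set_scope.
Local Open Scope fset_scope.
Local Open Scope ring_scope.

(** * Scalar products and root systems *)

(** No affine Weyl group is used: an arbitrary alcove is described by the integer parts of the roots
    at one of its points, and topology only serves to turn components and closures into linear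
    inequalities. All this is done inside the span of [Phi], since a localization does not span the
    ambient space.

    [G2] is different for the following reason. Coclosedness for an obtuse pair is tested at a point
    whose integral roots are, up to sign, in the cone of the pair, that is, have the pair as a base.
    In a plane of type [A2] or [B2] every obtuse pair is a base of the plane. In [G2] two roots of
    equal length at 120 degrees are not. For the long pair this is repaired by a point where only
    the long roots are integral. The short pair [a1], [a1 + a2] generates the whole root lattice, so
    whenever both are integral all roots are, and its condition escapes every test of this kind. The
    sets that satisfy the other conditions and violate this one are the seven exceptional sets. *)

Section Dot.
Variables (R : realType) (l : nat).
Local Notation V := 'rV[R]_l.
Implicit Types (u v w a b : V).

Lemma dotE u v : dot u v = \sum_j u 0 j * v 0 j.
Proof. by rewrite /dot mxE; apply: eq_bigr => j _; rewrite mxE. Qed.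

Lemma dotC u v : dot u v = dot v u.
Proof. by rewrite !dotE; apply: eq_bigr => j _; rewrite mulrC. Qed.

Lemma dotDl u v w : dot (u + v) w = dot u w + dot v w.
Proof. by rewrite /dot mulmxDl mxE. Qed.

Lemma dotZl c u v : dot (c *: u) v = c * dot u v.
Proof. by rewrite /dot -scalemxAl mxE. Qed.

Lemma dotNl u v : dot (- u) v = - dot u v.
Proof. by rewrite -scaleN1r dotZl mulN1r. Qed.

Lemma dotBl u v w : dot (u - v) w = dot u w - dot v w.
Proof. by rewrite dotDl dotNl. Qed.

Lemma dot0l u : dot 0 u = 0.
Proof. by rewrite /dot mul0mx mxE. Qed.

Lemma dotDr u v w : dot w (u + v) = dot w u + dot w v.
Proof. by rewrite dotC dotDl !(dotC w). Qed.

Lemma dotZr c u v : dot v (c *: u) = c * dot v u.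
Proof. by rewrite dotC dotZl (dotC v). Qed.

Lemma dotNr u v : dot v (- u) = - dot v u.
Proof. by rewrite dotC dotNl (dotC v). Qed.

Lemma dotBr u v w : dot w (u - v) = dot w u - dot w v.
Proof. by rewrite dotDr dotNr. Qed.

Lemma dot0r u : dot u 0 = 0.
Proof. by rewrite dotC dot0l. Qed.

Definition dotL := (dotDl, dotBl, dotNl, dotZl, dot0l).
Definition dotR := (dotDr, dotBr, dotNr, dotZr, dot0r).

Lemma dot_suml (I : Type) (r : seq I) (P : pred I) (F : I -> V) v :
  dot (\sum_(i <- r | P i) F i) v = \sum_(i <- r | P i) dot (F i) v.
Proof. exact: (big_morph (fun u => dot u v) (fun x y => dotDl x y v) (dot0l v)). Qed.

Lemma dot_sumr (I : Type) (r : seq I) (P : pred I) (F : I -> V) v :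
  dot v (\sum_(i <- r | P i) F i) = \sum_(i <- r | P i) dot v (F i).
Proof. exact: (big_morph (dot v) (fun x y => dotDr x y v) (dot0r v)). Qed.

Lemma dot_ge0 u : 0 <= dot u u.
Proof. by rewrite dotE; apply: sumr_ge0 => j _; rewrite -expr2 sqr_ge0. Qed.

Lemma dot_eq0 u : dot u u = 0 -> u = 0.
Proof.
rewrite dotE => /eqP; rewrite psumr_eq0; last first.
  by move=> j _; rewrite -expr2 sqr_ge0.
move=> /allP h; apply/matrixP => i j; rewrite (ord1 i) mxE.
by have := h j (mem_index_enum _); rewrite /= mulf_eq0 orbb => /eqP.
Qed.

Lemma dot_gt0 u : u != 0 -> 0 < dot u u.
Proof.
by move=> u0; rewrite lt_def dot_ge0 andbT; apply: contra_neq u0 => /dot_eq0.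
Qed.

(** The component of [a] orthogonal to [b] is nonzero; its squared length times [dot b b] is the
    difference of the two sides. *)
Lemma dot_cauchy_schwarz_lt a b : b != 0 -> (forall c, a != c *: b) ->
  dot a b * dot a b < dot a a * dot b b.
Proof.
move=> b0 nab; have bb := dot_gt0 b0.
have := dot_gt0 (u := a - (dot a b / dot b b) *: b).
rewrite subr_eq0 => /(_ (nab _)) h.
have := mulr_gt0 h bb; rewrite !(dotL, dotR) (dotC b a) => {}h.
rewrite -subr_gt0; apply: lt_le_trans h _; rewrite le_eqVlt; apply/orP; left.
by apply/eqP; field; rewrite gt_eqF.
Qed.

(* The row span of a free family carries a dual family, since its Gram matrix
   is invertible. *)
Lemma dual_point (U : {vspace V}) (b : seq V) (z : V -> R) : basis_of U b ->
  exists2 x, x \in U & forall v, v \in b -> dot v x = z v.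
Proof.
move=> bU; have fb := basis_free bU.
pose n := size b; pose B : 'M[R]_(n, l) := \matrix_(i < n) b`_i.
have rB i : row i B = b`_i by rewrite rowK.
have mulB (c : 'rV_n) : c *m B = \sum_(i < n) c 0 i *: b`_i.
  by rewrite mulmx_sum_row; apply: eq_bigr => i _; rewrite rB.
have fB (c : 'rV_n) : c *m B = 0 -> c = 0.
  rewrite mulB => h; apply/rowP => i; rewrite mxE.
  by have /freeP/(_ (c 0) h) : free (in_tuple b) by [].
have uG : B *m B^T \in unitmx.
  rewrite -row_free_unit; apply/inj_row_free => c h; apply: fB.
  apply: dot_eq0; rewrite /dot trmx_mul mulmxA -(mulmxA c) h mul0mx mxE //.
pose c := (\row_i z b`_i) *m invmx (B *m B^T).
exists (c *m B).
  rewrite mulB memv_suml // => i _; apply: memvZ.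
  by rewrite (basis_mem bU) // mem_nth.
move=> v vb; have iv : (index v b < n)%N by rewrite index_mem.
have ev : row (Ordinal iv) B = v by rewrite rB /= nth_index.
rewrite -{1}ev dotC /dot tr_row colE mulmxA -(mulmxA c) /c mulmxKV // -colE.
by rewrite !mxE /= nth_index.
Qed.

End Dot.

Section Roots.
Variables (R : realType) (l : nat) (Phi : {fset 'rV[R]_l}).
Hypothesis rootPhi : root_system Phi.
Implicit Types (a b : 'rV[R]_l).

Lemma root_nz a : a \in Phi -> a != 0.
Proof. by move=> aP; apply: contraNneq (root_neq0 rootPhi) => <-. Qed.

Lemma root_gt0 a : a \in Phi -> 0 < dot a a.
Proof. by move=> /root_nz; exact: dot_gt0. Qed.

Lemma root_opp a : a \in Phi -> - a \in Phi.
Proof.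
move=> aP; have := root_reflection rootPhi aP aP.
rewrite /reflection /cartan -mulrA divff ?gt_eqF ?root_gt0 // mulr1.
by rewrite scaler_nat mulr2n opprD addrA subrr sub0r.
Qed.

Lemma root_prop a b c : a \in Phi -> b \in Phi -> a = c *: b -> a = b \/ a = - b.
Proof.
move=> aP bP e; case: (root_reduced rootPhi bP (c := c)); rewrite -?e // e.
  by move=> ->; left; rewrite scale1r.
by move=> ->; right; rewrite scaleN1r.
Qed.

(** The equations are free of division, so that later case analyses are linear. The product of the
    two integers is four times the squared cosine of the angle, and reducedness turns [a != b] and
    [a != - b] into nonproportionality. *)
Lemma cartanP a b : a \in Phi -> b \in Phi ->
  exists m n : int, [/\ cartan a b = m%:~R, cartan b a = n%:~R,
    m%:~R * dot b b = 2 * dot a b, n%:~R * dot a a = 2 * dot a b &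
    (a != b -> a != - b -> m * n < 4)%R].
Proof.
move=> aP bP; have [/intrP[m em] /intrP[n en]] :=
  (root_integral rootPhi aP bP, root_integral rootPhi bP aP).
have [a0 b0] := (root_gt0 aP, root_gt0 bP).
have Em : m%:~R * dot b b = 2 * dot a b.
  by rewrite -em /cartan divfK // gt_eqF.
have En : n%:~R * dot a a = 2 * dot a b.
  by rewrite -en /cartan divfK ?gt_eqF // dotC.
exists m, n; split=> // ab abN.
have nab c : a != c *: b.
  apply: contraTneq isT => e.
  by case: (root_prop aP bP e) => h; [rewrite h eqxx in ab|rewrite h eqxx in abN].
have := dot_cauchy_schwarz_lt (root_nz bP) nab => h.
rewrite -(ltr_int R) rmorphM /=.
rewrite -(ltr_pM2r a0) -(ltr_pM2r b0).
have -> : m%:~R * n%:~R * dot a a * dot b b =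
  (m%:~R * dot b b) * (n%:~R * dot a a) :> R by ring.
rewrite Em En; have -> : 4%:~R = 4 :> R by []; lra.
Qed.

Lemma cartan_intP a b : a \in Phi -> b \in Phi ->
  exists2 m : int, cartan a b = m%:~R & m%:~R * dot b b = 2 * dot a b.
Proof. by move=> /cartanP h /h [m [n []]]; exists m. Qed.

(** Two positive integers with product below 4 include a 1, and the corresponding reflection gives
    [a - b] or [b - a]. *)
Lemma root_sub a b : a \in Phi -> b \in Phi -> a != b -> 0 < dot a b ->
  a - b \in Phi.
Proof.
move=> aP bP ab ab0; have [m [n [cm cn em en lt4]]] := cartanP aP bP.
have m0 : 0 < m.
  by rewrite -(ltr_int R) -(pmulr_lgt0 _ (root_gt0 bP)) em mulr_gt0.
have n0 : 0 < n.
  by rewrite -(ltr_int R) -(pmulr_lgt0 _ (root_gt0 aP)) en mulr_gt0.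
have abN : a != - b.
  by apply: contraTneq ab0 => ->; rewrite dotNl oppr_gt0 -leNgt dot_ge0.
have mn4 := lt4 ab abN.
have [m1|n1] : m = 1 \/ n = 1 by nia.
  by have := root_reflection rootPhi bP aP; rewrite /reflection cm m1 scale1r.
have := root_opp (root_reflection rootPhi aP bP).
by rewrite /reflection cn n1 scale1r opprB.
Qed.

End Roots.

(** The real order is not well founded, but on a finite set the number of elements of smaller value
    decreases. *)
Lemma fset_real_ind (R : realType) (T : choiceType) (A : {fset T}) (f : T -> R)
    (P : T -> Prop) :
  (forall a, a \in A -> (forall b, b \in A -> f b < f a -> P b) -> P a) ->
  forall a, a \in A -> P a.
Proof.
move=> IH a aA; have [n] := ubnP #|` [fset b in A | f b < f a]|.
elim: n a aA => // n IHn a aA lea; apply: IH => // b bA ba; apply: IHn => //.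
apply: leq_trans (_ : #|` [fset b in A | (f b < f a)%R]| <= n)%N => //.
apply/fproper_ltn_card; rewrite fproperE; apply/andP; split.
  by apply/fsubsetP => c; rewrite !inE /= => /andP[-> cb]; rewrite (lt_trans cb).
by apply/fsubsetPn; exists b; rewrite !inE /= ?bA ?ltxx.
Qed.

Section Span.
Variables (R : realType) (l : nat).
Local Notation V := 'rV[R]_l.
Implicit Types (D : {fset V}) (s : seq V) (x y : V).

Lemma span_dot_eq s x x' y : y \in span s ->
  (forall v, v \in s -> dot v x = dot v x') -> dot y x = dot y x'.
Proof.
move=> ys h; rewrite (coord_span (X := in_tuple s) ys) !dot_suml.
by apply: eq_bigr => i _; rewrite !dotZl h // mem_nth.
Qed.

Lemma span_perp s x y : y \in span s ->
  (forall v, v \in s -> dot v x = 0) -> dot y x = 0.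
Proof.
by move=> ys h; rewrite -(dot0r y); apply: (span_dot_eq ys) => v /h; rewrite dot0r.
Qed.

Lemma span_perp0 s x : x \in span s ->
  (forall v, v \in s -> dot v x = 0) -> x = 0.
Proof. by move=> xs h; apply: dot_eq0; apply: (span_perp xs). Qed.

Lemma free_fset D :
  (forall c : V -> R, \sum_(d <- D) c d *: d = 0 -> forall d, d \in D -> c d = 0) ->
  free (enum_fset D).
Proof.
move=> h; rewrite -[enum_fset D]/(tval (in_tuple (enum_fset D))).
apply/freeP => k; set X := in_tuple _ => e i.
have /(_ (fun v => if insub (index v X) is Some j then k j else 0)) := h.
rewrite (big_nth 0) big_mkord => /(_ _ X`_i).
have E (j : 'I_#|` D|) :
  (if insub (index X`_j X) is Some j' then k j' else 0) = k j.
  by rewrite index_uniq ?fset_uniq // insubT //= => ?; congr k; apply: val_inj.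
rewrite E; apply; last by rewrite mem_nth.
by rewrite -[RHS]e; apply: eq_bigr => j _; rewrite E.
Qed.

Lemma natcomb_mem D d : d \in D -> natcomb D d.
Proof.
move=> dD; exists (fun v => (v == d) : nat).
rewrite (bigD1_seq d) ?fset_uniq //= eqxx scale1r big1 ?addr0 // => v /negPf ->.
by rewrite scale0r.
Qed.

Lemma natcombD D x y : natcomb D x -> natcomb D y -> natcomb D (x + y).
Proof.
move=> [c ->] [c' ->]; exists (fun v => c v + c' v)%N.
by rewrite -big_split /=; apply: eq_bigr => v _; rewrite natrD scalerDl.
Qed.

Lemma natcomb_span D x : natcomb D x -> x \in <<enum_fset D>>%VS.
Proof.
move=> [c ->]; rewrite big_seq memv_suml // => d dD.
by apply: memvZ; apply: memv_span.
Qed.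

Lemma natcomb_ge0 D x y : natcomb D x -> (forall d, d \in D -> 0 <= dot d y) ->
  0 <= dot x y.
Proof.
move=> [c ->] h; rewrite dot_suml big_seq sumr_ge0 // => d dD.
by rewrite dotZl mulr_ge0 // h.
Qed.

Lemma natcomb_gt0 D x y : natcomb D x -> x != 0 ->
  (forall d, d \in D -> 0 < dot d y) -> 0 < dot x y.
Proof.
move=> nx x0 h; rewrite lt_def (natcomb_ge0 nx) ?andbT; last by move=> d /h/ltW.
apply: contra_neq x0; case: nx => c ->; rewrite dot_suml.
move=> /eqP; rewrite big_seq psumr_eq0; last first.
  by move=> d dD; rewrite dotZl mulr_ge0 // ltW // h.
move=> /allP e; rewrite big_seq big1 // => d dD.
have := e d dD; rewrite dD dotZl mulf_eq0 (gt_eqF (h _ dD)) orbF /= => /eqP ->.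
by rewrite scale0r.
Qed.

Lemma natcomb_int D x y : natcomb D x ->
  (forall d, d \in D -> dot d y \is a Num.int) -> dot x y \is a Num.int.
Proof.
move=> [c ->] h; rewrite dot_suml big_seq rpred_sum // => d dD.
by rewrite dotZl rpredM ?h // rpred_nat.
Qed.

End Span.

Section Simple.
Variables (R : realType) (l : nat) (Phi D : {fset 'rV[R]_l}).
Hypothesis (rootPhi : root_system Phi) (simD : simple_roots Phi D).
Implicit Types (a b d x : 'rV[R]_l).
Local Notation Phip := (positive_roots Phi D).

Lemma posP a : reflect (a \in Phi /\ natcomb D a) (a \in Phip).
Proof.
rewrite !inE /=; apply: (iffP andP) => -[aP h]; split=> //; exact/asboolP.
Qed.

Lemma pos_root a : a \in Phip -> a \in Phi.
Proof. by case/posP. Qed.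

Lemma mem_rspan a : a \in Phi -> a \in rspan Phi.
Proof. by move=> aP; apply: memv_span. Qed.

Lemma simple_root d : d \in D -> d \in Phi.
Proof. by move/(fsubsetP (simple_sub simD)). Qed.

Lemma simple_pos d : d \in D -> d \in Phip.
Proof. by move=> dD; apply/posP; split; [exact: simple_root|exact: natcomb_mem]. Qed.

Lemma rspanE : rspan Phi = <<enum_fset D>>%VS.
Proof. by rewrite (span_basis (simple_basis simD)). Qed.

Lemma simple_point (z : 'rV[R]_l -> R) :
  exists2 x, x \in rspan Phi & forall d, d \in D -> dot d x = z d.
Proof. exact: dual_point (simple_basis simD). Qed.

Lemma pos_gt0 a x : a \in Phip -> (forall d, d \in D -> 0 < dot d x) -> 0 < dot a x.
Proof. by move=> /posP[aP aD]; apply: natcomb_gt0 aD _; apply: (root_nz rootPhi). Qed.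

Lemma pos_or_neg a : a \in Phi -> a \in Phip \/ - a \in Phip.
Proof.
move=> aP; have aN := root_opp rootPhi aP.
by case: (simple_sign simD aP) => h; [left|right]; apply/posP.
Qed.

Lemma natcombN0 a : natcomb D a -> natcomb D (- a) -> a = 0.
Proof.
move=> h1 h2; have [rho _ hrho] := simple_point (fun=> 1).
have lt0 d : d \in D -> 0 < dot d rho by move=> /hrho ->.
apply/eqP; apply: contraT => a0.
have := natcomb_gt0 h1 a0 lt0; have := natcomb_gt0 h2 _ lt0.
by rewrite oppr_eq0 dotNl oppr_gt0 => /(_ a0) h; rewrite ltNge ltW.
Qed.

Lemma pos_negF a : a \in Phip -> - a \in Phip -> False.
Proof.
move=> /posP[aP h1] /posP[_ h2].
by have := root_nz rootPhi aP; rewrite (natcombN0 h1 h2) eqxx.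
Qed.

Lemma pos_prop a b c : a \in Phip -> b \in Phip -> a = c *: b -> a = b.
Proof.
move=> aP bP e; case: (root_prop rootPhi (pos_root aP) (pos_root bP) e) => // h.
by case: (pos_negF bP); rewrite -h.
Qed.

Lemma simple_coord_inj (c c' : 'rV[R]_l -> R) :
  \sum_(d <- D) c d *: d = \sum_(d <- D) c' d *: d -> {in D, c =1 c'}.
Proof.
move=> e d dD; have [w _ hw] := simple_point (fun v => (v == d)%:R).
have E (k : 'rV[R]_l -> R) : dot (\sum_(d <- D) k d *: d) w = k d.
  rewrite dot_suml (bigD1_seq d) ?fset_uniq //= dotZl hw // eqxx mulr1.
  rewrite big_seq_cond big1 ?addr0 // => v /andP[vD /negPf vd].
  by rewrite dotZl hw // vd mulr0.
by rewrite -E e E.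
Qed.

Lemma simple_dot_le0 d d' : d \in D -> d' \in D -> d != d' -> dot d d' <= 0.
Proof.
move=> dD d'D dd'; rewrite leNgt; apply: contraT => /negPn lt0.
have := root_sub rootPhi (simple_root dD) (simple_root d'D) dd' lt0.
(* The difference has coordinate -1 at [w], which no natural combination has. *)
have K (v w : 'rV[R]_l) : v \in D -> w \in D -> v != w -> ~ natcomb D (v - w).
  move=> vD wD vw [c e].
  have : \sum_(d <- D) (c d + (d == w))%:R *: d
       = \sum_(d <- D) (d == v)%:R *: d :> 'rV[R]_l.
    under eq_bigr do rewrite natrD scalerDl.
    rewrite big_split /= -e.
    have S u : u \in D -> \sum_(d <- D) (d == u)%:R *: d = u :> 'rV[R]_l.
      move=> uD; rewrite (bigD1_seq u) ?fset_uniq //= eqxx scale1r.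
      by rewrite big1 ?addr0 // => x /negPf ->; rewrite scale0r.
    by rewrite !S // subrK.
  move=> /simple_coord_inj/(_ w wD) /=; rewrite eqxx eq_sym (negPf vw).
  by move=> /eqP; rewrite pnatr_eq0 addn1.
by case/(simple_sign simD); rewrite ?opprB => /K; case=> //; rewrite eq_sym.
Qed.

End Simple.

(** * The affine base of an alcove *)

Section AffineBase.
Variables (R : realType) (l : nat) (Phi : {fset 'rV[R]_l}) (x0 : 'rV[R]_l).
Local Notation V := 'rV[R]_l.
Hypotheses (rootPhi : root_system Phi) (irrPhi : irreducible_roots Phi).
Hypothesis x0_regular : forall a, a \in Phi -> dot a x0 \isn't a Num.int.
Implicit Types (a b s t y : V).

Definition level a : int := Num.floor (dot a x0).
Definition affval a y : R := dot a y - (level a)%:~R.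

(* The inequalities [0 < affval a] define the alcove of [x0]; the indecomposable
   ones are its walls. *)
Definition alcove_base : {fset V} :=
  [fset a in Phi | `[< forall b c, b \in Phi -> c \in Phi -> a = b + c ->
                       level a <> level b + level c >]].
Local Notation S := alcove_base.

Lemma aff_gt0 a : a \in Phi -> 0 < affval a x0.
Proof.
move=> aP; rewrite subr_gt0 lt_def floor_le andbT.
by apply: contra (x0_regular aP) => /eqP ->; rewrite intr_int.
Qed.

Lemma aff_lt1 a : affval a x0 < 1.
Proof. by rewrite ltrBlDl; have := floorD1_gt (dot a x0); rewrite intrD. Qed.

Lemma lev_uniq a (k : int) : 0 < dot a x0 - k%:~R < 1 -> level a = k.
Proof. by move=> /andP[h1 h2]; apply: floor_def; rewrite intrD; lra. Qed.

(** The shift by 1 comes from [dot a x0] not being an integer. It makes [affval a] and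
    [affval (- a)] add up to the constant 1. *)
Lemma levN a : a \in Phi -> level (- a) = - level a - 1.
Proof.
move=> aP; apply: lev_uniq; have := aff_gt0 aP; have := aff_lt1 a.
by rewrite /affval dotNl intrD intrN; lra.
Qed.

Lemma affN a y : a \in Phi -> affval (- a) y = 1 - affval a y.
Proof. by move=> aP; rewrite /affval levN // dotNl intrD intrN; lra. Qed.

(** Fractional parts subtract without borrowing when the smaller is taken from the larger; they
    cannot be equal, as [dot (a - b) x0] would be an integer. *)
Lemma lev_sub a b : a \in Phi -> b \in Phi -> a - b \in Phi ->
  level a = level b + level (a - b) \/ level b = level a + level (b - a).
Proof.
move=> aP bP abP; have baP : b - a \in Phi.
  by rewrite -opprB; exact: root_opp.
have [] := (aff_gt0 aP, aff_gt0 bP); have := (aff_lt1 a, aff_lt1 b).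
move=> [] a1 b1 a0 b0; have := aff_gt0 abP; have := aff_gt0 baP.
have E1 : level (a - b) = level a - level b \/ level (b - a) = level b - level a.
  have [h|h|h] := ltgtP (affval a x0) (affval b x0).
  - by right; apply: lev_uniq; move: h a0 b0 a1 b1; rewrite /affval dotBl intrB; lra.
  - by left; apply: lev_uniq; move: h a0 b0 a1 b1; rewrite /affval dotBl intrB; lra.
  - case/negP: (x0_regular abP); rewrite dotBl.
    have -> : dot a x0 - dot b x0 = (level a - level b)%:~R.
      by move: h; rewrite /affval intrB; lra.
    exact: intr_int.
by move=> _ _; case: E1 => ->; [left|right]; lia.
Qed.

Lemma baseP a : reflect (a \in Phi /\ forall b c, b \in Phi -> c \in Phi ->
    a = b + c -> level a <> level b + level c) (a \in S).
Proof.
rewrite !inE /=; apply: (iffP andP) => -[aP h]; split=> //; exact/asboolP.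
Qed.

Lemma base_root a : a \in S -> a \in Phi.
Proof. by case/baseP. Qed.

Lemma base_sub s t : s \in S -> t \in S -> s - t \notin Phi.
Proof.
move=> /baseP[sP hs] /baseP[tP ht]; apply/negP => stP.
have tsP : t - s \in Phi by rewrite -opprB; exact: root_opp.
case: (lev_sub sP tP stP); first by apply: hs => //; rewrite addrC subrK.
by apply: ht => //; rewrite addrC subrK.
Qed.

Lemma base_obtuse s t : s \in S -> t \in S -> s != t -> dot s t <= 0.
Proof.
move=> sS tS st; rewrite leNgt; apply: contra (base_sub sS tS) => h.
by apply: (root_sub rootPhi) => //; apply: base_root.
Qed.

(** The induction hypothesis reaches every root of smaller value at [x0], not only the two summands:
    [dep_full] applies it to their difference. *)
Lemma base_ind (P : V -> Prop) : (forall s, s \in S -> P s) ->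
  (forall a b c, a \in Phi -> b \in Phi -> c \in Phi -> a = b + c ->
     level a = level b + level c ->
     (forall d, d \in Phi -> affval d x0 < affval a x0 -> P d) -> P a) ->
  forall a, a \in Phi -> P a.
Proof.
move=> hS hD; apply: (fset_real_ind (f := affval^~ x0)) => a aP IH.
have [/hS //|] := boolP (a \in S); rewrite !inE /= aP /= => /asboolPn.
move=> /existsNP[b] /existsNP[c] /not_implyP[bP] /not_implyP[cP].
move=> /not_implyP[e] /contrapT el; exact: hD e el IH.
Qed.

Lemma aff_add a b c y : a = b + c -> level a = level b + level c ->
  affval a y = affval b y + affval c y.
Proof. by move=> -> e; rewrite /affval e dotDl intrD; lra. Qed.

(** The same coefficients serve for the vector and for its level, so this is an identity of affine
    functions, as [aff_comb] makes explicit. *)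
Lemma base_expand a : a \in Phi -> exists c : V -> nat,
  a = \sum_(s <- S) (c s)%:R *: s /\
  (level a)%:~R = \sum_(s <- S) (c s)%:R * (level s)%:~R :> R.
Proof.
move: a; apply: base_ind => [s sS|a b c aP bP cP ea el IH].
  exists (fun t => (t == s) : nat).
  by split; rewrite (bigD1_seq s) ?fset_uniq //= eqxx (scale1r, mul1r) big1 ?addr0 // => t
    /negPf ->; rewrite (scale0r, mul0r).
have h := aff_add x0 ea el.
have [|cb [eb lb]] := IH b bP; first by rewrite h ltrDl aff_gt0.
have [|cc [ec lc]] := IH c cP; first by rewrite h ltrDr aff_gt0.
exists (fun t => cb t + cc t)%N; split.
  rewrite ea {1}eb {1}ec -big_split /=.
  by apply: eq_bigr => t _; rewrite natrD scalerDl.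
rewrite el intrD lb lc -big_split /=.
by apply: eq_bigr => t _; rewrite natrD mulrDl.
Qed.

Lemma aff_comb a (c : V -> R) y : a = \sum_(s <- S) c s *: s ->
  (level a)%:~R = \sum_(s <- S) c s * (level s)%:~R :> R ->
  affval a y = \sum_(s <- S) c s * affval s y.
Proof.
move=> e el; rewrite /affval el {1}e dot_suml -sumrB; apply: eq_bigr => s _.
by rewrite dotZl mulrBr.
Qed.

(** Pairing the relation with a [t] outside the support gives a vanishing sum of terms of one sign,
    so [t] is orthogonal to the support. By induction every root then lies in the span of the
    support or is orthogonal to it, and irreducibility leaves only the span. *)
Lemma dep_full (c : V -> R) : (forall s, s \in S -> 0 <= c s) ->
  \sum_(s <- S) c s *: s = 0 -> (exists2 s, s \in S & c s != 0) ->
  forall s, s \in S -> 0 < c s.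
Proof.
move=> c0 ec [s1 s1S cs1].
pose S1 := [fset s in S | c s != 0].
have S1P s : (s \in S1) = (s \in S) && (c s != 0) by rewrite !inE.
have orth t s : t \in S -> c t = 0 -> s \in S1 -> dot t s = 0.
  move=> tS ct; rewrite S1P => /andP[sS cs].
  have : \sum_(u <- S) - (c u * dot t u) = 0.
    rewrite sumrN -[RHS]oppr0; congr (- _).
    rewrite -[RHS](dot0r t) -ec dot_sumr; apply: eq_bigr => u _.
    by rewrite dotZr.
  move=> /eqP; rewrite big_seq psumr_eq0 => [/allP /(_ s)|u uS].
    move=> /(_ sS); rewrite sS /= oppr_eq0 mulf_eq0 (negPf cs).
    by move=> /eqP.
  have [->|ut] := eqVneq u t; first by rewrite ct mul0r oppr0.
  by rewrite oppr_ge0 mulr_ge0_le0 ?c0 // base_obtuse // eq_sym.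
have spO a : a \in span S1 -> (forall s, s \in S1 -> dot a s = 0) -> a = 0.
  by move=> /span_perp0 h1 h2; apply: h1 => s /h2; rewrite dotC.
have split_root a : a \in Phi -> a \in span S1 \/ forall s, s \in S1 -> dot a s = 0.
  move: a; apply: base_ind => [s sS|a b d aP bP dP ea el IH].
    have [e|ne] := eqVneq (c s) 0; first by right=> t; apply: orth.
    by left; apply: memv_span; rewrite S1P sS.
  have h := aff_add x0 ea el.
  have [b0 d0] := (aff_gt0 bP, aff_gt0 dP).
  have lb : affval b x0 < affval a x0 by rewrite h; lra.
  have ld : affval d x0 < affval a x0 by rewrite h; lra.
  (* If [u] lies in the span of [S1] and [v] is orthogonal to it, then [u - v]
     is a root belonging to neither part. *)
  have mixed u v : u \in Phi -> v \in Phi -> a = u + v -> 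
      affval u x0 < affval a x0 -> affval v x0 < affval a x0 ->
      u \in span S1 -> (forall s, s \in S1 -> dot v s = 0) -> False.
    move=> uP vP ea' lu lv uS vS.
    have uv0 : dot u v = 0 by apply: (span_perp uS) => s /vS; rewrite dotC.
    have [u0 v0] := (root_nz rootPhi uP, root_nz rootPhi vP).
    (* As [u] and [v] are orthogonal, this is the reflection of [a = u + v] in [v]. *)
    have uvP : u - v \in Phi.
      have := root_reflection rootPhi vP aP; rewrite /reflection /cartan ea'.
      rewrite dotDl uv0 add0r mulfK ?gt_eqF ?dot_gt0 //.
      by rewrite scaler_nat mulr2n opprD addrA addrK.
    have vuP : v - u \in Phi by rewrite -opprB; exact: root_opp.
    have spE : (u - v \in span S1) -> False.
      move=> h1; have vs : v \in span S1 by rewrite -(subKr u v) rpredB.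
      by rewrite (spO v) ?eqxx // in v0.
    have orE : (forall s, s \in S1 -> dot (u - v) s = 0) -> False.
      move=> h1; rewrite (spO u) ?eqxx // in u0 => s sS.
      by have := h1 s sS; rewrite dotBl vS // subr0.
    have [u1 v1] := (aff_gt0 uP, aff_gt0 vP).
    case: (lev_sub uP vP uvP) => e.
      case: (IH (u - v) uvP) => //; apply: le_lt_trans lu.
      by rewrite (@aff_add u v (u - v) x0) // ?lerDr ?ltW // addrC subrK.
    case: (IH (v - u) vuP) => //.
    - apply: le_lt_trans lv.
      by rewrite (@aff_add v u (v - u) x0) // ?lerDr ?ltW // addrC subrK.
    - by move=> h1; apply: spE; rewrite -opprB rpredN.
    - by move=> h1; apply: orE => s /h1; rewrite !dotBl; lra.
  case: (IH b bP lb) (IH d dP ld) => [hb|hb] [hd|hd].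
  - by left; rewrite ea rpredD.
  - by case: (mixed b d).
  - by case: (mixed d b) => //; rewrite addrC.
  - by right=> s sS; rewrite ea dotDl hb // hd // addr0.
pose Psi := [fset a in Phi | a \in span S1].
have [||e|e] := irrPhi.2 Psi.
- by apply/fsubsetP => a; rewrite !inE /= => /andP[].
- move=> a b; rewrite !inE /= => /andP[aP aS] /andP[/negP bn bP].
  case: (split_root b bP) => [bS|h]; first by case: bn; rewrite bP.
  by apply: (span_perp aS) => s /h; rewrite dotC.
- have : s1 \in Psi.
    by rewrite !inE /= base_root //= memv_span // S1P s1S.
  by rewrite e inE.
move=> s sS; rewrite lt_def c0 // andbT; apply/eqP => cs.
have : s \in Psi by rewrite e base_root.
rewrite !inE /= => /andP[sP /spO h]; have := root_nz rootPhi sP.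
by rewrite h ?eqxx // => t; apply: orth.
Qed.

(** The coefficients add the expansions of a root and of its opposite. The value -1 on levels says
    that the weighted sum of the functions [affval s] is the constant 1; it also shows that [m] is
    not zero, which [dep_full] needs. *)
Lemma base_dep : exists m : V -> R, [/\ forall s, s \in S -> 0 < m s,
  \sum_(s <- S) m s *: s = 0, \sum_(s <- S) m s * (level s)%:~R = -1
  & exists s, s \in S].
Proof.
have [a aP] : exists a, a \in Phi by case: irrPhi => /fset0Pn.
have aN := root_opp rootPhi aP.
have [[c [e el]] [c' [e' el']]] := (base_expand aP, base_expand aN).
pose m s : R := (c s)%:R + (c' s)%:R.
have m0 s : 0 <= m s by rewrite addr_ge0.
have sm : \sum_(s <- S) m s *: s = 0.
  under eq_bigr do rewrite scalerDl.
  by rewrite big_split /= -e -e' addrN.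
have lm : \sum_(s <- S) m s * (level s)%:~R = -1.
  under eq_bigr do rewrite mulrDl.
  by rewrite big_split /= -el -el' levN // intrD intrN; lra.
have [s sS ms] : exists2 s, s \in S & m s != 0.
  apply: contrapT => h; have : (-1 : R) == 0.
    rewrite -lm big_seq; apply/eqP; apply: big1 => s sS; rewrite (_ : m s = 0) ?mul0r //.
    by apply/eqP; apply: contraT => ms; case: h; exists s.
  by rewrite oppr_eq0 oner_eq0.
exists m; split=> //; last by exists s.
by apply: dep_full => //; exists s.
Qed.

(** Subtracting from [c] the multiple of [m] given by the smallest ratio leaves a nonnegative
    relation that vanishes at one place, hence everywhere by [dep_full]. *)
Lemma dep_prop (m c : V -> R) : (forall s, s \in S -> 0 < m s) ->
  \sum_(s <- S) m s *: s = 0 -> \sum_(s <- S) c s *: s = 0 ->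
  exists k : R, forall s, s \in S -> c s = k * m s.
Proof.
move=> m0 em ec; have [S0|[s0 s0S]] := fset_0Vmem S.
  by exists 0 => s; rewrite S0.
have [s1 s1S min1] : exists2 s1, s1 \in S & forall s, s \in S -> c s1 / m s1 <= c s / m s.
  apply: contrapT => h.
  have : forall s, s \in S -> False; last by move=> /(_ s0 s0S).
  apply: (fset_real_ind (f := fun s => c s / m s)) => s sS IH.
  apply: h; exists s => // t tS; rewrite leNgt; apply/negP; exact: IH.
exists (c s1 / m s1) => s sS; apply/eqP; rewrite -subr_eq0; apply: contraT => ne.
have := @dep_full (fun s => c s - c s1 / m s1 * m s).
have h1 t : t \in S -> 0 <= c t - c s1 / m s1 * m t.
  by move=> tS; rewrite subr_ge0 -ler_pdivlMr ?m0 // min1.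
have h2 : \sum_(t <- S) (c t - c s1 / m s1 * m t) *: t = 0.
  under eq_bigr do rewrite scalerBl -scalerA.
  by rewrite sumrB ec -scaler_sumr em scaler0 subrr.
have h3 : exists2 t, t \in S & c t - c s1 / m s1 * m t != 0 by exists s.
by move=> /(_ h1 h2 h3 s1 s1S); rewrite divfK ?subrr ?ltxx // gt_eqF ?m0.
Qed.

(** The vectors of the base have one relation up to scaling, and it does not kill the levels; as
    affine functions they are therefore independent. This is what allows comparing coefficients
    later. *)
Lemma aff_free (c : V -> R) : \sum_(s <- S) c s *: s = 0 ->
  \sum_(s <- S) c s * (level s)%:~R = 0 -> forall s, s \in S -> c s = 0.
Proof.
move=> ec el s sS; have [m [m0 em lm _]] := base_dep.
have [t ht] := dep_prop m0 em ec.
have : t * (-1) = 0.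
  rewrite -el -lm mulr_sumr [RHS]big_seq big_seq; apply: eq_bigr => u uS.
  by rewrite ht // mulrA.
by rewrite ht // mulrN1 => /eqP; rewrite oppr_eq0 => /eqP ->; rewrite mul0r.
Qed.

End AffineBase.

(** * Alcoves and their closures *)

Section Topology.
Variables (R : realType) (l : nat).
Local Notation V := 'rV[R]_l.
Implicit Types (a x y : V).

Lemma dot_continuous a : continuous (dot a).
Proof.
have -> : dot a = fun x => \sum_j a 0 j * x 0 j by apply/funext => x; exact: dotE.
elim: (index_enum _) => [|j s IH].
  have -> : (fun x : V => \sum_(j <- [::]) a 0 j * x 0 j) = fun=> 0.
    by apply/funext => x; rewrite big_nil.
  exact: cst_continuous.
have -> : (fun x : V => \sum_(i <- j :: s) a 0 i * x 0 i) =
    fun x => a 0 j * x 0 j + \sum_(i <- s) a 0 i * x 0 i.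
  by apply/funext => x; rewrite big_cons.
have h : continuous (fun x : V => a 0 j * x 0 j).
  move=> x; apply: (@continuous_comp _ _ _ (fun M : V => M 0 j) ( *%R (a 0 j))).
    exact: coord_continuous.
  exact: mulrl_continuous.
by move=> x; exact: (cvgD (h x) (IH x)).
Qed.

Definition seg x y (t : R) : V := (1 - t) *: x + t *: y.

Lemma dot_seg a x y t : dot a (seg x y t) = (1 - t) * dot a x + t * dot a y.
Proof. by rewrite dotDr !dotZr. Qed.

Lemma seg_continuous x y : continuous (seg x y).
Proof.
move=> t A /= /(nbhs_ballP (seg x y t)) [e e0 eA].
suff H (i : 'I_1) (j : 'I_l) : nbhs (t : R)
    (fun u : R => ball (seg x y t i j) e (seg x y u i j)).
  have H' i := @filter_forall _ _ _ (nbhs (t : R)) (nbhs_filter (t : R)) (H i).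
  have := @filter_forall _ _ _ (nbhs (t : R)) (nbhs_filter (t : R)) H'.
  apply: filterS => u Hu; apply: eA; split=> [|i j]; [exact: e0|exact: Hu].
suff H : (fun u : R => seg x y u i j) @ (t : R) --> seg x y t i j.
  by apply: H; apply: nbhsx_ballx.
have E u : seg x y u i j = x i j + u * (y i j - x i j) by rewrite !mxE; lra.
under eq_fun do rewrite E; rewrite E.
exact: (cvgD (cvg_cst (x i j)) (@mulrr_continuous R (y i j - x i j) t)).
Qed.

End Topology.

Section Alcoves.
Variables (R : realType) (l : nat) (Phi D : {fset 'rV[R]_l}).
Hypothesis (rootPhi : root_system Phi) (simD : simple_roots Phi D).
Local Notation V := 'rV[R]_l.
Implicit Types (a x y : V).

Lemma alcove_complementP x : alcove_complement Phi D x <->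
  x \in rspan Phi /\ forall a, a \in Phi -> dot a x \isn't a Num.int.
Proof.
split=> -[xU h]; split=> // a.
  move=> aP; apply/negP => /intrP[n e].
  have [ap|ap] := pos_or_neg rootPhi simD aP; first by apply: (h a n ap).
  by apply: (h _ (- n) ap); split=> //; rewrite dotNl e intrN.
move=> n /pos_root aP [_ e]; have := h a aP; rewrite e.
by rewrite intr_int.
Qed.

Section OneAlcove.
Variable x0 : V.
Hypotheses (x0U : x0 \in rspan Phi)
  (x0_regular : forall a, a \in Phi -> dot a x0 \isn't a Num.int).
Local Notation A := (connected_component (alcove_complement Phi D) x0).
Local Notation aff := (affval x0).

Lemma regular_alcove : alcove Phi D A.
Proof. by exists x0 => //; apply/alcove_complementP. Qed.

(** One direction is the intermediate value theorem: a connected set on which [dot a] passes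
    [level a] contains a point with that integer value. For the other, the segment from [x0] to [y]
    avoids all hyperplanes. *)
Lemma alcoveP y : A y <-> y \in rspan Phi /\ forall a, a \in Phi -> 0 < aff a y.
Proof.
have x0C : alcove_complement Phi D x0 by apply/alcove_complementP.
split=> [[B [Bx0 BC cB By]]|[yU hy]].
  split=> [|a aP]; first by have [] := BC y By.
  rewrite subr_gt0 ltNge; apply/negP => le.
  have cI : connected (dot a @` B)%classic.
    apply: connected_continuous_connected => //.
    by apply: continuous_subspaceT; exact: dot_continuous.
  have := (connected_intervalP _).1 cI (dot a y) (dot a x0).
  have i1 : (dot a @` B)%classic (dot a y) by exists y.
  have i2 : (dot a @` B)%classic (dot a x0) by exists x0.
  move=> /(_ i1 i2 (level x0 a)%:~R); rewrite le floor_le => /(_ isT) [z Bz e].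
  have /alcove_complementP[_ /(_ a aP)] := BC z Bz.
  by rewrite e intr_int.
exists (seg x0 y @` `[0, 1])%classic; last first.
  by exists 1; rewrite /= ?in_itv /= ?ler01 ?lexx // /seg subrr scale0r scale1r add0r.
split.
- by exists 0; rewrite /= ?in_itv /= ?ler01 ?lexx // /seg subr0 scale0r scale1r addr0.
- move=> _ [t /= t01 <-]; apply/alcove_complementP; split.
    by rewrite rpredD // rpredZ.
  move=> a aP; have aN := root_opp rootPhi aP.
  apply/negP => /intrP[n].
  move: t01; rewrite in_itv /= => /andP[t0 t1] e.
  have pos b : b \in Phi -> 0 < aff b (seg x0 y t).
    move=> bP; rewrite /aff dot_seg.
    have := hy b bP; have := aff_gt0 x0_regular bP; rewrite /aff => h1 h2.
    have [->|tn0] := eqVneq t 0; first by rewrite subr0 mul0r addr0 mul1r.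
    have tp : 0 < t by rewrite lt_def tn0.
    have := mulr_gt0 tp h2; have := mulr_ge0 (_ : 0 <= 1 - t) (ltW h1).
    by rewrite subr_ge0 => /(_ t1); nra.
  have := pos a aP; have := pos _ aN; rewrite (affN x0_regular) // /aff e => p2 p1.
  have h1 : 0 < n - level x0 a by rewrite -(ltr0z R) intrB.
  have h2 : n - level x0 a < 1 by rewrite -(ltr_int R) intrB; lra.
  by move: h1 h2; lia.
- apply: connected_continuous_connected; first exact: segment_connected.
  by apply: continuous_subspaceT; exact: seg_continuous.
Qed.

Lemma alcove_x0 : A x0.
Proof. by apply/alcoveP; split=> // a; exact: aff_gt0. Qed.

Lemma closure_alcoveP y : closure A y <->
  y \in rspan Phi /\ forall a, a \in Phi -> 0 <= aff a y.
Proof.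
split=> [cy|[yU hy] B nB].
  have le v (c : R) : (forall z, A z -> c <= dot v z) -> c <= dot v y.
    move=> h; have {}cy := @closure_subset _ A (dot v @^-1` [set z | c <= z])%classic h _ cy.
    have /closure_id e : closed (dot v @^-1` [set z | c <= z])%classic.
      apply: (continuous_closedP _).1; first exact: dot_continuous.
      exact: closed_ge.
    by rewrite -e in cy.
  split=> [|a aP]; last first.
    by rewrite subr_ge0; apply: le => z /alcoveP[_ /(_ a aP)]; rewrite subr_gt0 => /ltW.
  (* [p] is the orthogonal projection of [y] to the span. Pairing with [y - p] vanishes on the
     alcove, hence is nonpositive at [y], where it is the squared length of [y - p]. *)
  have [p pU hp] := simple_point simD (fun v => dot v y).
  have E z : z \in rspan Phi -> dot z (y - p) = 0.
    rewrite (rspanE simD) => zU; apply: (span_perp zU) => d dD.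
    by rewrite dotBr hp // subrr.
  suff : y - p = 0 by move/eqP; rewrite subr_eq0 => /eqP ->.
  apply: dot_eq0; have h0 : dot (y - p) y <= 0.
    rewrite -oppr_ge0 -dotNl; apply: le => z /alcoveP[zU _].
    by rewrite dotNl dotC E // oppr0.
  have := dot_ge0 (y - p); rewrite {2}/GRing.add /= dotBr [X in _ - X]dotC E // subr0.
  by move=> h1; apply/le_anti; rewrite h0 h1.
have /(_ B) := @seg_continuous R l y x0 0.
rewrite /seg subr0 scale0r scale1r addr0 => /(_ nB).
rewrite /nbhs /= => /nbhs_ballP [e /= e0 eB].
pose t := Num.min (e / 2) 1; have e2 : 0 < e / 2 by lra.
have t0 : 0 < t by rewrite lt_min e2 ltr01.
have t1 : t <= 1 by rewrite ge_min lexx orbT.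
have te : t < e by rewrite gt_min; apply/orP; left; lra.
exists (seg y x0 t); split; last first.
  by apply: eB; rewrite /ball /= sub0r normrN gtr0_norm.
apply/alcoveP; split; first by rewrite rpredD // rpredZ.
move=> a aP; rewrite /aff dot_seg; have := hy a aP.
have := aff_gt0 x0_regular aP; rewrite /aff => h1 h2.
have := mulr_gt0 t0 h1; have := mulr_ge0 (_ : 0 <= 1 - t) h2.
by rewrite subr_ge0 => /(_ t1); nra.
Qed.

End OneAlcove.

Lemma alcove_regular A : alcove Phi D A -> exists x0, [/\ x0 \in rspan Phi,
  forall a, a \in Phi -> dot a x0 \isn't a Num.int &
  A = connected_component (alcove_complement Phi D) x0].
Proof. by case=> x0 /alcove_complementP[h1 h2] ->; exists x0. Qed.

End Alcoves.

(** * Walls and ceilings *)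

Section ConvexHull.
Variables (R : realType) (l : nat).
Local Notation V := 'rV[R]_l.
Implicit Types (s : {fset V}) (v w : V).

Lemma big_delta s v (f : V -> R) : v \in s -> \sum_(w <- s) f w * (w == v)%:R = f v.
Proof.
move=> vs; rewrite (bigD1_seq v) ?fset_uniq //= eqxx mulr1 big1 ?addr0 //.
by move=> w /negPf ->; rewrite mulr0.
Qed.

Lemma big_delta_scale s v : v \in s -> \sum_(w <- s) ((w == v)%:R : R) *: w = v.
Proof.
move=> vs; rewrite (bigD1_seq v) ?fset_uniq //= eqxx scale1r big1 ?addr0 //.
by move=> w /negPf ->; rewrite scale0r.
Qed.

Lemma conv_hull_mem s v : v \in s -> conv_hull s v.
Proof.
move=> vs; exists (fun w => (w == v)%:R); split=> [w _||]; first exact: ler0n.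
  by have := big_delta (fun=> 1) vs; under eq_bigr do rewrite mul1r.
by rewrite big_delta_scale.
Qed.

(* The vertices of a simplex are its extreme points. *)
Lemma conv_hull_sub s s' : aff_indep s -> conv_hull s = conv_hull s' -> s `<=` s'.
Proof.
move=> indep e; apply/fsubsetP => v vs.
have [lam [lam0 lam1 ev]] : conv_hull s' v by rewrite -e; exact: conv_hull_mem.
have /choice[T hT] : forall w, exists t : V -> R, w \in s' ->
    [/\ forall u, u \in s -> 0 <= t u, \sum_(u <- s) t u = 1
       & w = \sum_(u <- s) t u *: u].
  move=> w; have [ws'|_] := boolP (w \in s'); last by exists (fun=> 0).
  by have := conv_hull_mem ws'; rewrite -e => -[t ht]; exists t.
(* Expanding each [w] of [s'] over [s] gives a second barycentric expression of [v], so its weight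
   at [v] is 1. Some [w] with nonzero [lam w] then has all its weight at [v], so that [w = v]. *)
have := indep (fun u => \sum_(w <- s') lam w * T w u - (u == v)%:R).
have d1 : \sum_(u <- s) (u == v)%:R = 1 :> R.
  by have := big_delta (fun=> 1) vs; under eq_bigr do rewrite mul1r.
have h1 : \sum_(u <- s) (\sum_(w <- s') lam w * T w u - (u == v)%:R) = 0.
  rewrite sumrB exchange_big d1 -[in RHS](subrr 1) -[in RHS]lam1 lam1 -lam1.
  congr (_ - _); rewrite big_seq [RHS]big_seq; apply: eq_bigr => w ws.
  by rewrite -mulr_sumr; have [_ -> _] := hT w ws; rewrite mulr1.
have h2 : \sum_(u <- s) (\sum_(w <- s') lam w * T w u - (u == v)%:R) *: u = 0.
  under eq_bigr do rewrite scalerBl scaler_suml.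
  rewrite sumrB big_delta_scale // exchange_big [X in _ - X]ev.
  apply/eqP; rewrite subr_eq0; apply/eqP.
  rewrite big_seq [RHS]big_seq; apply: eq_bigr => w ws.
  under eq_bigr do rewrite -scalerA.
  by rewrite -scaler_sumr -(let: And3 _ _ ew := hT w ws in ew).
move=> /(_ h1 h2 v vs); rewrite eqxx => /eqP; rewrite subr_eq0 => /eqP eT.
have T1 w : w \in s' -> T w v <= 1.
  move=> ws; have [T0 <- _] := hT w ws.
  rewrite (bigD1_seq v) ?fset_uniq //= lerDl big_seq_cond sumr_ge0 // => u /andP[us _].
  exact: T0.
have : \sum_(w <- s') lam w * (1 - T w v) = 0.
  under eq_bigr do rewrite mulrBr mulr1.
  by rewrite sumrB lam1 eT subrr.
move/eqP; rewrite big_seq psumr_eq0 => [/allP z|w ws]; last first.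
  by rewrite mulr_ge0 ?lam0 // subr_ge0 T1.
have [w ws lw] : exists2 w, w \in s' & lam w != 0.
  apply: contrapT => h; have := @oner_neq0 R; rewrite -lam1.
  rewrite big_seq big1 ?eqxx // => w ws; apply/eqP; apply: contraT => lw.
  by case: h; exists w.
have := z w ws; rewrite ws mulf_eq0 (negPf lw) subr_eq0 /= => /eqP Twv.
have [T0 Ts ew] := hT w ws.
suff -> : v = w by [].
rewrite ew -[LHS](big_delta_scale vs) big_seq [RHS]big_seq.
apply: eq_bigr => u us; congr (_ *: _); have [->|uv] := eqVneq u v => //=.
move: Ts; rewrite (bigD1_seq v) ?fset_uniq //= -Twv => /eqP.
rewrite addrC -subr_eq0 addrK big_seq_cond psumr_eq0 => [/allP /(_ u us)|x /andP[/T0]//].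
by rewrite us uv /= => /eqP ->.
Qed.

End ConvexHull.

Section Walls.
Variables (R : realType) (l : nat) (Phi D : {fset 'rV[R]_l}) (x0 : 'rV[R]_l).
Local Notation V := 'rV[R]_l.
Hypotheses (rootPhi : root_system Phi) (irrPhi : irreducible_roots Phi).
Hypothesis simD : simple_roots Phi D.
Hypotheses (x0U : x0 \in rspan Phi)
  (x0_regular : forall a, a \in Phi -> dot a x0 \isn't a Num.int).
Implicit Types (a b s t y : V).
Local Notation A := (connected_component (alcove_complement Phi D) x0).
Local Notation S := (alcove_base Phi x0).
Local Notation U := (rspan Phi).
Local Notation aff := (affval x0).
Local Notation lev := (level x0).

Lemma base_sep x y : x \in U -> y \in U ->
  (forall s, s \in S -> aff s x = aff s y) -> x = y.
Proof.
move=> xU yU h; apply/eqP; rewrite -subr_eq0; apply/eqP.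
apply: (span_perp0 (rpredB xU yU)) => a aP.
have [c [ea el]] := base_expand x0_regular aP.
have := aff_comb x ea el; have := aff_comb y ea el.
have -> : \sum_(s <- S) (c s)%:R * aff s y = \sum_(s <- S) (c s)%:R * aff s x.
  by rewrite big_seq [RHS]big_seq; apply: eq_bigr => s /h ->.
by move=> <-; rewrite /affval dotBr; lra.
Qed.

Lemma alcove_baseP y : A y <-> y \in U /\ forall s, s \in S -> 0 < aff s y.
Proof.
rewrite (alcoveP rootPhi simD x0U x0_regular y).
split=> -[yU h]; split=> // a; first by move/base_root/h.
move=> aP; have [c [ea el]] := base_expand x0_regular aP.
have ge0 s : s \in S -> 0 <= (c s)%:R * aff s y by move=> /h h1; rewrite mulr_ge0 ?ler0n ?ltW.
rewrite (aff_comb y ea el) lt_def; apply/andP; split; last first.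
  by rewrite big_seq; exact: sumr_ge0.
(* A zero at [y] would annihilate all coefficients, and [affval a] would vanish at [x0] too. *)
apply/eqP => /eqP; rewrite big_seq psumr_eq0 // => /allP z.
have := aff_gt0 x0_regular aP; rewrite (aff_comb x0 ea el) big_seq big1 ?ltxx // => s sS.
have := z s sS; rewrite sS mulf_eq0 (gt_eqF (h s sS)) orbF => /eqP ->.
by rewrite mul0r.
Qed.

Lemma closure_baseP y : closure A y <-> y \in U /\ forall s, s \in S -> 0 <= aff s y.
Proof.
rewrite (closure_alcoveP rootPhi simD x0U x0_regular y).
split=> -[yU h]; split=> // a; first by move/base_root/h.
move=> aP; have [c [ea el]] := base_expand x0_regular aP.
by rewrite (aff_comb y ea el) big_seq sumr_ge0 // => s /h h1; rewrite mulr_ge0 ?ler0n.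
Qed.

Section Vertices.
Variables (m : V -> R) (s1 : V).
Hypotheses (m_gt0 : forall s, s \in S -> 0 < m s)
  (m_dep : \sum_(s <- S) m s *: s = 0)
  (m_lev : \sum_(s <- S) m s * (lev s)%:~R = -1) (s1S : s1 \in S).

Lemma sum_aff y : \sum_(s <- S) m s * aff s y = 1.
Proof.
under eq_bigr do rewrite /affval mulrBr.
rewrite sumrB m_lev; under eq_bigr do rewrite -dotZl.
by rewrite -dot_suml m_dep dot0l; lra.
Qed.

(** A relation that avoids [s1] is a multiple of [m], which is positive at [s1]. *)
Lemma base_basis : basis_of U (enum_fset (S `\ s1)).
Proof.
have split_sum (M : zmodType) (F : V -> M) :
    \sum_(s <- S) F s = F s1 + \sum_(s <- S `\ s1) F s.
  by rewrite (big_fsetD1 s1).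
rewrite /basis_of andbC; apply/andP; split.
  apply: free_fset => c ec.
  pose c' s := if s == s1 then 0 else c s.
  have ec' : \sum_(s <- S) c' s *: s = 0.
    rewrite split_sum /c' eqxx scale0r add0r -[RHS]ec.
    rewrite big_seq [RHS]big_seq; apply: eq_bigr => s.
    by rewrite in_fsetD1 => /andP[/negPf ->].
  have [k hk] := dep_prop rootPhi irrPhi x0_regular m_gt0 m_dep ec'.
  have := hk s1 s1S; rewrite /c' eqxx => /esym/eqP.
  rewrite mulf_eq0 (gt_eqF (m_gt0 s1S)) orbF => /eqP k0 s.
  by rewrite in_fsetD1 => /andP[/negPf s1s sS]; have := hk s sS; rewrite /c' s1s k0 mul0r.
rewrite eqEsubv; apply/andP; split.
  apply/span_subvP => s; rewrite in_fsetD1 => /andP[_ sS].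
  by apply: mem_rspan; apply: base_root sS.
have mem s : s \in S -> s \in <<enum_fset (S `\ s1)>>%VS.
  move=> sS; have [->|ss1] := eqVneq s s1; last first.
    by apply: memv_span; rewrite in_fsetD1 ss1 sS.
  have : s1 = - (m s1)^-1 *: \sum_(s <- S `\ s1) m s *: s.
    have /eqP := m_dep; rewrite split_sum addrC addr_eq0 => /eqP ->.
    by rewrite scaleNr scalerN opprK scalerA mulVf ?scale1r // gt_eqF ?m_gt0.
  move=> e; rewrite [X in X \in _]e; apply: memvZ; rewrite big_seq memv_suml // => t tS.
  by apply: memvZ; apply: memv_span.
apply/span_subvP => a aP; have [c [-> _]] := base_expand x0_regular aP.
by rewrite big_seq memv_suml // => s sS; apply: memvZ; apply: mem.
Qed.

(** The values away from [s1] are free by [base_basis]; the one at [s1] is then forced by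
    [sum_aff]. *)
Lemma affine_point (z : V -> R) : \sum_(s <- S) m s * z s = 1 ->
  exists2 v, v \in U & forall s, s \in S -> aff s v = z s.
Proof.
move=> ez; have [v vU hv] := dual_point (fun s => z s + (lev s)%:~R) base_basis.
have h s : s \in S -> s != s1 -> aff s v = z s.
  by move=> sS ss1; rewrite /affval hv ?addrK // in_fsetD1 ss1 sS.
exists v => // s sS; have [->|] := eqVneq s s1; last exact: h.
have := sum_aff v; rewrite -ez !(big_fsetD1 s1 s1S) /=.
have -> : \sum_(s <- S `\ s1) m s * aff s v = \sum_(s <- S `\ s1) m s * z s.
  rewrite big_seq [RHS]big_seq; apply: eq_bigr => t.
  by rewrite in_fsetD1 => /andP[ts1 tS]; rewrite h.
by move=> /addIr /mulfI; apply; rewrite gt_eqF ?m_gt0.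
Qed.

(** The vertex opposite to the wall of [s]; the value [1 / m s] is the only one compatible with
    [sum_aff]. *)
Definition vert s : V :=
  get [set v | v \in U /\ forall t, t \in S -> aff t v = (t == s)%:R / m s].

Lemma vertP s : s \in S ->
  vert s \in U /\ forall t, t \in S -> aff t (vert s) = (t == s)%:R / m s.
Proof.
move=> sS; have [|v vU hv] := @affine_point (fun t => (t == s)%:R / m s).
  under eq_bigr do rewrite mulrCA mulrC.
  by rewrite big_delta // divff // gt_eqF ?m_gt0.
by rewrite /vert; case: xgetP => [w -> //|/(_ v)]; case.
Qed.

Lemma vert_U s : s \in S -> vert s \in U.
Proof. by case/vertP. Qed.

Lemma aff_vert s t : s \in S -> t \in S -> aff t (vert s) = (t == s)%:R / m s.
Proof. by move=> /vertP[_]; apply. Qed.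

Lemma vert_inj : {in S &, injective vert}.
Proof.
move=> s t sS tS e; have := aff_vert sS tS; rewrite e aff_vert // eqxx mul1r.
case: eqVneq => // _; rewrite mul0r => /eqP.
by rewrite invr_eq0 gt_eqF ?m_gt0.
Qed.

Definition verts : {fset V} := [fset vert s | s in S].

Lemma big_verts (M : zmodType) (F : V -> M) :
  \sum_(v <- verts) F v = \sum_(s <- S) F (vert s).
Proof. by rewrite big_imfset //=; exact: vert_inj. Qed.

(** The weights sum to 1 by [sum_aff], and the two sides agree under every base function because
    [vert s] is dual to them. *)
Lemma barycentric y : y \in U -> y = \sum_(s <- S) (m s * aff s y) *: vert s.
Proof.
move=> yU; apply: base_sep => // [|t tS].
  by rewrite big_seq memv_suml // => s /vert_U h; apply: memvZ.
rewrite [RHS]/affval dot_sumr.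
have -> : (lev t)%:~R = \sum_(s <- S) (m s * aff s y) * (lev t)%:~R.
  by rewrite -mulr_suml sum_aff mul1r.
rewrite -sumrB; transitivity (\sum_(s <- S) aff s y * (s == t)%:R).
  by rewrite big_delta.
rewrite big_seq [RHS]big_seq; apply: eq_bigr => s sS.
rewrite dotZr -mulrBr -/(affval x0 t (vert s)) aff_vert // [t == s]eq_sym.
by move: (_%:R) => e; field; rewrite gt_eqF ?m_gt0.
Qed.

Lemma card_verts : #|` verts| = (\dim U).+1.
Proof.
rewrite card_in_imfset /=; last exact: vert_inj.
rewrite (cardfsD1 s1) s1S add1n; congr _.+1.
by have /andP[/eqP <- /eqnP ->] := base_basis.
Qed.

Lemma verts_indep : aff_indep verts.
Proof.
move=> c; rewrite !big_verts => c1 c2 v /imfsetP[/= t tS ->].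
have : dot t (\sum_(s <- S) c (vert s) *: vert s) - \sum_(s <- S) c (vert s) * (lev t)%:~R
    = 0 by rewrite c2 dot0r -mulr_suml c1 mul0r subrr.
rewrite dot_sumr -sumrB big_seq.
under eq_bigr => s sS do
  rewrite dotZr -mulrBr -/(affval x0 t (vert s)) aff_vert // mulrCA mulrC eq_sym.
rewrite -big_seq big_delta // => /eqP; rewrite mulf_eq0 invr_eq0.
by rewrite (gt_eqF (m_gt0 tS)) orbF => /eqP.
Qed.

Lemma closure_hull : closure A = conv_hull verts.
Proof.
apply/seteqP; split=> y.
  move=> /closure_baseP[yU hy].
  have tE s : s \in S -> \sum_(t <- S) (m t * aff t y) * (vert t == vert s)%:R = m s * aff s y.
    move=> sS; rewrite -[RHS](big_delta (fun t => m t * aff t y) sS) big_seq [RHS]big_seq.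
    apply: eq_bigr => t tS; congr (_ * (_ : bool)%:R).
    by apply/eqP/eqP => [/vert_inj -> //|->].
  exists (fun v => \sum_(t <- S) (m t * aff t y) * (vert t == v)%:R); split.
  - move=> v _; rewrite big_seq sumr_ge0 // => t tS.
    by rewrite mulr_ge0 ?ler0n // mulr_ge0 ?hy // ltW ?m_gt0.
  - rewrite big_verts -[RHS](sum_aff y) big_seq [RHS]big_seq.
    by apply: eq_bigr => s /tE.
  - rewrite big_verts {1}(barycentric yU) big_seq [RHS]big_seq.
    by apply: eq_bigr => s /tE ->.
move=> [c [c0 c1 ->]]; apply/closure_baseP; rewrite big_verts.
have cv s : s \in S -> 0 <= c (vert s) by move=> sS; apply: c0; apply: in_imfset.
split=> [|t tS]; first by rewrite big_seq memv_suml // => s /vert_U h; apply: memvZ.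
rewrite /affval dot_sumr; have -> : (lev t)%:~R = \sum_(s <- S) c (vert s) * (lev t)%:~R.
  by rewrite -mulr_suml -(big_verts c) c1 mul1r.
rewrite -sumrB big_seq sumr_ge0 // => s sS.
rewrite dotZr -mulrBr -/(affval x0 t (vert s)) aff_vert //.
by rewrite mulr_ge0 ?cv // mulr_ge0 ?ler0n // invr_ge0 ltW ?m_gt0.
Qed.

Lemma dim_gt0 : exists r, \dim U = r.+1.
Proof.
case e : (\dim U) => [|r]; last by exists r.
have /eqP := e; rewrite dimv_eq0 => /eqP U0; have s1P := base_root s1S.
have := mem_rspan s1P; rewrite U0 memv0 => /eqP s10.
by have := root_nz rootPhi s1P; rewrite s10 eqxx.
Qed.

(** The facet is spanned by the vertices other than [vert s]. The last clause serves to place a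
    point of the closure that lies on a wall in a facet. *)
Lemma base_facet s : s \in S -> exists F, [/\ facet Phi A F,
  (F `<=` hyp Phi s (lev s)%:~R)%classic
  & forall y, closure A y -> aff s y = 0 -> F y].
Proof.
move=> sS; have vS : vert s \in verts by apply: in_imfset.
have subU (c : V -> R) : \sum_(v <- verts `\ vert s) c v *: v \in U.
  rewrite big_seq memv_suml // => v; rewrite in_fsetD1 => /andP[_ /imfsetP[t tS ->]].
  by apply: memvZ; apply: vert_U.
exists (conv_hull (verts `\ vert s)); split.
- have [r er] := dim_gt0; exists r; split=> //; exists verts, (verts `\ vert s).
  have ind := verts_indep; have card := card_verts.
  split; [split=> //; [by rewrite card er|exact: closure_hull]|exact: fsubD1set|].
  split=> //.
    by move: card; rewrite (cardfsD1 (vert s)) vS er => -[].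
  move=> c c1 c2 v vv; have vs : v != vert s by move: vv; rewrite in_fsetD1 => /andP[].
  have := ind (fun v => if v == vert s then 0 else c v).
  rewrite !(big_fsetD1 (vert s) vS) /= eqxx scale0r !add0r.
  have e (M : zmodType) (G : R -> V -> M) :
      \sum_(w <- verts `\ vert s) G (if w == vert s then 0 else c w) w =
      \sum_(w <- verts `\ vert s) G (c w) w.
    rewrite big_seq [RHS]big_seq; apply: eq_bigr => w.
    by rewrite in_fsetD1 => /andP[/negPf ->].
  rewrite (e _ (fun k _ => k)) (e _ (fun k w => k *: w)) => /(_ c1 c2 v).
  by rewrite (negPf vs); apply; move: vv; rewrite in_fsetD1 => /andP[].
- move=> y [c [c0 c1 ->]]; split=> //; rewrite dot_sumr.
  rewrite -[RHS]mul1r -{1}c1 mulr_suml big_seq [RHS]big_seq.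
  apply: eq_bigr => v; rewrite in_fsetD1 => /andP[vs /imfsetP[/= t tS ev]].
  rewrite dotZr; congr (_ * _); apply/eqP; rewrite -subr_eq0 ev.
  rewrite -/(affval x0 s (vert t)). rewrite aff_vert //.
  by case: (eqVneq s t) => [e|_]; [rewrite ev e eqxx in vs|rewrite mul0r eqxx].
- move=> y Ay ay0; have := Ay; rewrite closure_hull => -[c [c0 c1 ec]].
  have cs : c (vert s) = 0.
    have := ay0; rewrite /affval ec dot_sumr -[X in _ - X]mul1r -{1}c1 mulr_suml -sumrB.
    rewrite big_verts big_seq.
    under eq_bigr => t tS do
      rewrite dotZr -mulrBr -/(affval x0 s (vert t)) aff_vert // mulrCA mulrC eq_sym.
    rewrite -big_seq big_delta // => /eqP; rewrite mulf_eq0 invr_eq0.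
    by rewrite (gt_eqF (m_gt0 sS)) orbF => /eqP.
  exists c; split=> [v| |].
  - by rewrite in_fsetD1 => /andP[_]; apply: c0.
  - by rewrite -c1 (big_fsetD1 (vert s) vS) /= cs add0r.
  - by rewrite ec (big_fsetD1 (vert s) vS) /= cs scale0r add0r.
Qed.

Lemma hyp_hyperplane a (c : R) : a \in Phi -> hyperplane Phi (hyp Phi a c).
Proof.
by move=> aP; exists a, c; split=> //; [exact: mem_rspan|exact: (root_nz rootPhi)].
Qed.

Lemma base_wall s : s \in S -> wall Phi A (hyp Phi s (lev s)%:~R).
Proof.
move=> sS; split; first by apply: hyp_hyperplane; apply: base_root sS.
by have [F [fF FH _]] := base_facet sS; exists F.
Qed.

(** The definition of a facet lets the vertex set vary; [conv_hull_sub] reduces it to [verts]. By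
    cardinality a facet omits a single [vert s], and an affine function vanishing at the other
    vertices is a multiple of [aff s]. *)
Lemma wall_base H : wall Phi A H -> exists2 s, s \in S & H = hyp Phi s (lev s)%:~R.
Proof.
move=> [[a [c [aU a0 ->]]]] [F [r [er [sv [s' [[csv isv esv] ss' [cs' _ eF]]]]]] FH].
have esv' : sv `<=` verts.
  by apply: conv_hull_sub => //; rewrite -esv; exact: closure_hull.
have s'v := fsubset_trans ss' esv'.
have card := card_verts; rewrite er in card.
have [v vv vs'] : exists2 v, v \in verts & v \notin s'.
  by apply/fsubsetPn/negP => /fsubset_leq_card; rewrite card cs' ltnn.
have /imfsetP[/= s sS ev] := vv.
have es' : s' = verts `\ v.
  apply/eqP; rewrite eqEfcard; apply/andP; split.
    apply/fsubsetP => w ws; rewrite in_fsetD1 (fsubsetP s'v) // andbT.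
    by apply: contra vs' => /eqP <-.
  by rewrite cs'; move: card; rewrite (cardfsD1 v) vv add1n => -[->].
exists s => //.
have dv t : t \in S -> t != s -> dot a (vert t) = c.
  move=> tS ts; have [|_ //] := FH (vert t); rewrite eF es'.
  apply: conv_hull_mem; rewrite in_fsetD1 ev in_imfset // andbT.
  by apply: contra ts => /eqP /vert_inj -> //.
pose k := m s * (dot a (vert s) - c).
have dk y : y \in U -> dot a y - c = k * aff s y.
  move=> yU; rewrite {1}(barycentric yU) dot_sumr -{1}[c]mul1r -(sum_aff y) mulr_suml.
  rewrite -sumrB (big_fsetD1 s) //= big_seq big1 ?addr0.
    by rewrite dotZr /k; ring.
  by move=> t; rewrite in_fsetD1 => /andP[ts tS]; rewrite dotZr dv // subrr.
have k0 : k != 0.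
  apply: contra_neq a0 => k0; apply: dot_eq0.
  have := dk 0 (mem0v _); have := dk a aU; rewrite k0 !mul0r dot0r; lra.
apply/seteqP; split=> y [yU ey]; split=> //.
  have := dk y yU; rewrite ey subrr => /esym/eqP.
  by rewrite mulf_eq0 (negPf k0) /= subr_eq0 => /eqP.
by have := dk y yU; rewrite /affval ey subrr mulr0 => /eqP; rewrite subr_eq0 => /eqP.
Qed.

End Vertices.
End Walls.

Lemma int_between (m n : int) : m <= n -> n <= m + 1 -> m = n \/ m = n - 1.
Proof. lia. Qed.

Section Ceilings.
Variables (R : realType) (l : nat) (Phi D : {fset 'rV[R]_l}) (x0 : 'rV[R]_l).
Local Notation V := 'rV[R]_l.
Hypotheses (rootPhi : root_system Phi) (irrPhi : irreducible_roots Phi).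
Hypothesis simD : simple_roots Phi D.
Hypotheses (x0U : x0 \in rspan Phi)
  (x0_regular : forall a, a \in Phi -> dot a x0 \isn't a Num.int).
Implicit Types (a b s t x y : V).
Local Notation A := (connected_component (alcove_complement Phi D) x0).
Local Notation S := (alcove_base Phi x0).
Local Notation Phip := (positive_roots Phi D).
Local Notation aff := (affval x0).
Local Notation lev := (level x0).

Lemma hypN a (c : R) : hyp Phi (- a) (- c) = hyp Phi a c.
Proof.
by apply/seteqP; split=> y [yU e]; split=> //; move: e; rewrite dotNl; lra.
Qed.

Lemma aff_hyp s y : y \in rspan Phi -> aff s y = 0 <-> hyp Phi s (lev s)%:~R y.
Proof.
move=> yU; rewrite /affval; split=> [/eqP|[_ ->]]; last exact: subrr.
by rewrite subr_eq0 => /eqP.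
Qed.

(** At the origin [aff s] equals [- lev s], so the sign of the level tells on which side of the wall
    the origin lies. *)
Lemma base_ceiling s : s \in S -> lev s < 0 -> ceiling Phi A (hyp Phi s (lev s)%:~R).
Proof.
move=> sS sn; have [m [m0 em lm [s1 s1S]]] := base_dep rootPhi irrPhi x0_regular.
split.
- exact: (base_wall rootPhi irrPhi simD x0U x0_regular m0 em lm s1S).
- case=> _; rewrite dot0r => e; move: sn; rewrite -(ltr_int R) -e.
  by rewrite ltxx.
move=> y /(alcove_baseP rootPhi simD x0U x0_regular)[yU hy] k /andP[k0 k1] [_].
rewrite scaler0 add0r dotZr => e.
have := hy s sS; rewrite /affval -e; move: sn; rewrite -(ltr_int R) -e => kd.
by have [d0|d0] := lerP 0 (dot s y); nra.
Qed.

Lemma ceiling_lev s : s \in S -> ceiling Phi A (hyp Phi s (lev s)%:~R) -> lev s < 0.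
Proof.
move=> sS [_ n0 side]; have sP := base_root sS.
have := aff_gt0 x0_regular sP; rewrite /affval => x0s.
have Ax0 := alcove_x0 rootPhi simD x0U x0_regular.
rewrite ltNge; apply/negP => s0; have s0' : (0 : R) <= (lev s)%:~R by rewrite ler0z.
have d0 : 0 < dot s x0 by lra.
(* The parameter at which the segment from 0 to [x0] meets the wall. *)
apply: (side x0 Ax0 ((lev s)%:~R / dot s x0)).
  by rewrite divr_ge0 ?(ltW d0) //= ler_pdivrMr // mul1r; lra.
rewrite scaler0 add0r; split; first by rewrite rpredZ.
by rewrite dotZr divfK // gt_eqF.
Qed.

Lemma conv_hull_mono (s s' : {fset V}) : s `<=` s' ->
  (conv_hull s `<=` conv_hull s')%classic.
Proof.
move=> ss' y [c [c0 c1 ->]].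
have E (M : zmodType) (F : V -> M) : \sum_(v <- s') (if v \in s then F v else 0)
    = \sum_(v <- s) F v.
  rewrite -(big_fset_incl _ ss') => [|v _ /negPf -> //].
  by rewrite big_seq [RHS]big_seq; apply: eq_bigr => v ->.
exists (fun v => if v \in s then c v else 0); split.
- by move=> v _; case: ifP => // /c0.
- by rewrite E.
- by rewrite -E; apply: eq_bigr => v _; case: ifP => // _; rewrite scale0r.
Qed.

Lemma upper_closureP y : upper_closure Phi A y <->
  closure A y /\ forall s, s \in S -> aff s y = 0 -> lev s < 0.
Proof.
have [m [m0 em lm [s1 s1S]]] := base_dep rootPhi irrPhi x0_regular.
have bw := base_wall rootPhi irrPhi simD x0U x0_regular m0 em lm s1S.
have wb := wall_base rootPhi irrPhi simD x0U x0_regular m0 em lm s1S.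
have bf := base_facet rootPhi irrPhi simD x0U x0_regular m0 em lm s1S.
have cU z : closure A z -> z \in rspan Phi.
  by case/(closure_baseP rootPhi simD x0U x0_regular).
split=> [[Ay|[[F [H [[r [_ [sv [s' [[_ _ ecl] ss' [_ _ eF]]]]]] _ _ Fy]]] hy]]|].
- split=> [|s sS e]; first exact: subset_closure.
  case/(alcove_baseP rootPhi simD x0U x0_regular): Ay => _ /(_ s sS).
  by rewrite e ltxx.
- have cy : closure A y by rewrite ecl; apply: (conv_hull_mono ss'); rewrite -eF.
  split=> // s sS /(aff_hyp _ (cU _ cy)) yH.
  apply: ceiling_lev => //; apply: contrapT => nc.
  by apply: hy yH => //; exact: bw.
move=> [cy hy]; have yU := cU _ cy.
have [[s sS e]|none] := pselect (exists2 s, s \in S & aff s y = 0); last first.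
  left; apply/(alcove_baseP rootPhi simD x0U x0_regular); split=> // s sS.
  rewrite lt_def; case/(closure_baseP rootPhi simD x0U x0_regular): cy => _ -> //.
  by rewrite andbT; apply/eqP => e; apply: none; exists s.
right; split.
  have [F [fF FH Fy]] := bf s sS.
  exists F, (hyp Phi s (lev s)%:~R); split=> //; last exact: Fy.
  by apply: base_ceiling => //; exact: hy.
move=> H /wb[t tS ->] nc yH; apply: nc; apply: base_ceiling => //.
by apply: hy => //; apply/aff_hyp.
Qed.

Section Positive.
Hypothesis x0_pos : forall d, d \in D -> 0 < dot d x0.

Lemma neg_lev s : s \in Phi -> lev s < 0 -> - s \in Phip.
Proof.
move=> sP sn; case: (pos_or_neg rootPhi simD sP) => // /(pos_gt0 rootPhi) /(_ x0_pos).
move=> h; have := floor_ge0 (dot s x0); rewrite (ltW h) => h0.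
by move: sn; rewrite ltNge /level h0.
Qed.

Lemma nonpos_comb a (c : V -> nat) : a = \sum_(s <- S) (c s)%:R *: s ->
  (forall s, s \in S -> c s != 0%N -> - s \in Phip) -> a \notin Phip.
Proof.
move=> -> hc; apply/negP => /(pos_gt0 rootPhi) /(_ x0_pos); apply/negP.
rewrite -leNgt -oppr_ge0 dot_suml -sumrN big_seq sumr_ge0 // => s sS.
have [->|cs] := eqVneq (c s) 0%N; first by rewrite scale0r dot0l oppr0.
rewrite dotZl -mulrN -dotNl mulr_ge0 ?ler0n //.
by apply: ltW; apply: (pos_gt0 rootPhi) (hc s sS cs) x0_pos.
Qed.

(* At a point of the upper closure an integral positive root is, up to sign, a
   natural combination of the ceilings through that point. *)
Lemma upper_expand a x (n : int) : a \in Phip -> upper_closure Phi A x ->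
  dot a x = n%:~R -> lev (- a) = - n /\ exists c : V -> nat,
    [/\ - a = \sum_(s <- S) (c s)%:R *: s,
        (lev (- a))%:~R = \sum_(s <- S) (c s)%:R * (lev s)%:~R :> R &
        forall s, s \in S -> c s != 0%N ->
          [/\ aff s x = 0, lev s < 0 & - s \in Phip]].
Proof.
move=> ap /upper_closureP[cx hx] e; have aP := pos_root ap.
have aN := root_opp rootPhi aP.
(* All terms of the expansion are nonnegative at [x], so only walls through [x] occur, and in the
   upper closure these are ceilings. *)
have zero b : b \in Phi -> aff b x = 0 -> exists c : V -> nat,
    [/\ b = \sum_(s <- S) (c s)%:R *: s,
        (lev b)%:~R = \sum_(s <- S) (c s)%:R * (lev s)%:~R :> R &
        forall s, s \in S -> c s != 0%N ->
          [/\ aff s x = 0, lev s < 0 & - s \in Phip]].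
  move=> bP b0; have [c [eb el]] := base_expand x0_regular bP.
  exists c; split=> // s sS cs.
  have [_ gex] := (closure_baseP rootPhi simD x0U x0_regular x).1 cx.
  have s0 : aff s x = 0.
    have /eqP := b0; rewrite (aff_comb x eb el) big_seq psumr_eq0; last first.
      by move=> t tS; rewrite mulr_ge0 ?ler0n ?gex.
    move=> /allP /(_ s sS); rewrite sS mulf_eq0 pnatr_eq0 (negPf cs) /=.
    by move/eqP.
  by have sn := hx s sS s0; split=> //; apply: neg_lev => //; exact: base_root sS.
have [_ ge] := (closure_alcoveP rootPhi simD x0U x0_regular x).1 cx.
have a0 := ge a aP; have a1 := ge _ aN; rewrite (affN x0_regular) // in a1.
(* In the first case [a] itself would be a combination of ceilings, which are negative roots. This
   leaves [- a], which vanishes at [x] as an affine function. *)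
have [j0|j1] : n = lev a \/ n = lev a + 1.
  have h1 : lev a <= n by rewrite -(ler_int R) -e; move: a0; rewrite /affval; lra.
  have h2 : n <= lev a + 1.
    by rewrite -(ler_int R) intrD -e; move: a1; rewrite /affval; lra.
  by move: h1 h2; lia.
- have [|c [ea el hc]] := zero a aP; first by rewrite /affval e j0 subrr.
  by have := nonpos_comb ea (fun s sS cs => let: And3 _ _ h := hc s sS cs in h);
    rewrite ap.
split; first by rewrite (levN x0_regular) // j1; lia.
by apply: zero => //; rewrite (affN x0_regular) // /affval e j1 intrD; lra.
Qed.

(** Induction on the sum of the coefficients. The point is that after the reflection [- a'] is again
    a combination of the same walls, with the coefficient of [s] lowered by the Cartan integer. *)
Lemma coclosed_descent (Sigma : {fset V}) x :
  Sigma `<=` Phip -> negatively_coclosed Phi D Sigma -> closure A x ->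
  forall a (c : V -> nat), a \in Sigma ->
    - a = \sum_(s <- S) (c s)%:R *: s ->
    (lev (- a))%:~R = \sum_(s <- S) (c s)%:R * (lev s)%:~R :> R ->
    (forall s, s \in S -> c s != 0%N -> aff s x = 0 /\ - s \in Phip) ->
  exists s, [/\ s \in S, c s != 0%N & - s \in Sigma].
Proof.
move=> subS cocl cx a c; have [n] := ubnP (\sum_(s <- S) c s)%N.
elim: n a c => // n IH a c len aS ea el hc.
have ap := fsubsetP subS a aS; have aP := pos_root ap; have aN := root_opp rootPhi aP.
have a0 : aff (- a) x = 0.
  rewrite (aff_comb x ea el) big_seq big1 // => s sS.
  have [->|cs] := eqVneq (c s) 0%N; first by rewrite mul0r.
  by have [-> _] := hc s sS cs; rewrite mulr0.
have [s [sS cs sa]] : exists s, [/\ s \in S, c s != 0%N & 0 < dot a (- s)].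
  apply: contrapT => h; have := root_gt0 rootPhi aN.
  rewrite {1}ea dot_suml big_seq; apply/negP; rewrite -leNgt.
  rewrite -oppr_ge0 -sumrN sumr_ge0 // => s sS; rewrite dotZl.
  have [->|cs] := eqVneq (c s) 0%N; first by rewrite mul0r oppr0.
  rewrite -mulrN mulr_ge0 ?ler0n // dotNr opprK leNgt; apply/negP => lt0.
  by apply: h; exists s; split=> //; rewrite dotNr dotC; lra.
have [s0 bp] := hc s sS cs; have bP := pos_root bp; have sP := base_root sS.
have [e|ab] := eqVneq a (- s); first by exists s; rewrite -e.
have [k ck ek] := cartan_intP rootPhi aP bP.
have k0 : 0 < k.
  by rewrite -(ltr_int R) -(pmulr_lgt0 _ (root_gt0 rootPhi bP)) ek mulr_gt0.
case: k k0 ck ek => // k k0 ck ek.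
have a'P := root_reflection rootPhi bP aP.
rewrite /reflection ck in a'P; set a' := a - _ in a'P.
have a'N := root_opp rootPhi a'P.
have ea' : a = a' + k%:R *: - s by rewrite /a' subrK.
have a'b : dot a' (- s) < 0.
  rewrite /a' dotBl dotZl ek; lra.
have lx b : b \in Phi -> 0 <= aff b x <= 1.
  move=> bP'; have [_ ge] := (closure_alcoveP rootPhi simD x0U x0_regular x).1 cx.
  rewrite ge //= -subr_ge0 -(affN x0_regular) // ge //; exact: root_opp.
(* The constant for which [- a' = - a - k s] becomes an identity of affine functions. It is the
   value of [- a'] at [x], so the level of [- a'] is [e] or [e - 1]. *)
pose e : int := lev (- a) - k%:Z * lev s.
have feq y : dot (- a') y - e%:~R = aff (- a) y - k%:R * aff s y.
  rewrite /e /a' /affval !(dotL, dotR) intrB intrM; ring.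
have fx : dot (- a') x = e%:~R.
  by apply/eqP; rewrite -subr_eq0 feq a0 s0 mulr0 subrr.
have [j0|j1] : lev (- a') = e \/ lev (- a') = e - 1.
  have /andP := lx _ a'N; rewrite /affval fx => -[h1 h2].
  have h3 : lev (- a') <= e by rewrite -(ler_int R); lra.
  have h4 : e <= lev (- a') + 1 by rewrite -(ler_int R) intrD; lra.
  exact: int_between.
(* With level [e], [aff_free] compares the expansions of [- a] and [- a'], and the induction
   hypothesis applies to [a']. *)
- have [c' [ec' el']] := base_expand x0_regular a'N.
  have cc t : t \in S -> (c t = c' t + k * (t == s))%N.
    move=> tS; apply/eqP; rewrite -(eqr_nat R) natrD natrM -subr_eq0.
    have z1 : \sum_(t <- S) ((c t)%:R - ((c' t)%:R + k%:R * (t == s)%:R)) *: t = 0 :> V.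
      under eq_bigr do rewrite scalerBl scalerDl -scalerA.
      rewrite sumrB big_split /= -ea -ec' -scaler_sumr big_delta_scale //.
      by rewrite /a' scalerN; apply/eqP; rewrite subr_eq0; apply/eqP; rewrite opprD opprK addrNK.
    have z2 : \sum_(t <- S) ((c t)%:R - ((c' t)%:R + k%:R * (t == s)%:R)) * (lev t)%:~R = 0 :> R.
      under eq_bigr do rewrite mulrBl mulrDl mulrAC.
      rewrite sumrB big_split /= -el -el' (big_delta (fun t => k%:R * (lev t)%:~R)) //.
      by rewrite j0 /e intrB intrM; lra.
    by apply/eqP; apply: (aff_free rootPhi irrPhi x0_regular z1 z2).
  have supp t : t \in S -> c' t != 0%N -> c t != 0%N.
    by move=> tS; rewrite cc // addn_eq0 negb_and => ->.
  have a'p : a' \in Phip.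
    case: (pos_or_neg rootPhi simD a'P) => // a'n.
    have := nonpos_comb ec' (fun t tS ct => (hc t tS (supp t tS ct)).2).
    by rewrite a'n.
  have := cocl a a' (- s) 1%N k aS a'p bp isT k0.
  rewrite scale1r -ea' => /(_ erefl a'b) [a'S|]; last by exists s.
  have [|t tS ct|t [tS ct tSig]] := IH a' c' _ a'S ec' el'.
  - apply: leq_trans (_ : (\sum_(t <- S) c t <= n)%N) => //.
    rewrite !(big_fsetD1 s sS) /= cc // eqxx muln1.
    have -> : (\sum_(t <- S `\ s) c t = \sum_(t <- S `\ s) c' t)%N.
      rewrite big_seq [RHS]big_seq; apply: eq_bigr => t; rewrite in_fsetD1.
      by move=> /andP[/negPf ts tS]; rewrite cc // ts muln0 addn0.
    by rewrite ltn_add2r -[X in (X < _)%N]addn0 ltn_add2l.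
  - by apply: hc => //; apply: supp.
  - by exists t; split=> //; apply: supp.
(* With level [e - 1] it is [a'] whose affine function vanishes at [x]. The expansions of [- a] and
   [a'] add up to [k s], so [a] is proportional to [- s], which was excluded. *)
have [c' [ec' el']] := base_expand x0_regular a'P.
have z t : t \in S -> t != s -> c t = 0%N.
  move=> tS ts.
  have z1 : \sum_(t <- S) ((c t)%:R + (c' t)%:R - k%:R * (t == s)%:R) *: t = 0 :> V.
    under eq_bigr do rewrite scalerBl scalerDl -scalerA.
    rewrite sumrB big_split /= -ea -ec' -scaler_sumr big_delta_scale //.
    by rewrite /a' scalerN opprK addrA addNr add0r subrr.
  have z2 : \sum_(t <- S) ((c t)%:R + (c' t)%:R - k%:R * (t == s)%:R) * (lev t)%:~R = 0 :> R.
    under eq_bigr do rewrite mulrBl mulrDl mulrAC.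
    rewrite sumrB big_split /= -el -el' (big_delta (fun t => k%:R * (lev t)%:~R)) //.
    have := levN x0_regular a'N; rewrite opprK j1 => ->.
    by rewrite /e !(intrB, intrM, intrN); lra.
  have /eqP := aff_free rootPhi irrPhi x0_regular z1 z2 tS.
  by rewrite (negPf ts) mulr0 subr0 -natrD pnatr_eq0 addn_eq0 => /andP[/eqP].
exfalso; have ec : - a = (c s)%:R *: s.
  rewrite ea (big_fsetD1 s sS) /= big_seq big1 ?addr0 // => t.
  by rewrite in_fsetD1 => /andP[ts tS]; rewrite z // scale0r.
have : a = (c s)%:R *: - s by rewrite scalerN -ec opprK.
by move=> /(pos_prop rootPhi simD ap bp) /eqP; rewrite (negPf ab).
Qed.

End Positive.
End Ceilings.

(** * Compatible sets *)

Section Compatible.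
Variables (R : realType) (l : nat) (Phi D Sigma : {fset 'rV[R]_l}).
Local Notation V := 'rV[R]_l.
Hypotheses (rootPhi : root_system Phi) (irrPhi : irreducible_roots Phi).
Hypothesis simD : simple_roots Phi D.
Hypothesis subS : Sigma `<=` positive_roots Phi D.
Implicit Types (a b s t x y : V).
Local Notation Phip := (positive_roots Phi D).

(** Common to the coclosed case and to [G2_long_compatible]. One point of the intersection is
    enough: the expansion of [- a] does not depend on the point, and its terms are nonnegative on
    the closure, so every other point lies on the same ceilings. *)
Lemma compat_criterion :
  (forall x0 x a (c : V -> nat), x0 \in rspan Phi ->
     (forall a, a \in Phi -> dot a x0 \isn't a Num.int) ->
     (forall d, d \in D -> 0 < dot d x0) ->
     closure (connected_component (alcove_complement Phi D) x0) x -> a \in Sigma ->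
     - a = \sum_(s <- alcove_base Phi x0) (c s)%:R *: s ->
     (level x0 (- a))%:~R =
       \sum_(s <- alcove_base Phi x0) (c s)%:R * (level x0 s)%:~R :> R ->
     (forall s, s \in alcove_base Phi x0 -> c s != 0%N ->
        affval x0 s x = 0 /\ - s \in Phip) ->
     exists s, [/\ s \in alcove_base Phi x0, c s != 0%N & - s \in Sigma]) ->
  worpitzky_compatible Phi D Sigma.
Proof.
move=> crit A /(alcove_regular rootPhi simD)[x0 [x0U reg ->]] AP a n aS.
have x0_pos d : d \in D -> 0 < dot d x0.
  by move=> dD; have [_ /(_ d dD) /andP[]] := AP x0 (alcove_x0 rootPhi simD x0U reg).
set A0 := connected_component _ _; set X := (_ `&` _)%classic.
have [->|/set0P[x [ux [_ ex]]]] := eqVneq X set0; [by left|right].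
have ap := fsubsetP subS a aS.
have [el [c [ea ec hc]]] := upper_expand rootPhi irrPhi simD x0U reg x0_pos ap ux ex.
have [cx _] := (upper_closureP rootPhi irrPhi simD x0U reg x).1 ux.
have [|s [sB cs sS]] := crit x0 x a c x0U reg x0_pos cx aS ea ec.
  by move=> s sB /(hc s sB)[].
have [sx sn sp] := hc s sB cs.
exists (- s), (- level x0 s); rewrite intrN hypN; split=> //.
  exact: base_ceiling.
move=> y [uy [yU ey]]; have [cy _] := (upper_closureP rootPhi irrPhi simD x0U reg y).1 uy.
have [_ ge] := (closure_baseP rootPhi simD x0U reg y).1 cy.
have /eqP : affval x0 (- a) y = 0 by rewrite /affval el dotNl ey intrN subrr.
rewrite (aff_comb y ea ec) big_seq psumr_eq0 => [/allP /(_ s sB)|t tB]; last first.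
  by rewrite mulr_ge0 ?ler0n ?ge.
rewrite sB mulf_eq0 pnatr_eq0 (negPf cs) /= => /eqP e.
exact/aff_hyp.
Qed.

Lemma coclosed_compatible :
  negatively_coclosed Phi D Sigma -> worpitzky_compatible Phi D Sigma.
Proof.
move=> cocl; apply: compat_criterion => x0 x a c x0U reg x0_pos cx aS ea ec hc.
by apply: (coclosed_descent rootPhi irrPhi simD x0U reg x0_pos subS cocl cx aS ea ec).
Qed.

Lemma hyp_eq_prop a b (c c' : R) x : a \in Phi -> b \in Phi -> hyp Phi a c x ->
  hyp Phi a c = hyp Phi b c' -> exists k, b = k *: a.
Proof.
move=> aP bP [xU ax] e; exists (dot a b / dot a a); apply/eqP; rewrite -subr_eq0.
set w := b - _; have aw : dot a w = 0.
  by rewrite /w dotBr dotZr divfK ?subrr // gt_eqF ?(root_gt0 rootPhi).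
have wU : w \in rspan Phi by rewrite rpredB ?rpredZ // mem_rspan.
have [_ b1] : hyp Phi b c' x by rewrite -e.
have [_] : hyp Phi b c' (x + w).
  by rewrite -e; split; [exact: rpredD|rewrite dotDr aw addr0].
rewrite dotDr b1 => /eqP; rewrite -subr_eq0 addrAC subrr add0r => /eqP bw.
by apply/eqP; apply: dot_eq0; rewrite {1}/w dotBl dotZl bw aw mulr0 subrr.
Qed.

End Compatible.

Lemma seq_eps (R : realType) (T : eqType) (r : seq T) (f : T -> R) :
  (forall b, b \in r -> 0 < f b) -> exists2 e : R, 0 < e & forall b, b \in r -> e < f b.
Proof.
elim: r => [|b r IH] h; first by exists 1.
have [c cr|e e0 he] := IH; first by apply: h; rewrite inE cr orbT.
have fb : 0 < f b by apply: h; rewrite mem_head.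
exists (Num.min e (f b / 2)); first by rewrite lt_min e0; lra.
move=> c; rewrite inE => /orP[/eqP ->|cr]; rewrite gt_min; apply/orP; last first.
  by left; exact: he.
by right; lra.
Qed.

(** * Perturbations that cross no integer *)

Section Perturbation.
Variable R : realType.
Implicit Types v e : R.

(** A shift of absolute value below [gap v] reaches no integer other than [v] itself. *)
Definition gap v : R :=
  if v \is a Num.int then 1
  else Num.min (v - (Num.floor v)%:~R) ((Num.floor v)%:~R + 1 - v).

Lemma gap_gt0 v : 0 < gap v.
Proof.
rewrite /gap; case: ifPn => // vn; rewrite lt_min !subr_gt0.
rewrite -[1]/(1%:~R) -intrD floorD1_gt andbT lt_def floor_le andbT.
by apply: contra vn => /eqP ->; exact: intr_int.
Qed.

Lemma gap_int (n : int) e : `|e| < gap n%:~R -> e != 0 -> n%:~R + e \isn't a Num.int.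
Proof.
rewrite /gap intr_int => e1 e0; apply/negP => /intrP[k ek].
have e' : e = (k - n)%:~R by rewrite intrB -ek addrAC subrr add0r.
move: e1 e0; rewrite e' -intr_norm -[1]/(1%:~R) ltr_int intr_eq0; lia.
Qed.

Lemma gap_nonint v e : v \isn't a Num.int -> `|e| < gap v ->
  (Num.floor v)%:~R < v + e < (Num.floor v)%:~R + 1.
Proof.
rewrite /gap => /negPf ->; rewrite lt_min !ltr_norml.
by move=> /andP[/andP[h1 h2] /andP[h3 h4]]; apply/andP; split; lra.
Qed.

End Perturbation.

Section Local.
Variables (R : realType) (l : nat) (Phi D Sigma : {fset 'rV[R]_l}).
Local Notation V := 'rV[R]_l.
Hypotheses (rootPhi : root_system Phi) (irrPhi : irreducible_roots Phi).
Hypothesis simD : simple_roots Phi D.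
Hypothesis subS : Sigma `<=` positive_roots Phi D.
Implicit Types (a b s t x y : V).
Local Notation Phip := (positive_roots Phi D).

(* The alcove just below [x], reached by moving from [x] in the direction
   opposite to the sum of the fundamental coweights, has exactly the
   hyperplanes of [b1] and [b2] as ceilings through [x]. *)
Lemma compatible_local x b1 b2 a : worpitzky_compatible Phi D Sigma ->
  x \in rspan Phi -> (forall d, d \in D -> 0 < dot d x <= 1) ->
  b1 \in Phip -> b2 \in Phip ->
  dot b1 x \is a Num.int -> dot b2 x \is a Num.int ->
  (forall g, g \in Phi -> dot g x \is a Num.int -> exists c1 c2 : R,
     [/\ 0 <= c1, 0 <= c2 & g = c1 *: b1 + c2 *: b2 \/ - g = c1 *: b1 + c2 *: b2]) ->
  a \in Sigma -> dot a x \is a Num.int -> b1 \in Sigma \/ b2 \in Sigma.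
Proof.
move=> compat xU xP b1p b2p b1x b2x cone aS ax.
have [b1P b2P] := (pos_root b1p, pos_root b2p).
have [rho rhoU hrho] := simple_point simD (fun=> 1).
have rho_pos b : b \in Phip -> 0 < dot b rho.
  by move=> bp; apply: (pos_gt0 rootPhi bp) => d /hrho ->.
(* Moving by [- e *: rho] shifts every root value by less than its gap; the summand 1 keeps the
   denominator positive. *)
have [e e0 he] : exists2 e : R, 0 < e &
    forall g, g \in Phi -> e < gap (dot g x) / (1 + `|dot g rho|).
  by apply: seq_eps => g _; rewrite divr_gt0 ?gap_gt0 // ltr_pwDl.
have eb g : g \in Phi -> `|- (e * dot g rho)| < gap (dot g x).
  move=> /he; rewrite ltr_pdivlMr ?ltr_pwDl // normrN normrM (gtr0_norm e0) => h.
  by apply: le_lt_trans h; rewrite mulrDr mulr1 lerDr ltW.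
have rho_nz g : g \in Phi -> dot g rho != 0.
  move=> gP; case: (pos_or_neg rootPhi simD gP) => /rho_pos; first by move/gt_eqF ->.
  by rewrite dotNl oppr_gt0 => /lt_eqF ->.
pose x0 := x - e *: rho.
have dx0 g : dot g x0 = dot g x + - (e * dot g rho) by rewrite dotBr dotZr.
have x0U : x0 \in rspan Phi by rewrite rpredB ?rpredZ.
have reg g : g \in Phi -> dot g x0 \isn't a Num.int.
  move=> gP; rewrite dx0; have eg := eb g gP.
  have [/intrP[n en]|ni] := boolP (dot g x \is a Num.int).
    rewrite en in eg *; apply: gap_int eg _.
    by rewrite oppr_eq0 mulf_neq0 ?rho_nz ?gt_eqF.
  have /andP[h1 h2] := gap_nonint ni eg; apply/negP => /intrP[k ek].
  by move: h1 h2; rewrite ek -[1]/(1%:~R) -intrD !ltr_int; clear; lia.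
(* For a root integral at [x], the sign on [rho] decides whether the level is the value at [x] or
   one less. *)
have lev_neg g (n : int) : g \in Phi -> dot g x = n%:~R -> dot g rho < 0 -> level x0 g = n.
  move=> gP en gn; apply: lev_uniq; rewrite dx0 en.
  have := eb g gP; rewrite en /gap intr_int ltr_norml => /andP[_ h].
  by have := nmulr_rlt0 e gn; rewrite e0 => h'; apply/andP; split; lra.
have lev_pos g (n : int) : g \in Phi -> dot g x = n%:~R -> 0 < dot g rho ->
    level x0 g = n - 1.
  move=> gP en gp; apply: lev_uniq; rewrite dx0 en intrB.
  have := eb g gP; rewrite en /gap intr_int ltr_norml => /andP[h _].
  by have := mulr_gt0 e0 gp => h'; apply/andP; split; lra.
have cx : closure (connected_component (alcove_complement Phi D) x0) x.
  apply/(closure_alcoveP rootPhi simD x0U reg); split=> // g gP; rewrite /affval subr_ge0.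
  have [/intrP[n en]|ni] := boolP (dot g x \is a Num.int).
    have [gn|gp] := ltP (dot g rho) 0; first by rewrite (lev_neg g n) // en.
    rewrite (lev_pos g n) //; last by rewrite lt_def rho_nz.
    by rewrite en ler_int; clear; lia.
  have h := gap_nonint ni (eb g gP); rewrite (@lev_uniq _ _ x0 g (Num.floor (dot g x))).
    exact: floor_le.
  by move: h; rewrite dx0 => /andP[h1 h2]; apply/andP; split; lra.
have x0D d : d \in D -> 0 < dot d x0 < 1.
  move=> dD; have dP := simple_root simD dD; have := eb d dP; have := xP d dD.
  rewrite dx0 hrho // mulr1 => /andP[d0 d1] ed.
  have [/intrP[n en]|ni] := boolP (dot d x \is a Num.int).
    move: d0 d1 ed; rewrite en /gap intr_int ltr0z -[1]/(1%:~R) ler_int => n0 n1.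
    have -> : n = 1 by clear -n0 n1; lia.
    rewrite ltr_norml => /andP[h1 h2]; have -> : 1%:~R = 1 :> R by [].
    by apply/andP; split; lra.
  have f0 : Num.floor (dot d x) = 0.
    apply: floor_def; rewrite add0r ltW //= lt_def d1 andbT.
    by apply: contra ni => /eqP <-.
  by have := gap_nonint ni ed; rewrite f0 add0r.
have AP : (connected_component (alcove_complement Phi D) x0 `<=`
    parallelepiped Phi D)%classic.
  move=> y /(alcoveP rootPhi simD x0U reg)[yU hy]; split=> // d dD.
  have dP := simple_root simD dD; have dN := root_opp rootPhi dP.
  have l0 : level x0 d = 0 by apply: lev_uniq; rewrite subr0 x0D.
  have := hy d dP; have := hy _ dN; rewrite (affN reg) // /affval l0 subr0 => h1 h2.
  by rewrite h2; lra.
have [m1 em1] := intrP b1x; have [m2 em2] := intrP b2x.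
have levN b (m : int) : b \in Phip -> dot b x = m%:~R -> level x0 (- b) = - m.
  move=> bp em; apply: lev_neg; rewrite ?dotNl ?em ?intrN //.
    exact: root_opp (pos_root bp).
  by rewrite oppr_lt0 rho_pos.
(* A wall through [x] is negative on [rho], so the cone hypothesis writes it as
   [- (c1 *: b1 + c2 *: b2)]. Expanding [- b1] and [- b2] in the base, [aff_free] shows that one of
   them has [s] as its only term. *)
have wall_cases s : s \in alcove_base Phi x0 -> affval x0 s x = 0 -> s = - b1 \/ s = - b2.
  move=> sB /eqP; rewrite /affval subr_eq0 => /eqP sx; have sP := base_root sB.
  have := cone s sP; rewrite sx intr_int => /(_ isT) [c1 [c2 [c10 c20 es]]].
  have sn : dot s rho < 0.
    rewrite ltNge; apply/negP => sp; have sp' : 0 < dot s rho by rewrite lt_def rho_nz.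
    have h := lev_pos s _ sP sx sp'; by move: h; clear; lia.
  have {es} : - s = c1 *: b1 + c2 *: b2.
    case: es => // es; have : 0 <= dot s rho; last by rewrite leNgt sn.
    by rewrite es dotDl !dotZl addr_ge0 // mulr_ge0 // ltW // rho_pos.
  move/(congr1 -%R); rewrite opprK opprD => es.
  have [k1 [ek1 el1]] := base_expand reg (root_opp rootPhi b1P).
  have [k2 [ek2 el2]] := base_expand reg (root_opp rootPhi b2P).
  have z1 : \sum_(t <- alcove_base Phi x0)
      (c1 * (k1 t)%:R + c2 * (k2 t)%:R - (t == s)%:R) *: t = 0.
    under eq_bigr do rewrite scalerBl scalerDl -!scalerA.
    rewrite sumrB big_split /= -!scaler_sumr -ek1 -ek2 big_delta_scale //.
    by rewrite !scalerN -es subrr.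
  have z2 : \sum_(t <- alcove_base Phi x0)
      (c1 * (k1 t)%:R + c2 * (k2 t)%:R - (t == s)%:R) * (level x0 t)%:~R = 0.
    under eq_bigr do
      rewrite mulrBl mulrDl -!mulrA [(_ == s)%:R * _]mulrC.
    rewrite sumrB big_split /= -!mulr_sumr -el1 -el2 (big_delta (fun t => (level x0 t)%:~R)) //.
    rewrite (levN b1 m1) // (levN b2 m2) // -sx es dotDl !dotNl !dotZl em1 em2 !intrN.
    by ring.
  have coef t : t \in alcove_base Phi x0 -> t != s ->
      c1 * (k1 t)%:R + c2 * (k2 t)%:R = 0.
    move=> tB /negPf ts; have := aff_free rootPhi irrPhi reg z1 z2 tB.
    by rewrite ts subr0.
  have single b (k : V -> nat) : b \in Phip ->
      - b = \sum_(s <- alcove_base Phi x0) (k s)%:R *: s ->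
      (forall t, t \in alcove_base Phi x0 -> t != s -> (k t)%:R = 0 :> R) -> s = - b.
    move=> bp eb' kt; have e' : - b = (k s)%:R *: s.
      rewrite eb' (big_fsetD1 s sB) /= big_seq big1 ?addr0 // => t.
      by rewrite in_fsetD1 => /andP[ts tB]; rewrite kt // scale0r.
    case: (root_prop rootPhi (root_opp rootPhi (pos_root bp)) sP e') => // /oppr_inj es'.
    by have := rho_pos b bp; rewrite es' ltNge ltW.
  have [c1z|c1z] := eqVneq c1 0.
    right; apply: single ek2 _ => // t tB ts; have := coef t tB ts.
    rewrite c1z mul0r add0r => /eqP; rewrite mulf_eq0 => /orP[/eqP c2z|/eqP //].
    by have := root_nz rootPhi sP; rewrite es c1z c2z !scale0r oppr0 addr0 eqxx.
  left; apply: single ek1 _ => // t tB ts; have := coef t tB ts.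
  have := mulr_ge0 c10 (ler0n R (k1 t)); have := mulr_ge0 c20 (ler0n R (k2 t)).
  move=> h1 h2 h3; have /eqP : c1 * (k1 t)%:R = 0 by lra.
  by rewrite mulf_eq0 (negPf c1z) => /eqP.
have ux : upper_closure Phi (connected_component (alcove_complement Phi D) x0) x.
  apply/(upper_closureP rootPhi irrPhi simD x0U reg); split=> // s sB sx.
  have xpos b : b \in Phip -> 0 < dot b x.
    by move=> bp; apply: (pos_gt0 rootPhi bp) => d /xP/andP[].
  case: (wall_cases s sB sx) => ->; [rewrite (levN b1 m1)|rewrite (levN b2 m2)] => //.
    by rewrite oppr_lt0 -(ltr0z R) -em1 xpos.
  by rewrite oppr_lt0 -(ltr0z R) -em2 xpos.
have [n en] := intrP ax.
have Aal := regular_alcove rootPhi simD x0U reg.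
have ux' : (upper_closure Phi (connected_component (alcove_complement Phi D) x0)
   `&` hyp Phi a n%:~R)%classic x by [].
(* The ceiling given by compatibility passes through [x], so [wall_cases] identifies it. *)
have [z|[b [m [bS [wb _ _] sub]]]] := compat _ Aal AP a n aS; first by rewrite z in ux'.
have bx := sub x ux'; have bp := fsubsetP subS b bS.
have [mm [m0 em lm [s1 s1S]]] := base_dep rootPhi irrPhi reg.
have [s sB es] := wall_base rootPhi irrPhi simD x0U reg m0 em lm s1S wb.
have sx : affval x0 s x = 0 by apply/(aff_hyp x0 s xU); rewrite -es.
have [k ek] := hyp_eq_prop rootPhi (pos_root bp) (base_root sB) bx es.
have eqb b' : b' \in Phip -> s = - b' -> b = b'.
  move=> bp' es'; apply/esym/(pos_prop rootPhi simD bp' bp (c := - k)).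
  by rewrite scaleNr -ek es' opprK.
by case: (wall_cases s sB sx) => [/eqb <-|/eqb <-] //; [left|right].
Qed.

End Local.

(** * Planes of roots without the Cartan integer -3 *)

Section NoTriple.
Variables (R : realType) (l : nat).
Local Notation V := 'rV[R]_l.
Implicit Types (a b g h w x y : V).

Definition no_triple (Phi : {fset V}) :=
  forall a b, a \in Phi -> b \in Phi -> cartan a b <> -3.

(** Cramer's rule; the hypothesis is the positivity of the Gram determinant. *)
Lemma plane_proj b1 b2 g : dot b1 b2 * dot b1 b2 < dot b1 b1 * dot b2 b2 ->
  exists c1 c2, dot b1 (g - (c1 *: b1 + c2 *: b2)) = 0 /\
                dot b2 (g - (c1 *: b1 + c2 *: b2)) = 0.
Proof.
move=> lt; set X := dot b1 b1 in lt *; set Y := dot b2 b2 in lt *.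
set Z := dot b1 b2 in lt *.
have D0 : X * Y - Z * Z != 0 by rewrite gt_eqF // subr_gt0.
exists ((dot b1 g * Y - dot b2 g * Z) / (X * Y - Z * Z)),
       ((dot b2 g * X - dot b1 g * Z) / (X * Y - Z * Z)).
by rewrite !(dotL, dotR) (dotC b2 b1) -/X -/Y -/Z; split; field.
Qed.

(** Vectors are handled one at a time. One outside the plane that is still orthogonal to [w] has a
    nonzero component [w'] orthogonal to the plane, and a small multiple of [w'] is added to [w]. *)
Lemma generic_perp (U : {vspace V}) b1 b2 (r : seq V) : b1 \in U -> b2 \in U ->
  dot b1 b2 * dot b1 b2 < dot b1 b1 * dot b2 b2 ->
  (forall g, g \in r -> g \in U) ->
  exists w, [/\ w \in U, dot b1 w = 0, dot b2 w = 0 &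
    forall g, g \in r -> dot g w = 0 -> exists c1 c2, g = c1 *: b1 + c2 *: b2].
Proof.
move=> b1U b2U lt; elim: r => [|g r IH] rU.
  by exists 0; rewrite mem0v !dot0r.
have [h hr|w [wU w1 w2 hw]] := IH; first by apply: rU; rewrite inE hr orbT.
have gU : g \in U by apply: rU; rewrite mem_head.
have [gw|gw] := eqVneq (dot g w) 0; last first.
  exists w; split=> // h; rewrite inE => /orP[/eqP ->|/hw //].
  by move/eqP; rewrite (negPf gw).
have [gp|gp] := pselect (exists c1 c2, g = c1 *: b1 + c2 *: b2).
  by exists w; split=> // h; rewrite inE => /orP[/eqP ->|/hw].
have [c1 [c2 [p1 p2]]] := plane_proj g lt; set w' := g - _ in p1 p2.
have w'U : w' \in U by rewrite rpredB // rpredD // rpredZ.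
have gw' : dot g w' != 0.
  have -> : dot g w' = dot w' w'.
    by rewrite {2}/w' dotBl dotDl !dotZl p1 p2 !mulr0 addr0 subr0.
  apply/eqP => /dot_eq0 /eqP; rewrite subr_eq0 => /eqP e.
  by apply: gp; exists c1, c2.
(* Nonzero products with [w] must survive the correction; where the product is zero there is nothing
   to preserve, and 1 is a dummy bound. *)
have [s s0 hs] : exists2 s : R, 0 < s & forall h, h \in r ->
    s < if dot h w == 0 then 1 else `|dot h w| / (1 + `|dot h w'|).
  apply: seq_eps => h _; case: ifPn => // hn.
  by rewrite divr_gt0 ?normr_gt0 // ltr_pwDl.
exists (w + s *: w'); split.
- by rewrite rpredD // rpredZ.
- by rewrite dotDr dotZr w1 p1 mulr0 addr0.
- by rewrite dotDr dotZr w2 p2 mulr0 addr0.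
move=> h; rewrite inE dotDr dotZr => /orP[/eqP ->|hr].
  by rewrite gw add0r => /eqP; rewrite mulf_eq0 (negPf gw') gt_eqF.
have := hs h hr; case: ifPn => [/eqP hz _ _|hn]; first exact: hw.
rewrite ltr_pdivlMr ?ltr_pwDl // => lts /eqP; rewrite addr_eq0 => /eqP e.
move: lts; rewrite e normrN normrM (gtr0_norm s0) => lts.
by exfalso; move: lts; rewrite mulrDr mulr1 gtrDr ltNge ltW.
Qed.

Section Cone.
Variable Phi : {fset V}.
Hypotheses (rootPhi : root_system Phi) (no3 : no_triple Phi).

Lemma no_triple_bound a b (m n : int) : a \in Phi -> b \in Phi -> cartan a b = m%:~R ->
  cartan b a = n%:~R -> m * n < 4 -> 0 < m -> 0 < n ->
  [\/ m = 1 /\ n = 1, m = 1 /\ n = 2 | m = 2 /\ n = 1].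
Proof.
move=> aP bP em en mn m0 n0.
have m3 : m <> 3.
  move=> m3; apply: (no3 (root_opp rootPhi aP) bP).
  by move: em; rewrite m3 /cartan dotNl mulrN mulNr => ->.
have n3 : n <> 3.
  move=> n3; apply: (no3 (root_opp rootPhi bP) aP).
  by move: en; rewrite n3 /cartan dotNl mulrN mulNr => ->.
have mc : [\/ m = 1, m = 2 | 4 <= m].
  have [h|[h|h]] : m = 1 \/ m = 2 \/ 4 <= m by clear -m0 m3; lia.
  - by constructor 1.
  - by constructor 2.
  - by constructor 3.
have nc : [\/ n = 1, n = 2 | 4 <= n].
  have [h|[h|h]] : n = 1 \/ n = 2 \/ 4 <= n by clear -n0 n3; lia.
  - by constructor 1.
  - by constructor 2.
  - by constructor 3.
case: mc mn => [->|->|m4]; case: nc => [->|->|n4] // mn.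
- by constructor 1.
- by constructor 2.
- by move: mn; clear -n4; lia.
- by constructor 3.
- by move: mn; clear -n4; lia.
all: by exfalso; move: mn; clear -m4 n0; nia.
Qed.

Let ratio (m n : int) := [\/ m = 1 /\ n = 1, m = 1 /\ n = 2 | m = 2 /\ n = 1].

(** The setting of [cone_mixed] with [b = - b2]: [X], [Y], [G] are squared lengths of [b1], [b],
    [g], and [p], [q], [P], [Q] stand for [c1], [c2] times scalar products. Naming these products
    makes each of the 27 cases linear. *)
Lemma cone_arith (m n M M' N N' : int) (X Y Z G u v p q P Q : R) :
  0 < p -> 0 < q -> 0 < Z -> m%:~R * Y = 2 * Z -> n%:~R * X = 2 * Z ->
  M%:~R * X = 2 * u -> N%:~R * Y = 2 * v -> M'%:~R * G = 2 * u ->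
  N'%:~R * G = 2 * v -> n%:~R * P = 2 * p -> m%:~R * Q = 2 * q ->
  u = P + q -> v = p + Q -> 2 * G = M%:~R * P + N%:~R * Q ->
  ratio m n -> ratio M M' -> ratio N N' -> False.
Proof.
move=> p0 q0 Z0 e1 e2 e3 e4 e5 e6 e7 e8 e9 e10 e11 [] [? ?] [] [? ?] [] [? ?];
  subst; lra.
Qed.

(** Otherwise [g] would lie strictly between [b1] and [- b2], which form an acute angle. Without the
    integer -3 distinct roots at an acute angle are 45 or 60 degrees apart, and two such angles
    already make a right angle. *)
Lemma cone_mixed b1 b2 g (c1 c2 : R) : b1 \in Phi -> b2 \in Phi -> g \in Phi ->
  dot b1 b2 < 0 -> b1 != - b2 -> 0 < c1 -> 0 < c2 -> g <> c1 *: b1 - c2 *: b2.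
Proof.
move=> b1P b2P gP Z0 b12N c10 c20 eg.
have b2N := root_opp rootPhi b2P.
have Zp : 0 < dot b1 (- b2) by rewrite dotNr oppr_gt0.
have X0 := root_gt0 rootPhi b1P; have Y0 := root_gt0 rootPhi b2N.
have G0 := root_gt0 rootPhi gP.
have {}eg : g = c1 *: b1 + c2 *: - b2 by rewrite scalerN.
move: (- b2) b2N Zp Y0 eg b12N => b {b2P Z0 b2} bP Z0 Y0 eg b1b.
have b1bN : b1 != - b by apply: contraTneq Z0 => ->; rewrite dotNl oppr_gt0 -leNgt ltW.
have [m [n [cm cn em en]]] := cartanP rootPhi b1P bP.
move=> /(_ b1b b1bN) mn.
have g1 : 0 < dot g b1.
  by rewrite eg dotDl !dotZl (dotC b) addr_gt0 // mulr_gt0.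
have g2 : 0 < dot g b by rewrite eg dotDl !dotZl addr_gt0 // mulr_gt0.
have indep k : k *: b1 <> b.
  move=> e; case: (root_prop rootPhi bP b1P (esym e)) => e'; first by rewrite e' eqxx in b1b.
  by rewrite e' opprK eqxx in b1bN.
have gn1 k : g = k *: b1 -> False.
  rewrite eg => e; apply: (indep ((k - c1) / c2)).
  have : c2 *: b = (k - c1) *: b1 by rewrite scalerBl -e addrAC subrr add0r.
  by move=> e'; rewrite mulrC -scalerA -e' scalerA mulVf ?scale1r // gt_eqF.
have gn2 k : g = k *: b -> False.
  rewrite eg => e; apply: (indep ((k - c2) / c1)).
  have : c1 *: b1 = (k - c2) *: b by rewrite scalerBl -e addrK.
  move=> e'; case: (eqVneq (k - c2) 0) => [z|nz].
    have := root_nz rootPhi b1P; move: e'; rewrite z scale0r => /eqP.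
    by rewrite scaler_eq0 gt_eqF //= => /eqP ->; rewrite eqxx.
  exfalso; apply: (indep (c1 / (k - c2))).
  by rewrite mulrC -scalerA e' scalerA mulVf ?scale1r.
have [M [M' [cM cM' eM eM']]] := cartanP rootPhi gP b1P.
have gb1 : g != b1 by apply/eqP => e; apply: (gn1 1); rewrite scale1r.
have gb1N : g != - b1 by apply/eqP => e; apply: (gn1 (-1)); rewrite scaleN1r.
move=> /(_ gb1 gb1N) MM'.
have [N [N' [cN cN' eN eN']]] := cartanP rootPhi gP bP.
have gb : g != b by apply/eqP => e; apply: (gn2 1); rewrite scale1r.
have gbN : g != - b by apply/eqP => e; apply: (gn2 (-1)); rewrite scaleN1r.
move=> /(_ gb gbN) NN'.
have pos (k : int) (z1 z2 : R) : 0 < z1 -> 0 < z2 -> k%:~R * z1 = 2 * z2 -> 0 < k.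
  by move=> h1 h2 e; rewrite -(ltr_int R) -(pmulr_lgt0 _ h1) e mulr_gt0.
have m0 := pos m _ _ Y0 Z0 em; have n0 := pos n _ _ X0 Z0 en.
have M0 := pos M _ _ X0 g1 eM; have M'0 := pos M' _ _ G0 g1 eM'.
have N0 := pos N _ _ Y0 g2 eN; have N'0 := pos N' _ _ G0 g2 eN'.
have Gd : dot g g = c1 * dot g b1 + c2 * dot g b by rewrite {2}eg dotDr !dotZr.
have d1 : dot g b1 = c1 * dot b1 b1 + c2 * dot b1 b.
  by rewrite {1}eg dotDl !dotZl (dotC b).
have d2 : dot g b = c1 * dot b1 b + c2 * dot b b by rewrite {1}eg dotDl !dotZl.
have mc := no_triple_bound b1P bP cm cn mn m0 n0.
have Mc := no_triple_bound gP b1P cM cM' MM' M0 M'0.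
have Nc := no_triple_bound gP bP cN cN' NN' N0 N'0.
apply: (cone_arith (p := c1 * dot b1 b) (q := c2 * dot b1 b) (P := c1 * dot b1 b1)
  (Q := c2 * dot b b) _ _ Z0 em en eM eN eM' eN' _ _ d1 d2 _ mc Mc Nc).
- exact: mulr_gt0.
- exact: mulr_gt0.
- by rewrite mulrCA en mulrCA.
- by rewrite mulrCA em mulrCA.
- by rewrite ![_ * (c1 * _)]mulrCA ![_ * (c2 * _)]mulrCA eM eN Gd; ring.
Qed.

Lemma plane_cone b1 b2 g (c1 c2 : R) : b1 \in Phi -> b2 \in Phi -> g \in Phi ->
  dot b1 b2 < 0 -> b1 != - b2 -> g = c1 *: b1 + c2 *: b2 ->
  exists c1 c2 : R, [/\ 0 <= c1, 0 <= c2 &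
    g = c1 *: b1 + c2 *: b2 \/ - g = c1 *: b1 + c2 *: b2].
Proof.
move=> b1P b2P gP Z0 b12 eg.
have b21 : b2 != - b1 by apply: contra_neq b12 => ->; rewrite opprK.
have Z0' : dot b2 b1 < 0 by rewrite dotC.
have [h1|h1] := leP 0 c1; have [h2|h2] := leP 0 c2.
- by exists c1, c2; split=> //; left.
- have [h3|h3] := eqVneq c1 0.
    exists 0, (- c2); rewrite lexx oppr_ge0 ltW //; split=> //; right.
    by rewrite eg h3 !scale0r !add0r scaleNr.
  have p1 : 0 < c1 by rewrite lt_def h3.
  have p2 : 0 < - c2 by rewrite oppr_gt0.
  by case: (cone_mixed b1P b2P gP Z0 b12 p1 p2); rewrite scaleNr opprK.
- have [h3|h3] := eqVneq c2 0.
    exists (- c1), 0; rewrite lexx oppr_ge0 ltW //; split=> //; right.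
    by rewrite eg h3 !scale0r !addr0 scaleNr.
  have p1 : 0 < c2 by rewrite lt_def h3.
  have p2 : 0 < - c1 by rewrite oppr_gt0.
  by case: (cone_mixed b2P b1P gP Z0' b21 p1 p2); rewrite scaleNr opprK addrC.
exists (- c1), (- c2); rewrite !oppr_ge0 !ltW //; split=> //; right.
by rewrite eg opprD !scaleNr.
Qed.

End Cone.

Section Coclosed.
Variables (Phi D Sigma : {fset V}).
Hypotheses (rootPhi : root_system Phi) (irrPhi : irreducible_roots Phi).
Hypotheses (simD : simple_roots Phi D) (subS : Sigma `<=` positive_roots Phi D).

Lemma pos_independent b1 b2 : b1 \in positive_roots Phi D ->
  b2 \in positive_roots Phi D -> dot b1 b2 < 0 ->
  b1 != - b2 /\ forall c, b1 != c *: b2.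
Proof.
move=> b1p b2p Z0; split.
  by apply/eqP => e; case: (pos_negF rootPhi simD b2p); rewrite -e.
move=> c; apply/eqP => /(pos_prop rootPhi simD b1p b2p) e.
by move: Z0; rewrite e ltNge dot_ge0.
Qed.

Lemma compatible_coclosed : no_triple Phi -> worpitzky_compatible Phi D Sigma ->
  negatively_coclosed Phi D Sigma.
Proof.
move=> no3 compat a b1 b2 d1 d2 aS b1p b2p _ _ ea Z0.
have [b1P b2P] := (pos_root b1p, pos_root b2p).
have [b12 nprop] := pos_independent b1p b2p Z0.
have lt := dot_cauchy_schwarz_lt (root_nz rootPhi b2P) nprop.
have [w0 [w0U w01 w02 hw0]] := generic_perp (mem_rspan b1P) (mem_rspan b2P) lt
  (fun g (gP : g \in enum_fset Phi) => mem_rspan gP).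
have [t t0 ht] : exists2 t : R, 0 < t & forall g, g \in Phi -> t < (1 + `|dot g w0|)^-1.
  by apply: seq_eps => g _; rewrite invr_gt0 ltr_pwDl.
pose w := t *: w0.
have w_small g : g \in Phi -> `|dot g w| < 1.
  move=> /ht; rewrite /w dotZr normrM (gtr0_norm t0) -[X in _ < X -> _]mul1r.
  rewrite ltr_pdivlMr ?ltr_pwDl // => h; apply: le_lt_trans h.
  by rewrite mulrDr mulr1 lerDr ltW.
have w_plane g : g \in Phi -> dot g w = 0 -> exists c1 c2, g = c1 *: b1 + c2 *: b2.
  move=> gP /eqP; rewrite dotZr mulf_eq0 (gt_eqF t0) => /eqP; exact: hw0.
(* Adding 1 or 0 brings [dot d w], of absolute value below 1, into the interval ]0, 1]. As [h] is
   integral on all roots, it does not change which roots are integral. *)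
have [h hU hh] := simple_point simD (fun d => if dot d w <= 0 then 1 else 0).
have h_int g : g \in Phi -> dot g h \is a Num.int.
  have pos_int g' : g' \in positive_roots Phi D -> dot g' h \is a Num.int.
    by move=> /posP[_ /natcomb_int]; apply=> d dD; rewrite hh //; case: ifP.
  move=> gP; case: (pos_or_neg rootPhi simD gP) => /pos_int //.
  by rewrite dotNl rpredN.
have x_int g : g \in Phi -> dot g (w + h) \is a Num.int -> dot g w = 0.
  move=> gP; rewrite dotDr rpredDr ?h_int // => /intrP[k ek].
  have := w_small g gP; rewrite ek -intr_norm -[1]/(1%:~R) ltr_int => k1.
  by have -> : k = 0 by clear -k1; lia.
have perp_int g : dot g w = 0 -> g \in Phi -> dot g (w + h) \is a Num.int.
  by move=> gw gP; rewrite dotDr gw add0r h_int.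
have b1w : dot b1 w = 0 by rewrite dotZr w01 mulr0.
have b2w : dot b2 w = 0 by rewrite dotZr w02 mulr0.
have aP := pos_root (fsubsetP subS a aS).
apply: (compatible_local rootPhi irrPhi simD subS compat (x := w + h) _ _ b1p b2p) aS _.
- by rewrite rpredD ?rpredZ.
- move=> d dD; have := w_small d (simple_root simD dD).
  rewrite dotDr hh // ltr_norml => /andP[g1 g2].
  by case: ifPn; rewrite -?ltNge => g3; apply/andP; split; lra.
- exact: perp_int.
- exact: perp_int.
- move=> g gP /(x_int g gP) /(w_plane g gP)[c1 [c2 eg]].
  exact: (plane_cone rootPhi no3 b1P b2P gP Z0 b12 eg).
- by apply: perp_int aP; rewrite ea dotDl !dotZl b1w b2w !mulr0 addr0.
Qed.

End Coclosed.
End NoTriple.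

(** * Cartan integer -3 and type G2 *)

Section Descent.
Variables (R : realType) (l : nat) (Phi D : {fset 'rV[R]_l}).
Local Notation V := 'rV[R]_l.
Hypotheses (rootPhi : root_system Phi) (simD : simple_roots Phi D).
Implicit Types (a b d g x y : V).
Local Notation Phip := (positive_roots Phi D).

Lemma reflection_dot a x : a \in Phi -> dot (reflection a x) (reflection a x) = dot x x.
Proof.
move=> /(root_gt0 rootPhi) a0; rewrite /reflection /cartan !(dotL, dotR) (dotC a x).
by field; rewrite gt_eqF.
Qed.

Lemma reflectionK a : a \in Phi -> involutive (reflection a).
Proof.
move=> /(root_gt0 rootPhi) a0 x; rewrite /reflection /cartan.
rewrite -addrA -opprD -scalerDl !(dotL, dotR).
have -> : 2 * dot x a / dot a a + 2 * (dot x a - 2 * dot x a / dot a a * dot a a) / dot a a = 0.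
  by field; rewrite gt_eqF.
by rewrite scale0r subr0.
Qed.

(** The reflection changes only the coordinate at [d]; a negative image would leave [g] no other
    coordinate. *)
Lemma reflection_pos d g : d \in D -> g \in Phip -> g != d -> reflection d g \in Phip.
Proof.
move=> dD gp gd; have [dP gP] := (simple_root simD dD, pos_root gp).
case: (pos_or_neg rootPhi simD (root_reflection rootPhi dP gP)) => // /posP[_ [c' ec']].
have /posP[_ [c ec]] := gp.
have e : \sum_(v <- D) ((c v)%:R + (c' v)%:R) *: v
       = \sum_(v <- D) (cartan g d * (v == d)%:R) *: v.
  under eq_bigr do rewrite scalerDl.
  rewrite big_split /= -ec -ec'; under [RHS]eq_bigr do rewrite -scalerA.
  by rewrite -scaler_sumr big_delta_scale // /reflection opprB addrC subrK.
have z v : v \in D -> v != d -> c v = 0%N.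
  move=> vD /negPf vd; have := simple_coord_inj simD e vD; rewrite vd mulr0 -natrD.
  by move=> /eqP; rewrite pnatr_eq0 addn_eq0 => /andP[/eqP].
have : g = (c d)%:R *: d.
  rewrite ec (big_fsetD1 d dD) /= big_seq big1 ?addr0 // => v.
  by rewrite in_fsetD1 => /andP[vd vD]; rewrite z // scale0r.
by move=> /(pos_prop rootPhi simD gp (simple_pos simD dD)) /eqP; rewrite (negPf gd).
Qed.

(** A positive root that is not simple has a positive product with some simple root, and reflecting
    in it lowers the height [dot g rho]. *)
Lemma pos_ind (P : V -> Prop) : (forall d, d \in D -> P d) ->
  (forall d g, d \in D -> g \in Phip -> reflection d g \in Phip -> P g ->
     P (reflection d g)) ->
  forall g, g \in Phip -> P g.
Proof.
move=> PD Pr; have [rho _ hrho] := simple_point simD (fun=> 1).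
suff H g : g \in Phi -> g \in Phip -> P g by move=> g gp; exact: (H g (pos_root gp) gp).
apply: (@fset_real_ind R _ Phi (fun g => dot g rho) (fun g => g \in Phip -> P g)).
move=> {}g gP IH gp.
have [/PD//|gD] := boolP (g \in D).
have [d dD gd] : exists2 d, d \in D & 0 < dot g d.
  apply: contrapT => h; have := root_gt0 rootPhi gP; have /posP[_ [c {2}->]] := gp.
  rewrite dot_sumr; apply/negP; rewrite -leNgt -oppr_ge0 -sumrN big_seq.
  apply: sumr_ge0 => d dD; rewrite dotZr -mulrN mulr_ge0 ?ler0n // oppr_ge0 leNgt.
  by apply/negP => gd; apply: h; exists d.
have dP := simple_root simD dD.
have ngd : g != d by apply: contraNneq gD => ->.
have rp := reflection_pos dD gp ngd.
rewrite -(reflectionK dP g); apply: Pr => //; first by rewrite reflectionK.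
apply: IH => //; first exact: pos_root rp.
rewrite /reflection dotBl dotZl (hrho d dD) mulr1 gtrBl.
by rewrite divr_gt0 ?(root_gt0 rootPhi) // mulr_gt0.
Qed.

Lemma pos_length g : g \in Phip -> exists2 d, d \in D & dot g g = dot d d.
Proof.
move: g; apply: pos_ind => [d dD|d g dD _ _ [d' d'D e]]; first by exists d.
by exists d' => //; rewrite reflection_dot //; exact: (simple_root simD dD).
Qed.

End Descent.

Section Triple.
Variables (R : realType) (l : nat) (Phi D : {fset 'rV[R]_l}).
Local Notation V := 'rV[R]_l.
Hypotheses (rootPhi : root_system Phi) (irrPhi : irreducible_roots Phi).
Hypothesis simD : simple_roots Phi D.
Implicit Types (a b d g x y : V).
Local Notation Phip := (positive_roots Phi D).

Lemma cartan_pair a b : a \in Phi -> b \in Phi -> cartan b a = -3 ->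
  cartan a b = -1 /\ dot b b = 3 * dot a a /\ 2 * dot a b = -3 * dot a a.
Proof.
move=> aP bP e; have [m [n [em en eM eN lt4]]] := cartanP rootPhi bP aP.
have m3 : m = -3 by apply/eqP; rewrite -(eqr_int R) -em e.
have [a0 b0] := (root_gt0 rootPhi aP, root_gt0 rootPhi bP).
have ba : b != a.
  by apply/eqP => h; move: e; rewrite h /cartan mulfK ?gt_eqF //; lra.
have baN : b != - a.
  by apply/eqP => h; move: e; rewrite h /cartan dotNl mulrN mulNr mulfK ?gt_eqF //; lra.
have mn := lt4 ba baN.
have n0 : n < 0.
  rewrite -(ltr_int R) -(pmulr_llt0 _ b0) eN -eM m3 nmulr_rlt0 //; lra.
have n1 : n = -1 by clear -mn n0 m3; nia.
rewrite en n1; split=> //; move: eM eN; rewrite m3 n1 (dotC b a).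
have -> : (-3)%:~R = -3 :> R by []. have -> : (-1)%:~R = -1 :> R by [].
by move=> h1 h2; split; lra.
Qed.

(* The pairs are the Cartan integers of a root outside the plane of a [G2]
   subsystem with its three short roots and three long roots. *)
Lemma triple_arith (n1 n1' n2 n2' n3 n3' L L' M M' K K' : int) (G s : R) :
  0 < G -> 0 < s -> n2 = n1 + 3 * L -> n3 = - n1 - n2 -> M = n1 + L -> K = n1 + 2 * L ->
  n1'%:~R * G = n1%:~R * s -> n2'%:~R * G = n2%:~R * s -> n3'%:~R * G = n3%:~R * s ->
  L'%:~R * G = 3 * L%:~R * s -> M'%:~R * G = 3 * M%:~R * s ->
  K'%:~R * G = 3 * K%:~R * s ->
  n1 * n1' < 4 -> n2 * n2' < 4 -> n3 * n3' < 4 -> L * L' < 4 -> M * M' < 4 ->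
  K * K' < 4 -> n1 = 0 /\ L = 0.
Proof.
move=> G0 s0 e2 e3 eM eK h1 h2 h3 hL hM hK b1 b2 b3 bL bM bK.
have same (i i' : int) (k : R) : 0 < k -> i'%:~R * G = k * i%:~R * s ->
    (0 < i -> 0 < i') /\ (i < 0 -> i' < 0).
  move=> k0 e; split=> i0.
    by rewrite -(ltr0z R) -(pmulr_lgt0 _ G0) e pmulr_lgt0 // pmulr_rgt0 // ltr0z.
  by rewrite -(ltrz0 R) -(pmulr_llt0 _ G0) e pmulr_llt0 // pmulr_rlt0 // ltrz0.
have s3 : (0 : R) < 3 by lra.
have g1 : (0 < n1 -> 0 < n1') /\ (n1 < 0 -> n1' < 0) by apply: (same _ _ 1); rewrite ?mul1r.
have g2 : (0 < n2 -> 0 < n2') /\ (n2 < 0 -> n2' < 0) by apply: (same _ _ 1); rewrite ?mul1r.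
have g3 : (0 < n3 -> 0 < n3') /\ (n3 < 0 -> n3' < 0) by apply: (same _ _ 1); rewrite ?mul1r.
have gL := same L L' 3 s3 hL; have gM := same M M' 3 s3 hM; have gK := same K K' 3 s3 hK.
(* Eliminates the lengths [G] and [s]. With [n1] and [n2] between -3 and 3, which also bounds [L], a
   finite problem on integers remains. *)
have cross (i i' j j' : int) (k k' : R) : i'%:~R * G = k * i%:~R * s ->
    j'%:~R * G = k' * j%:~R * s -> k' * j%:~R * i'%:~R = k * i%:~R * j'%:~R :> R.
  move=> e e'; have Gs : G * s != 0 by rewrite mulf_neq0 ?gt_eqF.
  apply: (mulIf Gs); transitivity ((i'%:~R * G) * (k' * j%:~R * s)); first by ring.
  by rewrite e -e'; ring.
have int_eq (i j : int) : i%:~R = j%:~R :> R -> i = j by move=> /eqP; rewrite eqr_int => /eqP.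
have h1' : n1'%:~R * G = 1 * n1%:~R * s by rewrite mul1r.
have h2' : n2'%:~R * G = 1 * n2%:~R * s by rewrite mul1r.
have h3' : n3'%:~R * G = 1 * n3%:~R * s by rewrite mul1r.
have x12 : n2 * n1' = n1 * n2'.
  by apply: int_eq; rewrite !intrM; have := cross _ _ _ _ _ _ h1' h2'; rewrite !mul1r.
have x13 : n3 * n1' = n1 * n3'.
  by apply: int_eq; rewrite !intrM; have := cross _ _ _ _ _ _ h1' h3'; rewrite !mul1r.
have x1L : 3 * L * n1' = n1 * L'.
  by apply: int_eq; rewrite !intrM; have := cross _ _ _ _ _ _ h1' hL; rewrite !mul1r.
have x1M : 3 * M * n1' = n1 * M'.
  by apply: int_eq; rewrite !intrM; have := cross _ _ _ _ _ _ h1' hM; rewrite !mul1r.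
have x2K : 3 * K * n2' = n2 * K'.
  by apply: int_eq; rewrite !intrM; have := cross _ _ _ _ _ _ h2' hK; rewrite !mul1r.
clear h1 h2 h3 h1' h2' h3' hL hM hK same cross int_eq G0 s0 s3 G s gL.
have bd (i i' : int) : (0 < i -> 0 < i') /\ (i < 0 -> i' < 0) -> i * i' < 4 -> -3 <= i <= 3.
  clear; move=> [p q] h; have [i0|[i0|i0]] : i = 0 \/ 0 < i \/ i < 0 by clear; lia.
  - by rewrite i0.
  - by have := p i0; clear -i0 h; nia.
  - by have := q i0; clear -i0 h; nia.
have d1 := bd _ _ g1 b1; have d2 := bd _ _ g2 b2; clear bd.
have c1 : n1 = -3 \/ n1 = -2 \/ n1 = -1 \/ n1 = 0 \/ n1 = 1 \/ n1 = 2 \/ n1 = 3.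
  by clear -d1; lia.
have cL : L = -2 \/ L = -1 \/ L = 0 \/ L = 1 \/ L = 2 by clear -d1 d2 e2; lia.
case: g1 g2 g3 gM gK => [p1 q1] [p2 q2] [p3 q3] [pM qM] [pK qK].
clear R l Phi D rootPhi irrPhi simD.
by case: c1 => [?|[?|[?|[?|[?|[?|?]]]]]]; case: cL => [?|[?|[?|[?|?]]]];
  subst; lia.
Qed.

Lemma cartanE a b (k : R) : b \in Phi -> 2 * dot a b = k * dot b b -> cartan a b = k.
Proof. by move=> /(root_gt0 rootPhi) b0 e; rewrite /cartan e mulfK ?gt_eqF. Qed.

Lemma triple_roots a b : a \in Phi -> b \in Phi -> cartan b a = -3 ->
  [/\ a + b \in Phi, 2 *: a + b \in Phi, 3 *: a + b \in Phi & 3 *: a + 2 *: b \in Phi].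
Proof.
move=> aP bP e; have [eab [bb ab]] := cartan_pair aP bP e.
have r1 : a + b \in Phi.
  by have := root_reflection rootPhi bP aP; rewrite /reflection eab scaleN1r opprK.
have r3 : 3 *: a + b \in Phi.
  by have := root_reflection rootPhi aP bP; rewrite /reflection e scaleNr opprK addrC.
split=> //.
  have := root_reflection rootPhi aP r1; rewrite /reflection.
  rewrite (@cartanE _ _ (-1)) //; last by rewrite dotDl (dotC b); lra.
  by rewrite scaleN1r opprK addrAC scaler_nat mulr2n.
have := root_reflection rootPhi bP r3; rewrite /reflection.
rewrite (@cartanE _ _ (-1)) //; last by rewrite dotDl dotZl bb; lra.
by rewrite scaleN1r opprK -addrA [2 *: b]scaler_nat mulr2n.
Qed.

(** By [triple_arith] a root outside the plane is orthogonal to it, and irreducibility excludes such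
    roots. The sign on [2 *: a + b] makes the three short roots sum to zero. *)
Lemma triple_plane a b : a \in Phi -> b \in Phi -> cartan b a = -3 ->
  forall g, g \in Phi -> exists c1 c2, g = c1 *: a + c2 *: b.
Proof.
move=> aP bP e; have [eab [bb ab]] := cartan_pair aP bP e.
have s0 := root_gt0 rootPhi aP.
have [r1 r2 r3 r4] := triple_roots aP bP e.
have r2N := root_opp rootPhi r2.
pose plane g := exists c1 c2, g = c1 *: a + c2 *: b.
have planeN g : plane g -> plane (- g).
  by move=> [c1 [c2 ->]]; exists (- c1), (- c2); rewrite opprD !scaleNr.
have pl (c1 c2 : R) : plane (c1 *: a + c2 *: b) by exists c1, c2.
have orth v : v \in Phi -> ~ plane v -> dot v a = 0 /\ dot v b = 0.
  move=> vP nv; have G0 := root_gt0 rootPhi vP.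
  have C h : h \in Phi -> plane h -> exists m m' : int,
      [/\ m%:~R * dot h h = 2 * dot v h, m'%:~R * dot v v = 2 * dot v h & m * m' < 4].
    move=> hP hp; have [m [m' [_ _ e1 e2 e3]]] := cartanP rootPhi vP hP.
    exists m, m'; split=> //; apply: e3; apply/eqP => ev; apply: nv; rewrite ev //.
    exact: planeN.
  have p1 : plane a by exists 1, 0; rewrite scale1r scale0r addr0.
  have p2 : plane b by exists 0, 1; rewrite scale1r scale0r add0r.
  have p3 : plane (a + b) by exists 1, 1; rewrite !scale1r.
  have p4 : plane (- (2 *: a + b)) by apply: planeN; exists 2, 1; rewrite scale1r.
  have p5 : plane (3 *: a + b) by exists 3, 1; rewrite scale1r.
  have [n1 [n1' [e1 f1 b1]]] := C _ aP p1.
  have [n2 [n2' [e2 f2 b2]]] := C _ r1 p3.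
  have [n3 [n3' [e3 f3 b3]]] := C _ r2N p4.
  have [L [L' [eL fL bL]]] := C _ bP p2.
  have [M [M' [eM fM bM]]] := C _ r3 p5.
  have [K [K' [eK fK bK]]] := C _ r4 (pl _ _).
  move: e2 e3 eL eM eK f2 f3 fL fM fK; rewrite !(dotL, dotR) (dotC b a) bb.
  set s := dot a a in s0 ab e1 *; set G := dot v v in G0 f1 *.
  move=> e2 e3 eL eM eK f2 f3 fL fM fK.
  have {}e2 : n2%:~R * s = 2 * (dot v a + dot v b) by rewrite -e2; congr (_ * _); lra.
  have {}e3 : n3%:~R * s = 2 * - (2 * dot v a + dot v b) by rewrite -e3; congr (_ * _); lra.
  have {}eM : 3 * (M%:~R * s) = 2 * (3 * dot v a + dot v b).
    by rewrite -eM mulrCA; congr (_ * _); lra.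
  have {}eK : 3 * (K%:~R * s) = 2 * (3 * dot v a + 2 * dot v b).
    by rewrite -eK mulrCA; congr (_ * _); lra.
  have {}eL : 3 * (L%:~R * s) = 2 * dot v b by rewrite -eL mulrCA.
  have cancel (i j : int) : i%:~R * s = j%:~R * s -> i = j.
    by move/(mulIf (lt0r_neq0 s0))/eqP; rewrite eqr_int => /eqP.
  have q2 : n2 = n1 + 3 * L by apply: cancel; rewrite intrD intrM; lra.
  have q3 : n3 = - n1 - n2 by apply: cancel; rewrite intrB intrN; lra.
  have qM : M = n1 + L by apply: cancel; rewrite intrD; lra.
  have qK : K = n1 + 2 * L by apply: cancel; rewrite intrD intrM; lra.
  have [] := triple_arith G0 s0 q2 q3 qM qK _ _ _ _ _ _ b1 b2 b3 bL bM bK.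
  - by rewrite f1 e1.
  - by rewrite f2 e2.
  - by rewrite f3 e3.
  - by rewrite fL -mulrA eL.
  - by rewrite fM -mulrA eM.
  - by rewrite fK -mulrA eK.
  by move=> n10 L0; move: e1 eL; rewrite n10 L0 !mul0r => h1 h2; split; lra.
pose Psi := [fset g in Phi | `[< plane g >]].
have aPsi : a \in Psi.
  by rewrite !inE /= aP; apply/asboolP; exists 1, 0; rewrite scale1r scale0r addr0.
have [||h|h] := irrPhi.2 Psi.
- by apply/fsubsetP => g; rewrite !inE /= => /andP[].
- move=> u v; rewrite !inE /= => /andP[uP /asboolP[c1 [c2 ->]]] /andP[nv vP].
  have [|va vb] := orth v vP.
    by move=> vp; move: nv; rewrite vP /=; case/negP; apply/asboolP.
  by rewrite dotDl !dotZl dotC va dotC vb !mulr0 addr0.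
- by move: aPsi; rewrite h inE.
by move=> g; rewrite -h !inE /= => /andP[_ /asboolP].
Qed.

(** The given pair need not be simple. Its plane bounds the rank by 2, and [pos_length] transfers
    the length ratio 3 to the simple roots, whose Cartan integers are then [3 n] and [n] with [n]
    equal to 0 or -1. *)
Lemma triple_typeG2 : ~ no_triple Phi -> typeG2 D.
Proof.
move=> /existsNP[b] /existsNP[a] /not_implyP[bP] /not_implyP[aP] /contrapT e.
have [eab [bb ab]] := cartan_pair aP bP e.
have pl := triple_plane aP bP e.
have dim_le : (\dim (rspan Phi) <= 2)%N.
  apply: leq_trans (dim_span [:: a; b]); apply: dimvS; apply/span_subvP => g /pl[c1 [c2 ->]].
  by rewrite memvD // memvZ // memv_span // !inE eqxx ?orbT.
have cardD : (#|` D| <= 2)%N.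
  by have /andP[/eqP eD /eqnP <-] := simple_basis simD; rewrite eD.
have pos_rep g : g \in Phi -> exists2 g', g' \in Phip & g = g' \/ g = - g'.
  move=> gP; case: (pos_or_neg rootPhi simD gP) => h; first by exists g => //; left.
  by exists (- g) => //; right; rewrite opprK.
have [a' a'p ea] := pos_rep a aP; have [b' b'p eb] := pos_rep b bP.
have [da daD la'] := pos_length rootPhi simD a'p.
have [db dbD lb'] := pos_length rootPhi simD b'p.
have la : dot a a = dot da da by rewrite -la'; case: ea => ->; rewrite ?dotNl ?dotNr ?opprK.
have lb : dot b b = dot db db by rewrite -lb'; case: eb => ->; rewrite ?dotNl ?dotNr ?opprK.
have a0 := root_gt0 rootPhi aP.
have dab : da != db by apply/eqP => h; move: bb; rewrite lb -h -la; lra.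
have eD : D = [fset da; db].
  apply/esym/eqP; rewrite eqEfcard cardfs2 dab cardD andbT.
  by apply/fsubsetP => d; rewrite !inE => /orP[] /eqP ->.
have [daP dbP] := (simple_root simD daD, simple_root simD dbD).
have Z0 := simple_dot_le0 rootPhi simD daD dbD dab.
have [m [n [cm cn em en lt4]]] := cartanP rootPhi dbP daP.
have lens : dot db db = 3 * dot da da by rewrite -lb -la.
have dbaN : db != - da.
  by apply/eqP => h; move: lens; rewrite h dotNl dotNr opprK -la; lra.
have mn : m * n < 4 by apply: lt4 => //; rewrite eq_sym.
have da0 := root_gt0 rootPhi daP.
have m3n : m = 3 * n.
  apply/eqP; rewrite -(eqr_int R) intrM -(inj_eq (mulIf (lt0r_neq0 da0))) em -en lens.
  by apply/eqP; have -> : 3%:~R = 3 :> R by []; ring.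
have [n0|n0] := eqVneq n 0; last first.
  have nlt : n < 0.
    rewrite lt_def eq_sym n0 /= -(ler_int R) -(pmulr_lle0 _ (root_gt0 rootPhi dbP)) en.
    by rewrite dotC; lra.
  have n1 : n = -1 by clear -nlt mn m3n; nia.
  exists da, db; split=> //; first by rewrite cn n1.
  by rewrite cm m3n n1.
(* Orthogonal simple roots are the only positive roots, so that [a] and [b]
   cannot form an angle of 150 degrees. *)
exfalso; have Zz : dot db da = 0.
  by move: en; rewrite n0 mul0r => h; lra.
have only g : g \in Phip -> g = da \/ g = db.
  move=> gp; have [->|gda] := eqVneq g da; [by left|right].
  have rp := reflection_pos rootPhi simD daD gp gda.
  have /posP[gP [c ec]] := gp; have /posP[_ [c' ec']] := rp.
  have sumD (k : V -> nat) : \sum_(d <- D) (k d)%:R *: d = (k da)%:R *: da + (k db)%:R *: db.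
    by rewrite (big_fsetD1 da daD) /= eD fsetU1K ?big_seq_fset1 // inE.
  have [x _ hx] := simple_point simD (fun v => (v == da)%:R).
  have E (k : V -> nat) v : v = \sum_(d <- D) (k d)%:R *: d -> dot v x = (k da)%:R.
    by move=> ->; rewrite sumD dotDl !dotZl !hx // eqxx eq_sym (negPf dab) mulr0 addr0 mulr1.
  have h1 := E c g ec; have := E c' _ ec'; rewrite /reflection dotBl dotZl h1 hx // eqxx mulr1.
  have -> : cartan g da = 2 * (c da)%:R.
    apply: cartanE => //; rewrite {1}ec sumD dotDl !dotZl Zz mulr0 addr0; ring.
  move=> h2; have : (c da)%:R + (c' da)%:R = 0 :> R by lra.
  move=> /eqP; rewrite -natrD pnatr_eq0 addn_eq0 => /andP[/eqP c0 _].
  have : g = (c db)%:R *: db by rewrite {1}ec sumD c0 scale0r add0r.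
  exact: (pos_prop rootPhi simD gp (simple_pos simD dbD)).
have ab0 : dot a b = 0.
  have K : dot db db <> dot da da by rewrite lens; lra.
  have a'da : a' = da by case: (only a' a'p) => // h; case: K; rewrite -h.
  have b'db : b' = db by case: (only b' b'p) => // h; case: K; rewrite -[in RHS]h.
  have Zz' : dot da db = 0 by rewrite dotC.
  by case: ea => ->; case: eb => ->; rewrite a'da b'db ?dotNl ?dotNr Zz' ?oppr0.
by move: ab; rewrite ab0; lra.
Qed.

End Triple.

(** * Positive roots and compatible sets in type [G2] *)

Section G2.
Variables (R : realType) (l : nat) (Phi D : {fset 'rV[R]_l}) (a1 a2 : 'rV[R]_l).
Local Notation V := 'rV[R]_l.
Hypotheses (rootPhi : root_system Phi) (irrPhi : irreducible_roots Phi).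
Hypothesis simD : simple_roots Phi D.
Hypotheses (eD : D = [fset a1; a2]) (c21 : cartan a2 a1 = -3).
Implicit Types (a b d g x y : V) (p q r : nat * nat).
Local Notation Phip := (positive_roots Phi D).

Let a1D : a1 \in D. Proof. by rewrite eD !inE eqxx. Qed.
Let a2D : a2 \in D. Proof. by rewrite eD !inE eqxx orbT. Qed.
Let a1P : a1 \in Phi. Proof. exact: (simple_root simD a1D). Qed.
Let a2P : a2 \in Phi. Proof. exact: (simple_root simD a2D). Qed.
Let s0 : 0 < dot a1 a1. Proof. exact: (root_gt0 rootPhi a1P). Qed.
Let d22 : dot a2 a2 = 3 * dot a1 a1.
Proof. by have [_ []] := cartan_pair rootPhi a1P a2P c21. Qed.
Let d12 : 2 * dot a1 a2 = -3 * dot a1 a1.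
Proof. by have [_ []] := cartan_pair rootPhi a1P a2P c21. Qed.

Lemma G2_simple_neq : a1 != a2.
Proof. by apply/eqP => e; move: d22 s0; rewrite -e; lra. Qed.

Definition g2 p : V := p.1%:R *: a1 + p.2%:R *: a2.

(** The first coordinate is on the short simple root. Questions on pairs of positive roots become
    computations with natural numbers. *)
Definition G2_coords : seq (nat * nat) :=
  [:: (1, 0); (0, 1); (1, 1); (2, 1); (3, 1); (3, 2)]%N.

Lemma g2_10 : g2 (1, 0)%N = a1. Proof. by rewrite /g2 scale1r scale0r addr0. Qed.
Lemma g2_01 : g2 (0, 1)%N = a2. Proof. by rewrite /g2 scale1r scale0r add0r. Qed.

Lemma big_G2_simple (M : zmodType) (F : V -> M) : \sum_(d <- D) F d = F a1 + F a2.
Proof.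
rewrite (big_fsetD1 a1 a1D) /= eD fsetU1K ?big_seq_fset1 // inE.
exact: G2_simple_neq.
Qed.

Lemma natcomb_g2 p : natcomb D (g2 p).
Proof.
exists (fun v => if v == a1 then p.1 else p.2).
by rewrite big_G2_simple eqxx eq_sym (negPf G2_simple_neq).
Qed.

Lemma g2_point (z1 z2 : R) : exists x, [/\ x \in rspan Phi, dot a1 x = z1,
  dot a2 x = z2 & forall p, dot (g2 p) x = p.1%:R * z1 + p.2%:R * z2].
Proof.
have [x xU hx] := simple_point simD (fun v => if v == a1 then z1 else z2).
have h1 : dot a1 x = z1 by rewrite hx // eqxx.
have h2 : dot a2 x = z2 by rewrite hx // eq_sym (negPf G2_simple_neq).
by exists x; split=> // p; rewrite dotDl !dotZl h1 h2.
Qed.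

Lemma g2_inj : injective g2.
Proof.
move=> [i j] [i' j'] e; have [x [_ _ _ hx]] := g2_point 1 0.
have [y [_ _ _ hy]] := g2_point 0 1.
have := hx (i, j); rewrite e hx /= !mulr1 !mulr0 !addr0 => /eqP; rewrite eqr_nat => /eqP ->.
by have := hy (i, j); rewrite e hy /= !mulr1 !mulr0 !add0r => /eqP; rewrite eqr_nat => /eqP ->.
Qed.

(** The positive and negative parts stay natural numbers, so that obtuseness is a decidable
    comparison in [nat]. *)
Lemma g2_dot p q : 2 * dot (g2 p) (g2 q) = dot a1 a1 *
  ((2 * (p.1 * q.1) + 6 * (p.2 * q.2))%N%:R - (3 * (p.1 * q.2 + p.2 * q.1))%N%:R).
Proof.
rewrite /g2 !(dotL, dotR) (dotC a2 a1) d22.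
have -> : dot a1 a2 = -3 * dot a1 a1 / 2 by rewrite -d12; field.
by rewrite !(natrD, natrM); field.
Qed.

Lemma g2_reflection1 (u v : R) :
  reflection a1 (u *: a1 + v *: a2) = (3 * v - u) *: a1 + v *: a2.
Proof.
rewrite /reflection (_ : cartan _ _ = 2 * u - 3 * v).
  by rewrite addrAC -scalerBl; congr (_ *: _ + _); ring.
by apply: (cartanE rootPhi) => //; rewrite !(dotL, dotR) (dotC a2); move: d12 => h; nra.
Qed.

Lemma g2_reflection2 (u v : R) :
  reflection a2 (u *: a1 + v *: a2) = u *: a1 + (u - v) *: a2.
Proof.
rewrite /reflection (_ : cartan _ _ = 2 * v - u).
  by rewrite -addrA -scalerBl; congr (_ + _ *: _); ring.
by apply: (cartanE rootPhi) => //; rewrite !(dotL, dotR) d22; move: d12 => h; nra.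
Qed.

Lemma G2_posP g : g \in Phip <-> exists2 p, p \in G2_coords & g = g2 p.
Proof.
split=> [|[p pl ->]]; last first.
  apply/posP; split; last exact: natcomb_g2.
  have [r1 r2 r3 r4] := triple_roots rootPhi a1P a2P c21.
  move: pl; rewrite !inE => /or4P[/eqP->|/eqP->|/eqP->|/or3P[/eqP->|/eqP->|/eqP->]].
  - by rewrite g2_10.
  - by rewrite g2_01.
  - by rewrite /g2 !scale1r.
  - by rewrite /g2 scale1r.
  - by rewrite /g2 scale1r.
  - by rewrite /g2.
move: g; apply: (pos_ind rootPhi simD) => [d|d g dD gp rp [p pl eg]].
  by rewrite eD !inE => /orP[]/eqP ->; [exists (1, 0)%N; rewrite ?g2_10|exists (0, 1)%N; rewrite ?g2_01].
have neg (h : - g \in Phip) : False := pos_negF rootPhi simD gp h.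
have sw (u v : R) (q : nat * nat) : q \in G2_coords -> q.1%:R = u -> q.2%:R = v ->
    exists2 p, p \in G2_coords & u *: a1 + v *: a2 = g2 p.
  by move=> ql e1 e2; exists q; rewrite // /g2 e1 e2.
move: dD; rewrite eD !inE => /orP[]/eqP ed.
  move: pl rp neg; rewrite {}ed {}eg !inE g2_reflection1.
  move=> /or4P[/eqP->|/eqP->|/eqP->|/or3P[/eqP->|/eqP->|/eqP->]] rp neg.
  - case: neg; rewrite (_ : - g2 (1, 0)%N = (3 * 0%:R - 1%:R) *: a1 + 0%:R *: a2) //.
    by rewrite /g2 /= opprD -!scaleNr; congr (_ *: _ + _ *: _); lra.
  - by apply: (sw _ _ (3, 1)%N) => //=; lra.
  - by apply: (sw _ _ (2, 1)%N) => //=; lra.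
  - by apply: (sw _ _ (1, 1)%N) => //=; lra.
  - by apply: (sw _ _ (0, 1)%N) => //=; lra.
  - by apply: (sw _ _ (3, 2)%N) => //=; lra.
move: pl rp neg; rewrite {}ed {}eg !inE g2_reflection2.
move=> /or4P[/eqP->|/eqP->|/eqP->|/or3P[/eqP->|/eqP->|/eqP->]] rp neg.
- by apply: (sw _ _ (1, 1)%N) => //=; lra.
- case: neg; rewrite (_ : - g2 (0, 1)%N = 0%:R *: a1 + (0%:R - 1%:R) *: a2) //.
  by rewrite /g2 /= opprD -!scaleNr; congr (_ *: _ + _ *: _); lra.
- by apply: (sw _ _ (1, 0)%N) => //=; lra.
- by apply: (sw _ _ (2, 1)%N) => //=; lra.
- by apply: (sw _ _ (3, 2)%N) => //=; lra.
- by apply: (sw _ _ (3, 1)%N) => //=; lra.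
Qed.

(** If no ceiling in the expansion of [- a] came from [Sigma], there would be two of them, [s] and
    [t], neither equal to [- a2]. The coefficients of [- s] and [- t] on [a1] add up to at most that
    of [a], hence to at most 3. This forces [s - t] to be a root up to sign, against [base_sub]. *)
Lemma G2_long_compatible (Sigma : {fset V}) : Sigma `<=` Phip -> a2 \in Sigma ->
  worpitzky_compatible Phi D Sigma.
Proof.
move=> subS a2S; apply: (compat_criterion rootPhi irrPhi simD subS).
move=> x0 x a c x0U reg _ cx aS ea ec hc.
set B := alcove_base Phi x0 in ea ec hc *.
apply: contrapT => nex.
have noS s : s \in B -> c s != 0%N -> - s \notin Sigma.
  by move=> sB cs; apply/negP => sS; apply: nex; exists s.
have ap := fsubsetP subS a aS; have aP := pos_root ap.
have [s sB cs] : exists2 s, s \in B & c s != 0%N.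
  apply: contrapT => h; have := root_nz rootPhi (root_opp rootPhi aP).
  rewrite ea big_seq big1 ?eqxx // => s sB.
  have [->|cs] := eqVneq (c s) 0%N; first by rewrite scale0r.
  by case: h; exists s.
have [t [tB ts ct]] : exists t, [/\ t \in B, t != s & c t != 0%N].
  apply: contrapT => h.
  have e : a = (c s)%:R *: - s.
    apply: oppr_inj; rewrite ea scalerN opprK (big_fsetD1 s sB) /= big_seq big1 ?addr0 // => t.
    rewrite in_fsetD1 => /andP[ts tB]; have [->|ct] := eqVneq (c t) 0%N.
      by rewrite scale0r.
    by case: h; exists t.
  have := noS s sB cs.
  by rewrite -(pos_prop rootPhi simD ap (hc s sB cs).2 e) aS.
have [/G2_posP[p pl ep] /G2_posP[q ql eq]] := ((hc s sB cs).2, (hc t tB ct).2).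
have /G2_posP[r rl er] := ap.
have [x1 [_ h1 h2 hx]] := g2_point 1 0.
have coordE g : g \in Phip -> 0 <= dot g x1.
  by move=> /G2_posP[u _ ->]; rewrite hx mulr1 mulr0 addr0.
have le : (p.1 + q.1 <= r.1)%N.
  rewrite -(ler_nat R) natrD.
  have ->: r.1%:R = dot a x1 by rewrite er hx mulr1 mulr0 addr0.
  have -> : dot a x1 = \sum_(u <- B) (c u)%:R * dot (- u) x1.
    rewrite -[dot a x1]opprK -dotNl ea dot_suml -sumrN; apply: eq_bigr => u _.
    by rewrite dotZl dotNl mulrN.
  have tBs : t \in B `\ s by rewrite in_fsetD1 ts.
  rewrite (big_fsetD1 s sB) (big_fsetD1 t tBs) /= addrA.
  rewrite -[X in X <= _]addr0 lerD //; last first.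
    rewrite big_seq sumr_ge0 // => u; rewrite !in_fsetD1 => /and3P[_ _ uB].
    have [->|cu] := eqVneq (c u) 0%N; first by rewrite mul0r.
    by rewrite mulr_ge0 ?ler0n // coordE // (hc u uB cu).2.
  have up (k n : nat) : k != 0%N -> n%:R <= k%:R * n%:R :> R.
    by move=> k0; rewrite -natrM ler_nat leq_pmull // lt0n.
  by rewrite ep eq !hx !mulr1 !mulr0 !addr0 lerD // up.
have pn : p != (0, 1)%N.
  by apply: contraNneq (noS s sB cs) => e; rewrite ep e g2_01.
have qn : q != (0, 1)%N.
  by apply: contraNneq (noS t tB ct) => e; rewrite eq e g2_01.
have pq : p != q.
  by apply: contraNneq ts => e; rewrite -[t]opprK eq -e -ep opprK.
have g2D u v : g2 (u.1 + v.1, u.2 + v.2)%N = g2 u + g2 v.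
  by rewrite /g2 !natrD !scalerDl addrACA.
have diff u v w : u \in G2_coords -> g2 v = g2 w + g2 u -> g2 v - g2 w \in Phi.
  move=> ul ->; rewrite addrAC subrr add0r; apply: (@pos_root _ _ _ D).
  by apply/G2_posP; exists u.
have r3 : (r.1 < 4)%N.
  by move: rl; rewrite !inE => /or4P[/eqP->|/eqP->|/eqP->|/or3P[/eqP->|/eqP->|/eqP->]].
(* Only pairs among [a1], [a1 + a2] and [2 a1 + a2] survive the bound, and their differences are
   roots. *)
have check : (all (fun p => all (fun q => [|| p == (0, 1), q == (0, 1), p == q,
    3 < p.1 + q.1,
    has (fun r => p == (q.1 + r.1, q.2 + r.2)) G2_coords |
    has (fun r => q == (p.1 + r.1, p.2 + r.2)) G2_coords]) G2_coords) G2_coords)%N by [].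
have := allP (allP check p pl) q ql.
rewrite (negPf pn) (negPf qn) (negPf pq) !orFb ltnNge (leq_trans le r3) orFb.
have [sP tP] := (base_sub rootPhi reg sB tB, base_sub rootPhi reg tB sB).
have es : - g2 p = s by rewrite -ep opprK.
have et : - g2 q = t by rewrite -eq opprK.
case/orP=> /hasP[u ul /eqP e].
  move/negP: tP; apply; rewrite -es -et opprK addrC; apply: (diff u) => //.
  by rewrite {1}e g2D.
move/negP: sP; apply; rewrite -es -et opprK addrC; apply: (diff u) => //.
by rewrite {1}e g2D.
Qed.

Section Compatible.
Variable Sigma : {fset V}.
Hypotheses (subS : Sigma `<=` Phip) (compat : worpitzky_compatible Phi D Sigma).

(** At the point where both simple roots are 1 all roots are integral, and the simple roots span the
    cone. *)
Lemma G2_simple_cond a : a \in Sigma -> a1 \in Sigma \/ a2 \in Sigma.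
Proof.
move=> aS; have [x [xU h1 h2 hx]] := g2_point 1 1.
have int g : g \in Phip -> dot g x \is a Num.int.
  by move=> /G2_posP[p _ ->]; rewrite hx !mulr1 rpredD ?rpred_nat.
apply: (compatible_local rootPhi irrPhi simD subS compat (x := x) _ _ _ _ _ _ _ aS) => //.
- by move=> d; rewrite eD !inE => /orP[]/eqP ->; rewrite ?h1 ?h2 ltr01 lexx.
- exact: (simple_pos simD).
- exact: (simple_pos simD).
- by rewrite h1.
- by rewrite h2.
- move=> g gP _; case: (pos_or_neg rootPhi simD gP) => /G2_posP[p _ ->].
    by exists p.1%:R, p.2%:R; split=> //; left.
  by exists p.1%:R, p.2%:R; split=> //; right.
- by apply: int; exact: (fsubsetP subS).
Qed.

(** At the point with values 1/3 and 1 only the long roots are integral; they form a system of type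
    [A2] with base [3 a1 + a2], [a2]. *)
Lemma G2_long_cond : g2 (3, 2)%N \in Sigma -> g2 (3, 1)%N \in Sigma \/ a2 \in Sigma.
Proof.
move=> aS; have [x [xU h1 h2 hx]] := g2_point (3^-1) 1.
have h31 : dot (g2 (3, 1)%N) x = 2 by rewrite hx /=; field.
apply: (compatible_local rootPhi irrPhi simD subS compat (x := x) _ _ _ _ _ _ _ aS) => //.
- move=> d; rewrite eD !inE => /orP[]/eqP ->; rewrite ?h1 ?h2 ?ltr01 ?lexx //.
  by apply/andP; split; lra.
- by apply/G2_posP; exists (3, 1)%N.
- exact: (simple_pos simD).
- by rewrite h31.
- by rewrite h2.
- have nint (k : int) (u : R) : u *+ 3 = k%:~R -> (forall m : int, m * 3 != k) -> u \isn't a Num.int.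
    move=> e h; apply/negP => /intrP[m em]; have := h m; rewrite -(eqr_int R) intrM -e em.
    by rewrite mulr_natr eqxx.
  have pos_case g : g \in Phip -> dot g x \is a Num.int -> exists c1 c2 : R,
      [/\ 0 <= c1, 0 <= c2 & g = c1 *: g2 (3, 1)%N + c2 *: a2].
    move=> /G2_posP[p pl ->].
    move: pl; rewrite !inE => /or4P[/eqP->|/eqP->|/eqP->|/or3P[/eqP->|/eqP->|/eqP->]].
    + by rewrite (negPf (@nint 1 _ _ _)) // ?hx /=; [field|move=> m; apply/eqP; lia].
    + by move=> _; exists 0, 1; rewrite g2_01 scale0r add0r scale1r.
    + by rewrite (negPf (@nint 4 _ _ _)) // ?hx /=; [field|move=> m; apply/eqP; lia].
    + by rewrite (negPf (@nint 5 _ _ _)) // ?hx /=; [field|move=> m; apply/eqP; lia].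
    + by move=> _; exists 1, 0; rewrite scale0r addr0 scale1r.
    + move=> _; exists 1, 1; split=> //; rewrite !scale1r /g2 /= -addrA; congr (_ + _).
      by rewrite scale1r scaler_nat mulr2n.
  move=> g gP gx; case: (pos_or_neg rootPhi simD gP) => gp.
    by have [c1 [c2 [? ? ?]]] := pos_case g gp gx; exists c1, c2; split=> //; left.
  have [|c1 [c2 [? ? ?]]] := pos_case _ gp; first by rewrite dotNl rpredN.
  by exists c1, c2; split=> //; right.
- by rewrite hx /= (_ : _ + _ = 3) //; field.
Qed.

(** There are three obtuse pairs of positive roots. [G2_simple_cond] and [G2_long_cond] settle
    [a1, a2] and [3 a1 + a2, a2]; the assumption [C2] is the condition for the short pair
    [a1, a1 + a2]. If it fails, both short roots are missing and [G2_simple_cond] forces [a2] into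
    [Sigma]. *)
Lemma G2_compatible_cases : negatively_coclosed Phi D Sigma \/ G2_exceptional D Sigma.
Proof.
have [C2|nC2] := pselect ((g2 (2, 1)%N \in Sigma \/ g2 (3, 1)%N \in Sigma \/
    g2 (3, 2)%N \in Sigma) -> a1 \in Sigma \/ g2 (1, 1)%N \in Sigma).
  left=> a b1 b2 d1 d2 aS b1p b2p d10 d20 ea Z.
  have /G2_posP[p pl ep] := b1p; have /G2_posP[q ql eq] := b2p.
  have /G2_posP[r rl er] := fsubsetP subS a aS.
  have neg : (2 * (p.1 * q.1) + 6 * (p.2 * q.2) < 3 * (p.1 * q.2 + p.2 * q.1))%N.
    rewrite -(ltr_nat R) -subr_lt0 -(pmulr_rlt0 _ s0) -g2_dot -ep -eq.
    by rewrite pmulr_rlt0.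
  have rE : r = (d1 * p.1 + d2 * q.1, d1 * p.2 + d2 * q.2)%N.
    apply: g2_inj; rewrite -er ea ep eq /g2 /= !natrD !natrM !scalerDl -!scalerA.
    by rewrite !scalerDr addrACA.
  rewrite ep eq in b1p b2p *.
  have simple_cases := G2_simple_cond aS.
  have long_cases : r = (3, 2)%N -> g2 (3, 1)%N \in Sigma \/ a2 \in Sigma.
    by move=> e; apply: G2_long_cond; rewrite -e -er.
  have short_cases : r \in [:: (2, 1); (3, 1); (3, 2)]%N -> a1 \in Sigma \/ g2 (1, 1)%N \in Sigma.
    move=> h; apply: C2; move: h aS; rewrite er !inE => /or3P[]/eqP ->; tauto.
  have check : all (fun p => all (fun q =>
      (2 * (p.1 * q.1) + 6 * (p.2 * q.2) < 3 * (p.1 * q.2 + p.2 * q.1)) ==>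
      ((p, q) \in [:: ((1, 0), (0, 1)); ((0, 1), (1, 0)); ((3, 1), (0, 1));
         ((0, 1), (3, 1)); ((1, 0), (1, 1)); ((1, 1), (1, 0))]))%N G2_coords) G2_coords by [].
  have := implyP (allP (allP check p pl) q ql) neg.
  have swap (P Q : Prop) : P \/ Q -> Q \/ P by tauto.
  have rb : (r.1 <= 3)%N /\ (r.2 <= 2)%N /\ (r.2 = 2%N -> r.1 = 3%N).
    by move: rl; rewrite !inE => /or4P[/eqP->|/eqP->|/eqP->|/or3P[/eqP->|/eqP->|/eqP->]].
  rewrite !inE => /or4P[||| /or3P[||]] /eqP[ep' eq']; move: rE rb long_cases short_cases simple_cases;
    rewrite ep' eq' ?g2_10 ?g2_01 /= => rE rb lc sc simc.
  - exact: simc.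
  - exact: swap.
  - by apply: lc; rewrite rE; move: rb; rewrite rE /=; clear -d10 d20; move=> rb; congr (_, _); lia.
  - by apply: swap; apply: lc; rewrite rE; move: rb; rewrite rE /=; clear -d10 d20; move=> rb; congr (_, _); lia.
  - apply: sc; move: rl rb; rewrite rE !inE /= !xpair_eqE; clear -d10 d20; lia.
  - apply: swap; apply: sc; move: rl rb; rewrite rE !inE /= !xpair_eqE; clear -d10 d20; lia.
move/not_implyP: nC2 => [hT /not_orP[n10 n11]].
have a2S : a2 \in Sigma.
  by case: hT => [|[]] /G2_simple_cond [] // /n10.
right; exists a1, a2; split=> //; first by rewrite d22; move: s0; lra.
exists (Sigma `\ a2); split.
- case: hT => [h|[h|h]]; apply/fset0Pn; [exists (g2 (2, 1)%N)|exists (g2 (3, 1)%N)|exists (g2 (3, 2)%N)];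
    by rewrite in_fsetD1 h andbT -g2_01; apply/eqP => /g2_inj.
- apply/fsubsetP => g; rewrite in_fsetD1 => /andP[gn gS].
  have /G2_posP[p pl ep] := fsubsetP subS g gS; move: pl gn gS n10 n11; rewrite ep !inE.
  move=> /or4P[/eqP->|/eqP->|/eqP->|/or3P[/eqP->|/eqP->|/eqP->]]; rewrite ?g2_10 ?g2_01 ?eqxx //.
  + by rewrite /g2 /= !scale1r eqxx.
  + by rewrite /g2 /= !scale1r eqxx orbT.
  + by rewrite !orbT.
by rewrite fsetD1K.
Qed.

End Compatible.
End G2.

(** * Localizations *)

Section SimpleExists.
Variables (R : realType) (l : nat) (Psi : {fset 'rV[R]_l}) (rho : 'rV[R]_l).
Local Notation V := 'rV[R]_l.
Hypothesis rootPsi : root_system Psi.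
Hypothesis rho_nz : forall a, a \in Psi -> dot a rho != 0.
Implicit Types (a b c d : V).

(** The base is made of the positive roots that are not sums of two positive roots. They are
    pairwise obtuse and lie on one side of a hyperplane, hence are independent. *)
Lemma simple_exists : exists2 E, simple_roots Psi E &
  forall a, a \in positive_roots Psi E <-> a \in Psi /\ 0 < dot a rho.
Proof.
pose pos a := a \in Psi /\ 0 < dot a rho.
pose E := [fset a in Psi | `[< pos a /\ forall b c, pos b -> pos c -> a <> b + c >]].
have EP a : a \in E <-> pos a /\ forall b c, pos b -> pos c -> a <> b + c.
  rewrite !inE /=; split=> [/andP[_ /asboolP] //|h].
  by rewrite h.1.1; apply/asboolP.
have posN a : a \in Psi -> pos a \/ pos (- a).
  move=> aP; have [h|h] := ltP 0 (dot a rho); [by left|right].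
  split; first exact: root_opp.
  by rewrite dotNl oppr_gt0 lt_def eq_sym rho_nz.
have pos_comb a : pos a -> natcomb E a.
  move=> [aP]; move: a aP.
  apply: (@fset_real_ind R _ Psi (fun a => dot a rho)
    (fun a => 0 < dot a rho -> natcomb E a)) => a aP IH a0.
  have [aE|aE] := boolP (a \in E); first exact: natcomb_mem.
  have : ~ (pos a /\ forall b c, pos b -> pos c -> a <> b + c).
    by move/EP; rewrite (negPf aE).
  move=> /not_andP[[]//|] /existsNP[b] /existsNP[c] /not_implyP[[bP b0]].
  move=> /not_implyP[[cP c0]] /contrapT e.
  rewrite e; apply: natcombD; apply: IH => //; rewrite e dotDl.
    by rewrite ltrDl.
  by rewrite ltrDr.
have sub a : a \in E -> a \in Psi by move/EP=> [[]].
have obtuse a b : a \in E -> b \in E -> a != b -> dot a b <= 0.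
  move=> /EP[pa ha] /EP[pb hb] ab; rewrite leNgt; apply/negP => lt0.
  have abP := root_sub rootPsi pa.1 pb.1 ab lt0.
  case: (posN _ abP) => p; first by apply: (ha b (a - b)) => //; rewrite addrC subrK.
  have p' : pos (b - a) by rewrite -opprB.
  by apply: (hb a (b - a)) => //; rewrite addrC subrK.
have freeE : free (enum_fset E).
  have half (k : V -> R) : (forall d, d \in E -> 0 <= k d) ->
      \sum_(d <- E) k d *: d = 0 -> forall d, d \in E -> k d = 0.
    move=> k0 e d dE; have : \sum_(d <- E) k d * dot d rho = 0.
      rewrite -[RHS](dot0l rho) -e dot_suml; apply: eq_bigr => v _.
      by rewrite dotZl.
    move/eqP; rewrite big_seq psumr_eq0 => [/allP /(_ d dE)|v vE].
      have [[_ /gt_eqF d0] _] := (EP d).1 dE.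
      by rewrite dE mulf_eq0 d0 orbF => /eqP.
    by have [[_ v0] _] := (EP v).1 vE; rewrite mulr_ge0 ?k0 // ltW.
  apply: free_fset => k ek.
  (* A relation is cut into two nonnegative combinations of disjoint support. Their common value has
     nonpositive square, so it is 0, and pairing with [rho] kills the coefficients. *)
  pose kp d := Num.max (k d) 0; pose kn d := Num.max (- k d) 0.
  have kE d : k d = kp d - kn d.
    by rewrite /kp /kn; case: (lerP (k d) 0); case: (lerP (- k d) 0); lra.
  have kp0 d : 0 <= kp d by rewrite le_max lexx orbT.
  have kn0 d : 0 <= kn d by rewrite le_max lexx orbT.
  have kpn d : kp d * kn d = 0.
    by rewrite /kp /kn; case: (lerP (k d) 0); case: (lerP (- k d) 0); nra.
  have e : \sum_(d <- E) kp d *: d = \sum_(d <- E) kn d *: d.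
    apply/eqP; rewrite -subr_eq0 -sumrB -[X in _ == X]ek; apply/eqP.
    by apply: eq_bigr => d _; rewrite kE scalerBl.
  have p0 : \sum_(d <- E) kp d *: d = 0.
    apply: dot_eq0; apply/le_anti; rewrite dot_ge0 andbT {2}e dot_suml.
    rewrite -oppr_ge0 -sumrN big_seq sumr_ge0 // => d dE.
    rewrite dotZl dot_sumr mulr_sumr -sumrN big_seq sumr_ge0 // => d' d'E.
    rewrite dotZr mulrA; have [->|dd'] := eqVneq d d'; first by rewrite kpn mul0r oppr0.
    by rewrite -mulrN mulr_ge0 ?mulr_ge0 // oppr_ge0 obtuse.
  have n0 : \sum_(d <- E) kn d *: d = 0 by rewrite -e.
  by move=> d dE; rewrite kE (half kp) // (half kn) // subrr.
have simE : simple_roots Psi E.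
  split.
  - by apply/fsubsetP => a /sub.
  - rewrite /basis_of freeE andbT eqEsubv; apply/andP; split.
      by apply/span_subvP => a /sub aP; exact: memv_span.
    apply/span_subvP => a aP; case: (posN a aP) => /pos_comb /natcomb_span //.
    by rewrite rpredN.
  - by move=> a aP; case: (posN a aP) => /pos_comb; [left|right].
exists E => // a; split=> [/posP[aP aE]|[aP a0]]; last by apply/posP; split=> //; exact: pos_comb.
split=> //; apply: (natcomb_gt0 aE); first exact: (root_nz rootPsi aP).
by move=> d /EP[[_ d0] _].
Qed.

End SimpleExists.

Section SimpleUnique.
Variables (R : realType) (l : nat) (Phi D D' : {fset 'rV[R]_l}).
Local Notation V := 'rV[R]_l.
Hypothesis rootPhi : root_system Phi.
Hypotheses (simD : simple_roots Phi D) (simD' : simple_roots Phi D').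
Hypothesis eqpos : positive_roots Phi D' = positive_roots Phi D.

(** [locally_compatible2] only provides some simple system with the right positive roots. An element
    of [D] has height 1 and is a natural combination of elements of [D'], all of height at least 1,
    so it is one of them. *)
Lemma simple_unique : D' = D.
Proof.
have [rho _ hrho] := simple_point simD (fun=> 1).
have ht_ge1 v : v \in positive_roots Phi D -> 1 <= dot v rho.
  move=> vp; have v0 : 0 < dot v rho by apply: (pos_gt0 rootPhi vp) => d /hrho ->.
  have /posP[_ /natcomb_int h] := vp.
  have /h /intrP[n en] : forall d, d \in D -> dot d rho \is a Num.int by move=> d /hrho ->.
  by move: v0; rewrite en ltr0z -[X in X <= _]/(1%:~R) ler_int; clear; lia.
have sub : D `<=` D'.
  apply/fsubsetP => d dD; have dp := simple_pos simD dD.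
  have dp' : d \in positive_roots Phi D' by rewrite eqpos.
  have /posP[_ [c ec]] := dp'.
  have pos' v : v \in D' -> 1 <= dot v rho.
    by move=> vD'; apply: ht_ge1; rewrite -eqpos; exact: simple_pos.
  have [v vD' cv] : exists2 v, v \in D' & c v != 0%N.
    apply: contrapT => h; have := root_nz rootPhi (simple_root simD dD).
    rewrite ec big_seq big1 ?eqxx // => v vD'.
    have [->|cv] := eqVneq (c v) 0%N; first by rewrite scale0r.
    by case: h; exists v.
  have ht : \sum_(w <- D') (c w)%:R * dot w rho = 1.
    rewrite -[RHS](hrho d dD) [in RHS]ec dot_suml.
    by apply: eq_bigr => w _; rewrite dotZl.
  have cv1 : 1 <= (c v)%:R :> R by rewrite ler1n lt0n.
  have rest w : w \in D' -> w != v -> c w = 0%N.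
    move=> wD' wv; apply/eqP; apply: contraT => cw.
    have cw1 : 1 <= (c w)%:R :> R by rewrite ler1n lt0n.
    have wDv : w \in D' `\ v by rewrite in_fsetD1 wv.
    have := ht; rewrite (big_fsetD1 v vD') (big_fsetD1 w wDv) /=.
    have : 0 <= \sum_(u <- (D' `\ v) `\ w) (c u)%:R * dot u rho.
      rewrite big_seq sumr_ge0 // => u; rewrite !in_fsetD1 => /and3P[_ _ uD'].
      by rewrite mulr_ge0 ?ler0n // (le_trans ler01) // pos'.
    move: (\sum_(u <- _) _) => r r0; have := pos' v vD'; have := pos' w wD'.
    move: cv1 cw1; move: (c v)%:R (c w)%:R (dot v rho) (dot w rho) => x y z t.
    by move=> x1 y1 t1 z1 e; clear -r0 x1 y1 t1 z1 e; nra.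
  have : d = (c v)%:R *: v.
    rewrite ec (big_fsetD1 v vD') /= big_seq big1 ?addr0 // => w.
    by rewrite in_fsetD1 => /andP[wv wD']; rewrite rest // scale0r.
  by move/(pos_prop rootPhi simD' dp' (simple_pos simD' vD')) => ->.
have card (F : {fset V}) : simple_roots Phi F -> #|` F| = \dim (rspan Phi).
  by move=> sF; have /andP[/eqP <- /eqnP ->] := simple_basis sF.
by apply/esym/eqP; rewrite eqEfcard sub (card D' simD') (card D simD) leqnn.
Qed.

End SimpleUnique.

Section Localization.
Variables (R : realType) (l : nat) (Phi D Sigma : {fset 'rV[R]_l}).
Local Notation V := 'rV[R]_l.
Hypotheses (rootPhi : root_system Phi) (simD : simple_roots Phi D).
Hypothesis subS : Sigma `<=` positive_roots Phi D.
Implicit Types (a b g x : V) (X : {vspace V}).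

Lemma localizationP (Psi : {fset V}) X a :
  reflect (a \in Psi /\ forall x, x \in X -> dot a x = 0) (a \in localization Psi X).
Proof.
by rewrite !inE /=; apply: (iffP andP) => -[aP h]; split=> //; apply/asboolP.
Qed.

Lemma localization_root X : root_system (localization Phi X).
Proof.
split.
- by apply/negP => /localizationP[h _]; move: (root_neq0 rootPhi); rewrite h.
- by move=> a c /localizationP[aP _] /localizationP[caP _]; exact: (root_reduced rootPhi aP).
- move=> a b /localizationP[aP aX] /localizationP[bP bX]; apply/localizationP.
  split=> [|x xX]; first exact: (root_reflection rootPhi).
  by rewrite /reflection dotBl dotZl aX // bX // mulr0 subrr.
- by move=> a b /localizationP[aP _] /localizationP[bP _]; exact: (root_integral rootPhi).
Qed.

Lemma localization_no_triple X : no_triple Phi -> no_triple (localization Phi X).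
Proof. by move=> no3 a b /localizationP[aP _] /localizationP[bP _]; exact: no3. Qed.

(** The vector with value 1 on all of [D] is regular for the localization and selects the induced
    positive roots. *)
Lemma localization_simple X : exists DX, simple_roots (localization Phi X) DX /\
  positive_roots (localization Phi X) DX = localization (positive_roots Phi D) X.
Proof.
have [rho _ hrho] := simple_point simD (fun=> 1).
have rho_pos a : a \in positive_roots Phi D -> 0 < dot a rho.
  by move=> ap; apply: (pos_gt0 rootPhi ap) => d /hrho ->.
have rho_nz a : a \in localization Phi X -> dot a rho != 0.
  move=> /localizationP[aP _]; case: (pos_or_neg rootPhi simD aP) => /rho_pos.
    by move/gt_eqF ->.
  by rewrite dotNl oppr_gt0 => /lt_eqF ->.
have [DX sDX pDX] := simple_exists (localization_root X) rho_nz.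
exists DX; split=> //; apply/fsetP => a; apply/idP/idP.
  move/pDX => [/localizationP[aP aX] a0]; apply/localizationP; split=> //.
  case: (pos_or_neg rootPhi simD aP) => // /rho_pos; rewrite dotNl oppr_gt0 => a0'.
  by move: a0; rewrite ltNge ltW.
move=> /localizationP[ap aX]; apply/pDX; split; last exact: rho_pos.
by apply/localizationP; split=> //; exact: pos_root ap.
Qed.

Lemma localization_sub X : localization Sigma X `<=` localization (positive_roots Phi D) X.
Proof.
apply/fsubsetP => a /localizationP[aS aX]; apply/localizationP; split=> //.
exact: (fsubsetP subS).
Qed.

Lemma coclosed_local : negatively_coclosed Phi D Sigma -> locally_compatible2 Phi D Sigma.
Proof.
move=> cocl X _ irrX; have [DX [sDX pDX]] := localization_simple X.
exists DX; split=> //; apply: (coclosed_compatible (localization_root X) irrX sDX).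
  by rewrite pDX localization_sub.
move=> a b1 b2 d1 d2 /localizationP[aS aX]; rewrite pDX.
move=> /localizationP[b1p b1X] /localizationP[b2p b2X] d10 d20 ea Z.
by case: (cocl a b1 b2 d1 d2 aS b1p b2p d10 d20 ea Z) => h; [left|right];
  apply/localizationP.
Qed.

Lemma perp_vspace b1 b2 : b2 != 0 -> (forall c, b1 != c *: b2) ->
  exists X, (\dim X + 2)%N = l /\ forall x, x \in X <-> dot b1 x = 0 /\ dot b2 x = 0.
Proof.
move=> b20 nprop; pose f := linfun (mulmxr (col_mx b1 b2)^T) : 'Hom(V, 'rV[R]_(1 + 1)).
have XP x : x \in lker f <-> dot b1 x = 0 /\ dot b2 x = 0.
  have E b : (x *m b^T == 0) <-> dot b x = 0.
    rewrite dotC; split=> [/eqP e|e]; first by rewrite /dot e mxE.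
    by apply/eqP/matrixP => i j; rewrite !ord1 [RHS]mxE; exact: e.
  rewrite memv_ker lfunE /= tr_col_mx mul_mx_row row_mx_eq0 -E -E.
  by split=> /andP.
exists (lker f); split=> //.
pose P := <<[:: b1; b2]>>%VS.
have dP : \dim P = 2%N.
  have : free [:: b1; b2].
    rewrite free_cons seq1_free b20 andbT span_seq1; apply/negP => /vlineP[c e].
    by move: (nprop c); rewrite e eqxx.
  by move/eqnP => ->.
have lt := dot_cauchy_schwarz_lt b20 nprop.
have disj : (lker f :&: P = 0)%VS.
  apply/eqP; rewrite -subv0; apply/subvP => x; rewrite memv_cap memv0 => /andP[xX xP].
  have [x1 x2] := (XP x).1 xX; apply/eqP; apply: (span_perp0 xP) => v.
  by rewrite !inE => /orP[]/eqP ->.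
(* Orthogonal projection to the plane makes it a complement of the kernel, which gives the
   codimension. *)
have tot : (lker f + P = fullv)%VS.
  apply/vspaceP => x; rewrite memvf; apply/memv_addP.
  have [c1 [c2 [p1 p2]]] := plane_proj x lt.
  exists (x - (c1 *: b1 + c2 *: b2)); first by apply/XP.
  exists (c1 *: b1 + c2 *: b2); last by rewrite subrK.
  by rewrite memvD // memvZ // memv_span // !inE eqxx ?orbT.
have dim_rV : dim 'rV[R]_l = l by exact: mul1n.
by have := dimv_disjoint_sum disj; rewrite tot dimvf dP dim_rV => /esym.
Qed.

Lemma local_coclosed : no_triple Phi -> locally_compatible2 Phi D Sigma ->
  negatively_coclosed Phi D Sigma.
Proof.
move=> no3 lcompat a b1 b2 d1 d2 aS b1p b2p d10 d20 ea Z.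
have [_ nprop] := pos_independent rootPhi simD b1p b2p Z.
have [b1P b2P] := (pos_root b1p, pos_root b2p).
have b20 := root_nz rootPhi b2P.
have lt := dot_cauchy_schwarz_lt b20 nprop.
have [X [dX XP]] := perp_vspace b20 nprop.
have b1X : b1 \in localization Phi X by apply/localizationP; split=> // x /XP[].
have b2X : b2 \in localization Phi X by apply/localizationP; split=> // x /XP[].
have flatX : codim2_flat Phi D X.
  split=> //; exists [fset b1; b2].
    by apply/fsubsetP => b; rewrite in_fset2 => /orP[]/eqP ->.
  move=> x; split=> [/XP[x1 x2] b|h].
    by rewrite in_fset2 => /orP[]/eqP ->.
  by apply/XP; split; apply: h; rewrite in_fset2 eqxx ?orbT.
(* Such a [g] would lie in [X], hence be orthogonal to itself. *)
have perp0 g : g \in localization Phi X -> dot b1 g = 0 -> dot b2 g = 0 -> False.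
  move=> /localizationP[gP gX] g1 g2; have := root_gt0 rootPhi gP.
  by rewrite gX ?ltxx //; apply/XP.
(* In an orthogonal splitting [b1] and [b2] fall on the same side, and [perp0] empties the other. *)
have irrX : irreducible_roots (localization Phi X).
  split; first by apply/fset0Pn; exists b1.
  move=> Psi sPsi orth.
  have bb (b b' : V) : b \in localization Phi X -> b' \in Psi -> dot b b' < 0 -> b \in Psi.
    move=> bX b'S neg; apply: contraT => bS; move: neg.
    by rewrite dotC orth ?ltxx // in_fsetD bS.
  have Z' : dot b2 b1 < 0 by rewrite dotC.
  have [b1S|b1S] := boolP (b1 \in Psi).
    have b2S := bb b2 b1 b2X b1S Z'; right; apply/eqP; rewrite eqEfsubset sPsi /=.
    apply/fsubsetP => g gX; apply: contraT => gS.
    have gD : g \in localization Phi X `\` Psi by rewrite in_fsetD gS.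
    by case: (perp0 g gX); apply: orth.
  have b2S : b2 \notin Psi by apply: contra b1S => h; exact: bb h Z.
  left; apply/eqP; apply: contraT => /fset0Pn[g gS].
  by case: (perp0 g (fsubsetP sPsi g gS)); rewrite dotC; apply: orth => //;
    rewrite in_fsetD ?b1S ?b2S ?b1X ?b2X.
have [DX [sDX pDX cX]] := lcompat X flatX irrX.
have subX : localization Sigma X `<=` positive_roots (localization Phi X) DX.
  by rewrite pDX localization_sub.
have cocl := compatible_coclosed (localization_root X) irrX sDX subX
  (localization_no_triple no3) cX.
have [] := cocl a b1 b2 d1 d2 _ _ _ d10 d20 ea Z.
- apply/localizationP; split=> // x /XP[x1 x2].
  by rewrite ea dotDl !dotZl x1 x2 !mulr0 addr0.
- by rewrite pDX; apply/localizationP; split=> // x /XP[].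
- by rewrite pDX; apply/localizationP; split=> // x /XP[].
- by move/localizationP => [h _]; left.
- by move/localizationP => [h _]; right.
Qed.

(** The only flat of codimension 2 is then 0, where the localization is the whole system. *)
Lemma rank2_local : rspan Phi = fullv -> #|` D| = 2%N -> irreducible_roots Phi ->
  worpitzky_compatible Phi D Sigma <-> locally_compatible2 Phi D Sigma.
Proof.
move=> spanPhi cardD irrPhi.
have dl : l = 2%N.
  have := dimvf 'rV[R]_l; rewrite (_ : dim _ = l); last exact: mul1n.
  rewrite -spanPhi => <-.
  by have /andP[/eqP <- /eqnP ->] := simple_basis simD.
have loc0 (F : {fset V}) : localization F 0%VS = F.
  apply/fsetP => a; apply/localizationP/idP => [[]//|aF]; split=> // x.
  by rewrite memv0 => /eqP ->; rewrite dot0r.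
split=> [compat X [dX _] _|lcompat].
  have -> : X = 0%VS by apply/eqP; rewrite -dimv_eq0 -(eqn_add2r 2) (etrans dX dl).
  by exists D; rewrite !loc0.
have flat0 : codim2_flat Phi D 0%VS.
  split; first by rewrite dimv0 add0n; exact: esym dl.
  exists (positive_roots Phi D) => // x; split=> [|h].
    by rewrite memv0 => /eqP -> a _; rewrite dot0r.
  have xU : x \in rspan Phi by rewrite spanPhi memvf.
  rewrite memv0; apply/eqP; apply: (span_perp0 xU) => a aP.
  case: (pos_or_neg rootPhi simD aP) => /h //.
  by rewrite dotNl => /eqP; rewrite oppr_eq0 => /eqP.
have := lcompat 0%VS flat0; rewrite !loc0 => /(_ irrPhi)[DX [sDX pDX]].
by rewrite (simple_unique rootPhi simD sDX pDX).
Qed.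

End Localization.

(** * The equivalences, with type [G2] treated apart *)

Theorem theorem1p7 (R : realType) (l : nat) (Phi D Sigma : {fset 'rV[R]_l})
    (Phi_root : root_system Phi)
    (Phi_span : rspan Phi = fullv)
    (Phi_irr : irreducible_roots Phi)
    (D_simple : simple_roots Phi D)
    (Sigma_pos : fsubset Sigma (positive_roots Phi D)) :
  (worpitzky_compatible Phi D Sigma <-> locally_compatible2 Phi D Sigma) /\
  (worpitzky_compatible Phi D Sigma <->
     (~ typeG2 D -> negatively_coclosed Phi D Sigma) /\
     (typeG2 D -> negatively_coclosed Phi D Sigma \/ G2_exceptional D Sigma)).
Proof.
have cocl_compat := coclosed_compatible Phi_root Phi_irr D_simple Sigma_pos.
have [G2D|nG2D] := pselect (typeG2 D).
  have [a1 [a2 [eD _ c21]]] := G2D.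
  split.
    apply: rank2_local => //.
    by rewrite eD cardfs2 (G2_simple_neq Phi_root D_simple eD c21).
  split=> [compat|[_ /(_ G2D) [cocl|[b1 [b2 [eD' lt [S [S0 _ eS]]]]]]]].
  - by split=> // _; exact: (G2_compatible_cases Phi_root Phi_irr D_simple eD c21 Sigma_pos).
  - exact: cocl_compat.
  apply: (G2_long_compatible Phi_root Phi_irr D_simple eD c21 Sigma_pos).
  (* [G2_exceptional] names its own simple roots; comparing lengths identifies the long one. *)
  suff <- : b2 = a2 by rewrite eS fset1U1.
  have a1D : a1 \in D by rewrite eD !inE eqxx.
  have a2D : a2 \in D by rewrite eD !inE eqxx orbT.
  have a1P := simple_root D_simple a1D.
  have [_ [d22 _]] := cartan_pair Phi_root a1P (simple_root D_simple a2D) c21.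
  have s0 := root_gt0 Phi_root a1P.
  have : b1 \in D by rewrite eD' !inE eqxx.
  have : b2 \in D by rewrite eD' !inE eqxx orbT.
  rewrite eD !inE => /orP[]/eqP e2 // /orP[]/eqP e1.
    by move: lt; rewrite e1 e2 ltxx.
  by move: lt; rewrite e1 e2 d22 => lt; exfalso; clear -lt s0; lra.
have no3 : no_triple Phi.
  by apply: contrapT => n3; apply: nG2D; exact: (triple_typeG2 Phi_root Phi_irr D_simple).
have compat_cocl := compatible_coclosed Phi_root Phi_irr D_simple Sigma_pos no3.
split; split.
- by move=> /compat_cocl; exact: coclosed_local.
- by move=> /(local_coclosed Phi_root D_simple Sigma_pos no3).
- by move=> /compat_cocl cocl; split.
- by move=> [/(_ nG2D) cocl _]; exact: cocl_compat.
Qed.
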